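(* Let $d\ge 1$, $K\ge 1$ be integers, $T>0$, $B\in\mathbb{R}$, and let $\overline\Pi$, $\Pi_i$, $L$ be the multi-dimensional junction described in the context. Assume that, for each $i\in\{1,\dots,K\}$, the Hamiltonian $H_i=H_i(p,u,x,t)$ is coercive in $p$ uniformly in $x,t$ and for bounded $u$, Lipschitz continuous in $u$ and $t$, and uniformly continuous in $(p,u,x,t)$ for bounded $p$ and $u$. Consider the Kirchhoff-type junction problem $$ \begin{cases} u_{i,t}+H_i(Du_i,u_i,x,t)=0 & \text{in } \Pi_i\times(0,T],\ i=1,\dots,K,\\ \min\Big(\sum_{i=1}^K u_{i,x_i}-B,\ \min_i\big(u_{i,t}+H_i(Du_i,u_i,x,t)\big)\Big)\le 0 & \text{on } L\times(0,T],\\ \max\Big(\sum_{i=1}^K u_{i,x_i}-B,\ \max_i\big(u_{i,t}+H_i(Du_i,u_i,x,t)\big)\Big)\ge 0 & \text{on } L\times(0,T], \end{cases} \qquad (\ast) $$ understood in the generalized viscosity sense. (a) If $u,v\in BUC(\overline\Pi\times[0,T])$ are respectively a sub-solution and a super-solution of $(\ast)$ with $u_i(\cdot,0)\le v_i(\cdot,0)$ on $\overline\Pi_i$ for all $i$, then $u\le v$ on $\overline\Pi\times[0,T]$. (b) For each $u_0\in BUC(\overline\Pi)$, the problem $(\ast)$ together with the initial condition $u(\cdot,0)=u_0$ on $\overline\Pi$ has a unique solution $u\in BUC(\overline\Pi\times[0,T])$.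
   Context: Points of $\mathbb{R}^d$ are written $(x',x_d)$ with $x'\in\mathbb{R}^{d-1}$. For $i=1,\dots,K$, $\overline\Pi_i=\{(x',x_i): x'\in\mathbb{R}^{d-1},\ x_i\le 0\}$ are $K$ closed half-spaces glued together along their common boundary $L=\{(x',0):x'\in\mathbb{R}^{d-1}\}$ (the junction), and $\overline\Pi=\bigcup_{i=1}^K\overline\Pi_i$ is the resulting space; away from $L$ the branches are disjoint. The equation ''in $\Pi_i$'' is meant at the points with $x_i<0$. A function $u$ on $\overline\Pi$ is identified with the tuple $(u_1,\dots,u_K)$ of its restrictions $u_i(x',x_i)$ to $\overline\Pi_i$; all the $u_i$ agree on $L$. $Du_i$ is the full spatial gradient of $u_i$ on the branch $\overline\Pi_i$ (in the variables $(x',x_i)$), $u_{i,x_i}$ is the derivative of $u_i$ in $x_i$ (on $L$ it is the exterior normal derivative), and $u_{i,t}$ is the time derivative. $BUC$ denotes bounded uniformly continuous functions. Each $H_i$ is a real-valued function of $(p,u,x,t)\in\mathbb{R}^d\times\mathbb{R}\times\overline\Pi_i\times[0,T]$; coercive in $p$ uniformly in $x,t$ and for bounded $u$ means that for every $R>0$, $H_i(p,u,x,t)\to+\infty$ as $|p|\to\infty$ uniformly in $x,t$ and $|u|\le R$. Generalized viscosity solutions. Test functions are $\phi\in C(\overline\Pi\times[0,T])$ such that each restriction $\phi_i$ is $C^1$ on $\overline\Pi_i\times[0,T]$ (up to $L$; the derivatives in $x_i$ on $L$ may differ from branch to branch). A function $u\in C(\overline\Pi\times[0,T])$ is a sub-solution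 of $(\ast)$ if, whenever $u-\phi$ has a local maximum over $\overline\Pi\times[0,T]$ at $(x_0,t_0)$ with $t_0\in(0,T]$: if $x_0\in\Pi_i\setminus L$, then $\phi_{i,t}+H_i(D\phi_i,u,x_0,t_0)\le 0$; if $x_0\in L$, then $\min\big(\sum_i\phi_{i,x_i}-B,\ \min_i(\phi_{i,t}+H_i(D\phi_i,u,x_0,t_0))\big)\le 0$ (all evaluated at $(x_0,t_0)$). It is a super-solution if, whenever $u-\phi$ has a local minimum at such $(x_0,t_0)$: if $x_0\in\Pi_i\setminus L$, then $\phi_{i,t}+H_i(D\phi_i,u,x_0,t_0)\ge 0$; if $x_0\in L$, then $\max\big(\sum_i\phi_{i,x_i}-B,\ \max_i(\phi_{i,t}+H_i(D\phi_i,u,x_0,t_0))\big)\ge 0$. A solution is a function that is both a sub- and a super-solution.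
   Formalization: In (b) each H_i is additionally assumed bounded for bounded p and u; without this (b) fails, e.g. d=K=1, H=|p|+|x|, u_0=0 forces u(x,t) ≤ -|x|t, so there is no bounded solution. *)

(* Defs.v *)
From HB Require Import structures.
From mathcomp Require Import all_boot all_order all_algebra.
From mathcomp Require Import all_classical all_reals all_analysis.
Set Implicit Arguments.
Unset Strict Implicit.
Unset Printing Implicit Defensive.
Import Order.TTheory GRing.Theory Num.Theory.
Import numFieldNormedType.Exports.
Local Open Scope classical_set_scope.
Local Open Scope ring_scope.

(* MathComp-Analysis.  R^d is represented as R^(d-1) * R, x = (x', x_d), with
   the norm max(|x'|_oo, |x_d|); all the notions below depend on the norm only
   up to equivalence. *)
Notation spoint R d := (prod 'rV[R]_d.-1 R).

(* Space-time points are pairs (x, t). *)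
Notation stpoint R d := (prod (spoint R d) R).

Section Defs.
Context {R : realType} {d K : nat}.
Implicit Types (T B : R).

Definition half_space : set (spoint R d) := [set x | x.2 <= 0].

Definition cylinder T : set (stpoint R d) :=
  [set z | half_space z.1 /\ 0 <= z.2 <= T].

Definition unif_continuous_on (V : normedModType R) (D : set V) (f : V -> R) :=
  forall e : R, 0 < e -> exists2 r : R, 0 < r &
    forall z w : V, D z -> D w -> `|z - w| < r -> `|f z - f w| < e.

Definition bounded_on (V : normedModType R) (D : set V) (f : V -> R) :=
  exists C : R, forall z : V, D z -> `|f z| <= C.

Definition BUC_on (V : normedModType R) (D : set V) (f : V -> R) :=
  bounded_on D f /\ unif_continuous_on D f.

(* A function on the junction (times [0, T]) is a tuple of functions, one for
   each branch, which agree on L = {x_d = 0}; the values of the components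
   outside the half-space (resp. the cylinder) are irrelevant. *)
Definition glued0 (u : 'I_K -> spoint R d -> R) :=
  forall (i j : 'I_K) (x' : 'rV[R]_d.-1), u i (x', 0) = u j (x', 0).

Definition glued T (u : 'I_K -> stpoint R d -> R) :=
  forall (i j : 'I_K) (x' : 'rV[R]_d.-1) (t : R), 0 <= t <= T ->
    u i ((x', 0), t) = u j ((x', 0), t).

(* Two points on different branches are joined through L, so that (uniform)
   continuity on the junction is (uniform) continuity on each branch. *)
Definition junction_BUC0 (u : 'I_K -> spoint R d -> R) :=
  glued0 u /\ forall i, BUC_on half_space (u i).

Definition junction_BUC T (u : 'I_K -> stpoint R d -> R) :=
  glued T u /\ forall i, BUC_on (cylinder T) (u i).

Definition junction_continuous T (u : 'I_K -> stpoint R d -> R) :=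
  glued T u /\ forall i, {within cylinder T, continuous (u i)}.

Definition dotp (p q : spoint R d) : R :=
  \sum_(k < d.-1) p.1 0 k * q.1 0 k + p.2 * q.2.

(* f is C^1 on the closed cylinder, with spatial gradient Df and time
   derivative ft; on the boundary (x_d = 0, t = 0 or t = T) the derivatives are
   one-sided.  They are uniquely determined on the cylinder when 0 < T. *)
Definition C1_on_cylinder T (f : stpoint R d -> R)
    (Df : stpoint R d -> spoint R d) (ft : stpoint R d -> R) :=
  [/\ {within cylinder T, continuous Df},
      {within cylinder T, continuous ft} &
      forall z, cylinder T z -> forall e : R, 0 < e ->
        \forall w \near within (cylinder T) (nbhs z),
          `|f w - f z - (dotp (Df z) (w.1 - z.1) + ft z * (w.2 - z.2))|
            <= e * `|w - z| ].

Definition test_function T (phi : 'I_K -> stpoint R d -> R)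
    (Dphi : 'I_K -> stpoint R d -> spoint R d)
    (phit : 'I_K -> stpoint R d -> R) :=
  glued T phi /\ forall i, C1_on_cylinder T (phi i) (Dphi i) (phit i).

Definition local_max_on (V : normedModType R) (D : set V) (f : V -> R) (z : V) :=
  \forall w \near within D (nbhs z), f w <= f z.

Definition local_min_on (V : normedModType R) (D : set V) (f : V -> R) (z : V) :=
  \forall w \near within D (nbhs z), f z <= f w.

(* A neighbourhood in the junction of a point off L can be taken inside one
   branch; a neighbourhood of a point of L meets all the branches.
   \big[Num.min/a]_(i < K) F i is min (a, min_i F i), and likewise for max. *)
Definition sub_solution T B
    (H : 'I_K -> spoint R d -> R -> spoint R d -> R -> R)
    (u : 'I_K -> stpoint R d -> R) :=
  junction_continuous T u /\
  forall phi Dphi phit, test_function T phi Dphi phit ->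
    (forall (i : 'I_K) (x : spoint R d) (t : R), x.2 < 0 -> 0 < t <= T ->
       local_max_on (cylinder T) (fun w => u i w - phi i w) (x, t) ->
       phit i (x, t) + H i (Dphi i (x, t)) (u i (x, t)) x t <= 0) /\
    (forall (x' : 'rV[R]_d.-1) (t : R), 0 < t <= T ->
       let x := (x', 0) in
       (forall i : 'I_K,
          local_max_on (cylinder T) (fun w => u i w - phi i w) (x, t)) ->
       \big[Num.min / (\sum_(i < K) (Dphi i (x, t)).2 - B)]_(i < K)
          (phit i (x, t) + H i (Dphi i (x, t)) (u i (x, t)) x t) <= 0).

Definition super_solution T B
    (H : 'I_K -> spoint R d -> R -> spoint R d -> R -> R)
    (u : 'I_K -> stpoint R d -> R) :=
  junction_continuous T u /\
  forall phi Dphi phit, test_function T phi Dphi phit ->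
    (forall (i : 'I_K) (x : spoint R d) (t : R), x.2 < 0 -> 0 < t <= T ->
       local_min_on (cylinder T) (fun w => u i w - phi i w) (x, t) ->
       0 <= phit i (x, t) + H i (Dphi i (x, t)) (u i (x, t)) x t) /\
    (forall (x' : 'rV[R]_d.-1) (t : R), 0 < t <= T ->
       let x := (x', 0) in
       (forall i : 'I_K,
          local_min_on (cylinder T) (fun w => u i w - phi i w) (x, t)) ->
       0 <= \big[Num.max / (\sum_(i < K) (Dphi i (x, t)).2 - B)]_(i < K)
          (phit i (x, t) + H i (Dphi i (x, t)) (u i (x, t)) x t)).

Definition solution T B
    (H : 'I_K -> spoint R d -> R -> spoint R d -> R -> R)
    (u : 'I_K -> stpoint R d -> R) :=
  sub_solution T B H u /\ super_solution T B H u.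

Implicit Type h : spoint R d -> R -> spoint R d -> R -> R.

Definition coercive_ham T h :=
  forall M C : R, exists r : R, forall p u x t,
    cylinder T (x, t) -> `|u| <= M -> r <= `|p| -> C <= h p u x t.

Definition lipschitz_ham T h :=
  exists C : R, forall p u v x s t,
    cylinder T (x, s) -> cylinder T (x, t) ->
    `|h p u x s - h p v x t| <= C * (`|u - v| + `|s - t|).

Definition ham_domain T (M : R) : set (spoint R d * R * stpoint R d) :=
  [set q | [/\ `|q.1.1| <= M, `|q.1.2| <= M & cylinder T q.2]].

Definition uncurry_ham h (q : spoint R d * R * stpoint R d) : R :=
  h q.1.1 q.1.2 q.2.1 q.2.2.

Definition unif_continuous_ham T h :=
  forall M : R, unif_continuous_on (ham_domain T M) (uncurry_ham h).

(* Since x ranges over an unbounded set, this does not follow from uniform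
   continuity: consider h p u x t = |p| + |x|. *)
Definition bounded_ham T h :=
  forall M : R, bounded_on (ham_domain T M) (uncurry_ham h).

End Defs.

(* Main.v *)
Require Import Defs.
From mathcomp Require Import all_boot all_order all_algebra.
From mathcomp Require Import all_classical all_reals all_analysis.
From mathcomp Require Import ring lra.
Set Implicit Arguments.
Unset Strict Implicit.
Unset Printing Implicit Defensive.
Import Order.TTheory GRing.Theory Num.Theory.
Import numFieldNormedType.Exports.
Local Open Scope classical_set_scope.
Local Open Scope ring_scope.

(** Subsolutions are described by jets: g is a jet of f at z if
    f w <= f z + g.(w - z) + o(|w - z|) for the w of the cylinder whose time is at
    most that of z, and jet_sub is the inequality of the problem for all jets. Among
    bounded uniformly continuous functions the sub-solutions are those satisfying it
    (sub_solutionP): quadratic test functions give it for quadratic jets, and the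
    stability of subsolutions (jet_sub_stability) upgrades these to all jets. A function v is a super-solution
    iff - v is a sub-solution for the Hamiltonians - H_i(- p, - u, x, t) and the
    flux - B (super_sub_dual), so only subsolutions have to be studied.

    Comparison. The H_i depend on p in an arbitrary continuous and coercive way,
    differently on each branch, so that the square of the distance is of no use in a
    doubling of variables near L. Instead the tangential variables and the
    time are doubled, while the two points keep the same normal variable x_d. At a
    maximum point of the doubled function, the maximum over each slice x_d = const
    turns u, and likewise - v, into a function of one variable, f and h, with
    f + h <= 0 and f(0) = h(0) = 0, and all the variables of H_i but the normal slope
    may be frozen (envelope). A lemma on functions of one variable
    (slope_separation) then provides an interval of slopes r such that r bounds f
    from above near 0, - r bounds h, and the equation fails strictly for u with
    slope r and for - v with slope - r. Inside a branch, this being done on both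
    sides of the point, one of the two functions has a jet violating its equation.
    On L, there are intervals around r_i of radius s_i > 0 on all branches; the
    equations fail, so that the Kirchhoff conditions must hold, for u with the
    slopes r_i + s_i and for v with the slopes r_i - s_i: the sum of r_i + s_i is at
    most B and that of r_i - s_i at least B, which is absurd
    (doubled_contradiction).

    This argument uses that u is Lipschitz (comparison_lip). A general u is replaced
    by its sup-convolution in time, which is again a subsolution (treg_jet_sub), is
    Lipschitz in time, and is thus Lipschitz in space because H_i is coercive
    (coercive_lipschitz). This gives comparison, in the stronger form that an
    initial excess c of u over v grows at most like c exp(lam t).

    Existence. For Lipschitz data u0, the functions u0 - theta and u0 + theta with
    theta(t) = C (exp(lam t) - 1) are a sub- and a super-solution
    (barrier_jet_sub). The subsolutions above the first and with initial values at
    most u0 lie below the second, by comparison; their sup-convolutions in time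
    have the same properties and are Lipschitz with a common constant. Hence there is
    a greatest one (perron_max). It is a super-solution, since otherwise it could be
    increased near some point by its maximum with a paraboloid (perron_super). For
    u0 bounded and uniformly continuous, one takes the uniform limit of the
    solutions for Lipschitz approximations of u0; comparison makes them converge,
    and stability shows that the limit is a solution (existence). *)

(** * Scalar products and norms in space-time *)

Section Inner.
Context {R : realType} {d : nat}.
Implicit Types (g w z : stpoint R d) (p q : spoint R d).

Definition ip g w : R := dotp g.1 w.1 + g.2 * w.2.
Definition sqn w : R := ip w w.

Lemma dotpC p q : dotp p q = dotp q p.
Proof.
by rewrite /dotp mulrC; congr (_ + _); apply: eq_bigr => k _; rewrite mulrC.
Qed.

Lemma dotpDl p p' q : dotp (p + p') q = dotp p q + dotp p' q.
Proof.
rewrite /dotp /= mulrDl [RHS]addrACA -big_split /=; congr (_ + _).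
by apply: eq_bigr => k _; rewrite mxE mulrDl.
Qed.

Lemma dotpZl (a : R) p q : dotp (a *: p) q = a * dotp p q.
Proof.
rewrite /dotp /= mulrDr mulr_sumr !mulrA; congr (_ + _).
by apply: eq_bigr => k _; rewrite mxE mulrA.
Qed.

Lemma ipC g w : ip g w = ip w g.
Proof. by rewrite /ip dotpC mulrC. Qed.

Lemma ipDl g g' w : ip (g + g') w = ip g w + ip g' w.
Proof. by rewrite /ip /= dotpDl mulrDl addrACA. Qed.

Lemma ipZl (a : R) g w : ip (a *: g) w = a * ip g w.
Proof. by rewrite /ip /= dotpZl -[a *: g.2]/(a * g.2) [RHS]mulrDr mulrA. Qed.

Lemma ipDr g w w' : ip g (w + w') = ip g w + ip g w'.
Proof. by rewrite !(ipC g) ipDl. Qed.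

Lemma ipZr (a : R) g w : ip g (a *: w) = a * ip g w.
Proof. by rewrite !(ipC g) ipZl. Qed.

Lemma ipNl g w : ip (- g) w = - ip g w.
Proof. by rewrite -scaleN1r ipZl mulN1r. Qed.

Lemma ipNr g w : ip g (- w) = - ip g w.
Proof. by rewrite !(ipC g) ipNl. Qed.

Lemma ipBl g g' w : ip (g - g') w = ip g w - ip g' w.
Proof. by rewrite ipDl ipNl. Qed.

Lemma ipBr g w w' : ip g (w - w') = ip g w - ip g w'.
Proof. by rewrite ipDr ipNr. Qed.

Lemma ip0l w : ip 0 w = 0.
Proof. by rewrite -(scale0r (0 : stpoint R d)) ipZl mul0r. Qed.

Lemma ip0r g : ip g 0 = 0.
Proof. by rewrite ipC ip0l. Qed.

Definition ipE := (ipDl, ipDr, ipNl, ipNr, ipZl, ipZr, ip0l, ip0r).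

Lemma sqnD w z : sqn (w + z) = sqn w + 2 * ip w z + sqn z.
Proof. rewrite /sqn !ipE (ipC z w); ring. Qed.

Lemma sqnN w : sqn (- w) = sqn w.
Proof. by rewrite /sqn !ipE opprK. Qed.

Lemma sqnB w z : sqn (w - z) = sqn w - 2 * ip w z + sqn z.
Proof. by rewrite sqnD sqnN !ipE; ring. Qed.

Lemma sqnZ (a : R) w : sqn (a *: w) = a ^+ 2 * sqn w.
Proof. by rewrite /sqn !ipE mulrA. Qed.

Lemma sqn0 : sqn (0 : stpoint R d) = 0.
Proof. by rewrite /sqn ip0l. Qed.

Lemma sqnE w : sqn w = \sum_(k < d.-1) w.1.1 0 k ^+ 2 + w.1.2 ^+ 2 + w.2 ^+ 2.
Proof. by []. Qed.

Lemma sqn_ge0 w : 0 <= sqn w.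
Proof.
rewrite sqnE; apply: addr_ge0; last exact: sqr_ge0.
by apply: addr_ge0; [apply: sumr_ge0 => k _|]; exact: sqr_ge0.
Qed.

Lemma stnormE w : `|w| = Num.max (Num.max `|w.1.1| `|w.1.2|) `|w.2|.
Proof. by []. Qed.

Lemma norm_le_st w (c : R) :
  (`|w| <= c) = [&& `|w.1.1| <= c, `|w.1.2| <= c & `|w.2| <= c].
Proof. by rewrite stnormE !ge_max -andbA. Qed.

Lemma norm1_le w : `|w.1| <= `|w|.
Proof.
by rewrite stnormE -[leLHS]/(Num.max `|w.1.1| `|w.1.2|) le_max lexx.
Qed.
Lemma norm2_le w : `|w.2| <= `|w|.
Proof. by rewrite stnormE le_max lexx orbT. Qed.
Lemma norm12_le w : `|w.1.2| <= `|w|.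
Proof. by rewrite stnormE !le_max lexx orbT. Qed.
Lemma norm11_le w : `|w.1.1| <= `|w|.
Proof. by rewrite stnormE !le_max lexx. Qed.

Lemma row_norm_le n (v : 'rV[R]_n) (c : R) :
  0 <= c -> (`|v| <= c) <-> (forall k, `|v 0 k| <= c).
Proof.
move=> c0; rewrite -[`|v|]/(mx_norm v) mx_normrE; split=> [h k|h].
  by apply: le_trans h; apply: (le_bigmax _ (fun ij => `|v ij.1 ij.2|) (0, k)).
by apply/bigmax_leP; split=> // -[i k] _ /=; rewrite ord1.
Qed.

Lemma sqr_norm_le_sqn w : `|w| ^+ 2 <= sqn w.
Proof.
have h0 : 0 <= \sum_(k < d.-1) w.1.1 0 k ^+ 2.
  by apply: sumr_ge0 => k _; exact: sqr_ge0.
have sqle (x : R) : x ^+ 2 <= sqn w -> `|x| <= Num.sqrt (sqn w).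
  by move=> h; rewrite -sqrtr_sqr ler_sqrt // sqn_ge0.
rewrite -[leRHS]sqr_sqrtr ?sqn_ge0 // ler_sqr ?nnegrE ?sqrtr_ge0 //.
rewrite norm_le_st; apply/and3P; split.
- apply/row_norm_le; rewrite ?sqrtr_ge0 // => k; apply: sqle.
  rewrite sqnE (bigD1 k) //= -!addrA lerDl.
  rewrite addr_ge0 ?sumr_ge0 // => [j _|]; first exact: sqr_ge0.
  by rewrite addr_ge0 ?sqr_ge0.
- apply: sqle; rewrite sqnE; have := sqr_ge0 w.2; lra.
- apply: sqle; rewrite sqnE; have := sqr_ge0 w.1.2; lra.
Qed.

Lemma sqr_time_le_sqn w : w.2 ^+ 2 <= sqn w.
Proof.
rewrite sqnE lerDr addr_ge0 ?sqr_ge0 // sumr_ge0 // => k _; exact: sqr_ge0.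
Qed.

(** The number of coordinates of space-time (for d at least 1), which bounds the ratio
    of the squared Euclidean norm to the squared sup norm. *)
Definition dimn : R := d.-1.+2%:R.

Lemma dimn_gt0 : 0 < dimn.
Proof. by rewrite /dimn ltr0n. Qed.

Lemma dimn_ge1 : 1 <= dimn.
Proof. by rewrite /dimn ler1n. Qed.

Lemma ip_le g w : `|ip g w| <= dimn * `|g| * `|w|.
Proof.
have e : dimn * `|g| * `|w| =
   \sum_(k < d.-1) `|g| * `|w| + `|g| * `|w| + `|g| * `|w|.
  rewrite sumr_const card_ord /dimn -mulr_natl; set n := d.-1.
  rewrite -[n.+2]addn2 natrD; ring.
rewrite e /ip /dotp.
apply: le_trans (ler_normD _ _) _; rewrite lerD //; last first.
  by rewrite normrM ler_pM // norm2_le.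
apply: le_trans (ler_normD _ _) _; rewrite lerD //; last first.
  by rewrite normrM ler_pM // norm12_le.
apply: le_trans (ler_norm_sum _ _ _) _; apply: ler_sum => k _.
rewrite normrM ler_pM //.
  by apply: le_trans (norm11_le g);
    exact: (row_norm_le g.1.1 (normr_ge0 _)).1 (lexx _) k.
by apply: le_trans (norm11_le w);
    exact: (row_norm_le w.1.1 (normr_ge0 _)).1 (lexx _) k.
Qed.

Lemma sqn_le w : sqn w <= dimn * `|w| ^+ 2.
Proof. by apply: le_trans (ler_norm _) _; rewrite expr2 mulrA; exact: ip_le. Qed.

End Inner.
Arguments dimn : clear implicits.

(** * Extrema on closed unbounded sets and retraction on the cylinder *)

(** Irrelevant hypotheses slow the arithmetic decision procedure down, so only
    (in)equalities are kept. *)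
Ltac qlra :=
  repeat match goal with
  | H : ?A |- _ => match type of A with Prop => match A with
      | is_true (_ <= _)%O => fail 1 | is_true (_ < _)%O => fail 1
      | _ = _ => fail 1 | _ => clear H end end
  end; lra.

Section Compactness.
Context {R : realType}.

Lemma continuous_of_eps (V : normedModType R) (f : V -> R) :
  (forall z (e : R), 0 < e -> exists2 r : R, 0 < r &
     forall w, `|w - z| < r -> `|f w - f z| < e) -> continuous f.
Proof.
move=> h z; apply/cvgrPdist_lt => e e0; have [r r0 hr] := h z e e0.
near=> w; rewrite distrC; apply: hr; near: w.
by apply/nbhs_normP; exists r => //= w /=; rewrite distrC.
Unshelve. all: end_near. Qed.

Lemma continuous_loc_lip (V : normedModType R) (f : V -> R) :
  (forall z, exists C : R, forall w, `|w - z| < 1 ->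
     `|f w - f z| <= C * `|w - z|) -> continuous f.
Proof.
move=> h; apply: continuous_of_eps => z e e0; have [C hC] := h z.
have C1 : 0 < `|C| + 1 by have := normr_ge0 C; lra.
exists (Num.min 1 (e / (`|C| + 1))); first by rewrite lt_min ltr01 divr_gt0.
move=> w; rewrite lt_min => /andP[w1]; rewrite ltr_pdivlMr // => w2.
apply: le_lt_trans (hC _ w1) _; apply: le_lt_trans w2; rewrite mulrC.
apply: ler_wpM2l => //; have := ler_norm C; lra.
Qed.

Lemma closed_le0 (V : normedModType R) (c : V -> R) :
  continuous c -> closed [set w | c w <= 0].
Proof. by move=> cc; apply: (closed_comp _ (@closed_le R 0)) => w _; exact: cc. Qed.

Definition proper_space (V : normedModType R) :=
  forall r : R, compact [set w : V | `|w| <= r].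

(** Outside a ball the function does not exceed its value at w0, and closed balls are
    compact. *)
Lemma EVT_closed (V : normedModType R) (f : V -> R) (D : set V) w0 (r : R) :
  proper_space V -> continuous f -> closed D -> D w0 ->
  (forall w, D w -> r < `|w| -> f w <= f w0) ->
  exists2 w, D w & forall w', D w' -> f w' <= f w.
Proof.
move=> pV cf cD Dw0 hr.
pose A := [set w : V | `|w| <= Num.max r `|w0|] `&` D.
have cA : compact A by apply: compact_closedI => //; exact: pV.
have [||w wA hw] := compact_EVT_max _ cA _ (f := f).
- by exists w0; split=> //=; rewrite le_max lexx orbT.
- exact: continuous_subspaceT.
have {}wA : A w by move: wA; rewrite inE.
exists w => [|w' Dw']; first by case: wA.
have [h|h] := leP `|w'| (Num.max r `|w0|).
  by apply: hw; rewrite inE; split.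
apply: (@le_trans _ _ (f w0)).
  by apply: hr => //; apply: le_lt_trans h; rewrite le_max lexx.
by apply: hw; rewrite inE; split=> //=; rewrite le_max lexx orbT.
Qed.

Lemma proper_real : proper_space R.
Proof.
move=> r; have := @segment_compact R (- r) r; congr (compact _).
by apply/seteqP; split=> x /=; rewrite in_itv/= ler_norml.
Qed.

Lemma proper_row n : proper_space ('rV[R]_n).
Proof.
move=> r; apply: bounded_closed_compact.
  by exists r; split; [exact: num_real|move=> x rx w /= /le_trans; apply; exact: ltW].
have : closed (Num.norm @^-1` [set x : R | x <= r] : set 'rV[R]_n).
  apply: (closed_comp _ (@closed_le R r)) => w _; exact: norm_continuous.
by [].
Qed.

Lemma proper_prod (U V : normedModType R) :
  proper_space U -> proper_space V -> proper_space (U * V)%type.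
Proof.
move=> pU pV r; have := compact_setX (pU r) (pV r); congr (compact _).
apply/seteqP; split=> -[x y] /=.
  by move=> -[hx hy]; rewrite -[leLHS]/(Num.max `|x| `|y|) ge_max hx hy.
by rewrite -[leLHS]/(Num.max `|x| `|y|) ge_max => /andP[].
Qed.

Lemma proper_st d : proper_space (stpoint R d).
Proof.
apply: proper_prod; last exact: proper_real.
apply: proper_prod; [exact: proper_row|exact: proper_real].
Qed.

End Compactness.

Section Cyl.
Context {R : realType} {d : nat}.
Implicit Types (g w z : stpoint R d).

Lemma continuous_ip g : continuous (ip g).
Proof.
apply: continuous_loc_lip => z; exists (dimn R d * `|g|) => w _.
by rewrite -ipBr; exact: ip_le.
Qed.

Lemma continuous_sqn : continuous (@sqn R d).
Proof.
apply: continuous_loc_lip => z; exists (dimn R d * (2 * `|z| + 1)) => w w1.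
have -> : sqn w - sqn z = ip (w - z + 2 *: z) (w - z).
  by rewrite -{1}(subrK z w) sqnD /sqn !ipE (ipC w z); ring.
apply: le_trans (ip_le _ _) _; apply: ler_wpM2r => //.
apply: ler_wpM2l; first exact/ltW/dimn_gt0.
by apply: le_trans (ler_normD _ _) _; rewrite normrZ ger0_norm //; lra.
Qed.

Lemma continuous_xd : continuous (fun w : stpoint R d => w.1.2).
Proof.
apply: continuous_loc_lip => z; exists 1 => w _; rewrite mul1r.
exact: (norm12_le (w - z)).
Qed.

Lemma continuous_time : continuous (fun w : stpoint R d => w.2).
Proof.
apply: continuous_loc_lip => z; exists 1 => w _; rewrite mul1r.
exact: (norm2_le (w - z)).
Qed.

(** Retraction on the cylinder: f \o clamp T is a globally continuous function that
    agrees with f where it matters. *)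
Definition clamp (T : R) w : stpoint R d :=
  ((w.1.1, Num.min w.1.2 0), Num.max 0 (Num.min w.2 T)).

Lemma clamp_cylinder T w : 0 <= T -> cylinder T (clamp T w).
Proof.
move=> T0; split; rewrite /half_space /= ?ge_min ?lexx ?orbT //.
by rewrite le_max lexx /= ge_max T0 ge_min lexx orbT.
Qed.

Lemma clamp_id T w : cylinder T w -> clamp T w = w.
Proof.
case: w => -[x' x] t [/= hx /andP[t0 tT]]; rewrite /clamp /=.
by rewrite (min_l hx) (min_l tT) max_r.
Qed.

Lemma dist_minr (a b c : R) : `|Num.min a c - Num.min b c| <= `|a - b|.
Proof.
have := ler_norm (a - b); have := ler_norm (- (a - b)).
rewrite normrN => h1 h2; rewrite ler_norml.
by case: (leP a c) => ?; case: (leP b c) => ?; apply/andP; split; lra.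
Qed.

Lemma dist_maxr (a b c : R) : `|Num.max c a - Num.max c b| <= `|a - b|.
Proof.
have := ler_norm (a - b); have := ler_norm (- (a - b)).
rewrite normrN => h1 h2; rewrite ler_norml.
by case: (leP c a) => ?; case: (leP c b) => ?; apply/andP; split; lra.
Qed.

Lemma clamp_lip T w z : `|clamp T w - clamp T z| <= `|w - z|.
Proof.
rewrite norm_le_st /=; apply/and3P; split; first exact: (norm11_le (w - z)).
  exact: le_trans (dist_minr _ _ _) (norm12_le (w - z)).
apply: le_trans (dist_maxr _ _ _) _.
exact: le_trans (dist_minr _ _ _) (norm2_le (w - z)).
Qed.

Lemma continuous_clamp T (f : stpoint R d -> R) : 0 <= T ->
  unif_continuous_on (cylinder T) f -> continuous (f \o clamp T).
Proof.
move=> T0 uf; apply: continuous_of_eps => z e e0.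
have [r r0 hr] := uf e e0; exists r => // w wz /=.
apply: hr; [exact: clamp_cylinder|exact: clamp_cylinder|].
exact: le_lt_trans (clamp_lip _ _ _) wz.
Qed.

Lemma closed_cyl (tau T : R) :
  closed [set w : stpoint R d | w.1.2 <= 0 /\ tau <= w.2 <= T].
Proof.
have -> : [set w : stpoint R d | w.1.2 <= 0 /\ tau <= w.2 <= T] =
  [set w | w.1.2 <= 0] `&` ([set w | tau - w.2 <= 0] `&` [set w | w.2 - T <= 0]).
  by apply/seteqP; split=> w /=; rewrite !subr_le0; [move=> [? /andP[]]|move=> [? [-> ->]]].
apply: closedI; first exact/closed_le0/continuous_xd.
apply: closedI; apply/closed_le0 => w.
  by apply: cvgB; [exact: cvg_cst|exact: continuous_time].
by apply: cvgB; [exact: continuous_time|exact: cvg_cst].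
Qed.

End Cyl.

(** * Jets and viscosity inequalities *)

Lemma within_normP (R : realType) (V : normedModType R) (D : set V) (P : V -> Prop) (z : V) :
  (\forall w \near within D (nbhs z), P w) <->
  exists2 r : R, 0 < r & forall w, D w -> `|w - z| < r -> P w.
Proof.
split=> [h|[r r0 hr]].
  have /nbhs_normP[r /= r0 hr] : nbhs z (fun w => D w -> P w) by exact: h.
  by exists r => // w Dw wz; apply: hr => //=; rewrite distrC.
suff : nbhs z (fun w => D w -> P w) by [].
by apply/nbhs_normP; exists r => //= w /=; rewrite distrC => wz Dw; exact: hr.
Qed.

Section Jets.
Context {R : realType} {d K : nat}.
Implicit Types (g w z : stpoint R d) (f : stpoint R d -> R) (u : 'I_K -> stpoint R d -> R).
Implicit Types (T B tau : R) (H : 'I_K -> spoint R d -> R -> spoint R d -> R -> R).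

(** Only the past of z is tested, so that a bound valid for w.2 <= z.2 alone provides a
    jet. This costs nothing: a maximum can be pushed strictly into the past
    (perturbed_max). *)
Definition jet T f z g := forall e : R, 0 < e -> exists2 r : R, 0 < r &
  forall w, cylinder T w -> w.2 <= z.2 -> `|w - z| < r ->
    f w <= f z + ip g (w - z) + e * `|w - z|.

Definition qjet T f z g := exists C : R, exists2 r : R, 0 < r &
  forall w, cylinder T w -> `|w - z| < r ->
    f w <= f z + ip g (w - z) + C * sqn (w - z).

Definition ham_at H i z g (c : R) : R := g.2 + H i g.1 c z.1 z.2.

(** On the junction the space-time gradients on the branches only differ in the normal
    slope r. *)
Definition tgrad (p' : 'rV[R]_d.-1) (r a : R) : stpoint R d := ((p', r), a).

(** J is the notion of jet. On the junction the jets on the branches have the same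
    tangential gradient and time derivative, because test functions are glued there. *)
Definition gen_sub (J : (stpoint R d -> R) -> stpoint R d -> stpoint R d -> Prop)
    T tau B H u :=
  (forall i z g, z.1.2 < 0 -> tau < z.2 <= T -> J (u i) z g ->
     ham_at H i z g (u i z) <= 0) /\
  (forall z p' (r : 'I_K -> R) a, z.1.2 = 0 -> tau < z.2 <= T ->
     (forall i, J (u i) z (tgrad p' (r i) a)) ->
     \sum_i r i <= B \/ exists i, ham_at H i z (tgrad p' (r i) a) (u i z) <= 0).

Definition jet_sub T := gen_sub (jet T) T.
Definition qjet_sub T := gen_sub (qjet T) T.

(** The Hamiltonian of the problem solved by the opposite of a solution. *)
Definition dual_ham H i p (c : R) x t := - H i (- p) (- c) x t.

Lemma qjet_one_sided T f z g :
  (exists C : R, exists2 r : R, 0 < r & forall w, cylinder T w -> w.2 <= z.2 ->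
    `|w - z| < r -> f w <= f z + ip g (w - z) + C * sqn (w - z)) -> jet T f z g.
Proof.
move=> [C [r r0 hr]] e e0.
have D0 := dimn_gt0 (R := R) (d := d).
have C1 : 0 < `|C| * dimn R d + 1.
  by rewrite ltr_pwDr // mulr_ge0 // ltW.
exists (Num.min r (e / (`|C| * dimn R d + 1))).
  by rewrite lt_min r0 divr_gt0.
move=> w cw wz; rewrite lt_min => /andP[w1]; rewrite ltr_pdivlMr // => w2.
apply: le_trans (hr w cw wz w1) _; rewrite lerD2l.
apply: (@le_trans _ _ (`|C| * (dimn R d * `|w - z| ^+ 2))).
  apply: le_trans (ler_norm _) _; rewrite normrM ler_wpM2l //.
  by rewrite ger0_norm ?sqn_ge0 // sqn_le.
rewrite mulrA expr2 mulrA ler_wpM2r //; apply: le_trans (ltW w2).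
by rewrite mulrC ler_wpM2l // lerDl.
Qed.

Lemma qjet_jet T f z g : qjet T f z g -> jet T f z g.
Proof.
move=> [C [r r0 hr]]; apply: qjet_one_sided; exists C, r => // w cw _; exact: hr.
Qed.

Lemma jet_sub_qjet_sub T tau B H u : jet_sub T tau B H u -> qjet_sub T tau B H u.
Proof.
move=> [h1 h2]; split=> [i z g z0 zt /qjet_jet|z p' r a z0 zt hJ]; first exact: h1.
by apply: h2 => // i; exact/qjet_jet.
Qed.

Lemma bigmin_le0 (x0 : R) (F : 'I_K -> R) :
  \big[Num.min/x0]_(i < K) F i <= 0 <-> x0 <= 0 \/ exists i, F i <= 0.
Proof.
split=> [|[h|[i h]]].
- apply: contraPP => /not_orP[/negP h0 /forallNP h]; apply/negP; rewrite -!ltNge in h0 *.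
  elim/big_ind : _ => //= [x y x0' y0|i _]; first by rewrite lt_min x0'.
  by rewrite ltNge; apply/negP/h.
- exact: le_trans (bigmin_le_id _ _ _ _) h.
- exact: le_trans (bigmin_le_cond _ _ _) h.
Qed.

Lemma bigmax_ge0 (x0 : R) (F : 'I_K -> R) :
  0 <= \big[Num.max/x0]_(i < K) F i <-> 0 <= x0 \/ exists i, 0 <= F i.
Proof.
split=> [|[h|[i h]]].
- apply: contraPP => /not_orP[/negP h0 /forallNP h]; apply/negP; rewrite -!ltNge in h0 *.
  elim/big_ind : _ => //= [x y x0' y0|i _]; first by rewrite gt_max x0'.
  by rewrite ltNge; apply/negP/h.
- exact: le_trans h (bigmax_ge_id _ _ _ _).
- exact: le_trans h (le_bigmax_cond _ _ _).
Qed.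

Lemma local_max_jet T f phi Dphi phit z :
  C1_on_cylinder T phi Dphi phit -> cylinder T z ->
  local_max_on (cylinder T) (fun w => f w - phi w) z ->
  jet T f z (Dphi z, phit z).
Proof.
move=> [_ _ h] cz /within_normP[r r0 hr] e e0.
have /within_normP[s s0 hs] := h z cz e e0.
exists (Num.min r s); first by rewrite lt_min r0.
move=> w cw _; rewrite lt_min => /andP[/(hr w cw) h1 /(hs w cw) h2].
move: h2; rewrite -[X in _ - X](_ : ip (Dphi z, phit z) (w - z) = _) //.
rewrite ler_norml => /andP[_ h2]; lra.
Qed.

(** Two differentiable functions that agree on the junction have the same derivatives
    along it; for the time derivative at t = T one can only move backwards. *)
Lemma test_function_tangent T phi Dphi phit (i j : 'I_K) (x' : 'rV[R]_d.-1) (t : R) :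
  test_function T phi Dphi phit -> 0 < t <= T ->
  (Dphi i ((x', 0), t)).1 = (Dphi j ((x', 0), t)).1 /\
  phit i ((x', 0), t) = phit j ((x', 0), t).
Proof.
move=> [gl hC] /andP[t0 tT]; set z := ((x', 0), t).
have cz : cylinder T z by split; rewrite /half_space //= (ltW t0).
pose g k : stpoint R d := (Dphi k z, phit k z).
have key (e : R) : 0 < e -> exists2 r : R, 0 < r & forall w, cylinder T w -> w.1.2 = 0 ->
    `|w - z| < r -> `|ip (g i - g j) (w - z)| <= e * `|w - z|.
  move=> e0; have [_ _ /(_ z cz (e / 2)) hi] := hC i.
  have [_ _ /(_ z cz (e / 2)) hj] := hC j.
  have e2 : 0 < e / 2 by lra.
  have /within_normP[r r0 hr] := hi e2; have /within_normP[s s0 hs] := hj e2.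
  exists (Num.min r s); first by rewrite lt_min r0.
  move=> w cw w0; rewrite lt_min => /andP[/(hr w cw) h1 /(hs w cw) h2].
  rewrite ipBl; move: h1 h2.
  rewrite -[X in _ - X](_ : ip (g i) (w - z) = _) //.
  rewrite -[X in `|phi j _ - _ - X|](_ : ip (g j) (w - z) = _) //.
  have -> : phi i w = phi j w.
    case: w w0 cw {hr hs} => -[w' wx] wt /= -> [_ /= wt0]; exact: gl.
  have -> : phi i z = phi j z by apply: gl; rewrite (ltW t0).
  rewrite !ler_norml => /andP[h1 h2] /andP[h3 h4]; apply/andP; split; lra.
have small (c M : R) : (forall e : R, 0 < e -> exists2 r : R, 0 < r &
    forall s : R, 0 < s -> s < r -> s * c <= e * (s * M)) -> 0 <= c -> 0 <= M -> c = 0.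
  move=> h c0 M0; apply/eqP; rewrite eq_le c0 andbT leNgt; apply/negP => cp.
  have [|r r0 hr] := h (c / (2 * (M + 1))).
    by rewrite divr_gt0 //; lra.
  have := hr (r / 2); rewrite divr_gt0 // => /(_ isT) H0.
  have : r / 2 * c <= c / (2 * (M + 1)) * (r / 2 * M) by apply: H0; lra.
  rewrite leNgt => /negP; apply.
  have M1 : 0 < M + 1 by lra.
  rewrite (mulrCA _ (r / 2) M) ltr_pM2l; last lra.
  rewrite mulrAC ltr_pdivrMr; last lra.
  by rewrite ltr_pM2l //; lra.
split.
- have [e|e] := eqVneq (Dphi i z).1 (Dphi j z).1; first by [].
  set v := (Dphi i z).1 - (Dphi j z).1.
  pose V : stpoint R d := ((v, 0), 0).
  have gV : ip (g i - g j) V = sqn V.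
    rewrite /sqn /ip /dotp /= !mulr0 !addr0; apply: eq_bigr => k _.
    by rewrite !mxE.
  have nV : `|V| = `|v|.
    by rewrite stnormE /= normr0 (max_l (normr_ge0 _)) (max_l (normr_ge0 _)).
  have : sqn V = 0.
    apply: (small _ `|V|) => //; last exact: sqn_ge0.
    move=> e' e0; have [r r0 hr] := key e' e0.
    exists (r / (`|V| + 1)); first by rewrite divr_gt0 // ltr_wpDl.
    move=> s s0; rewrite ltr_pdivlMr ?ltr_wpDl // => sr.
    have zV : z + s *: V - z = s *: V by rewrite addrAC subrr add0r.
    have s0' : s *: (0 : R) = 0 by rewrite -[LHS]/(s * 0) mulr0.
    have : `|ip (g i - g j) (z + s *: V - z)| <= e' * `|z + s *: V - z|.
      apply: hr; rewrite ?zV.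
      + by split; rewrite /half_space /= !s0' ?addr0 //= (ltW t0).
      + by rewrite /= s0' addr0.
      + rewrite normrZ (gtr0_norm s0); apply: le_lt_trans sr.
        by rewrite ler_wpM2l ?ltW // ltrDl.
    rewrite zV normrZ (gtr0_norm s0) ipZr gV ger0_norm //.
    by rewrite mulr_ge0 ?sqn_ge0 // ltW.
  have := sqr_norm_le_sqn V; move=> h1 h2; move: h1; rewrite h2 nV.
  rewrite real_exprn_even_le0 ?num_real //= normr_eq0 subr_eq0 => /eqP ev.
  exact: ev.
- set c := phit i z - phit j z.
  have [//|] := eqVneq (phit i z) (phit j z); rewrite -subr_eq0 -/c => cn0.
  exfalso; move: cn0; rewrite -normr_eq0 => /negP; apply; apply/eqP.
  apply: (small _ 1) => // e e0; have [r r0 hr] := key e e0.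
  exists (Num.min r t); first by rewrite lt_min r0.
  move=> s s0; rewrite lt_min => /andP[sr st].
  pose V : stpoint R d := ((0, 0), - s).
  have nV : `|V| = s.
    by rewrite stnormE /= !normr0 maxxx normrN gtr0_norm // max_r // ltW.
  have := hr (z + V); rewrite [_ + _ - z]addrAC subrr add0r nV.
  have -> : ip (g i - g j) V = - (s * c).
    rewrite /ip /dotp /= big1 => [|k _]; last by rewrite [X in _ * X]mxE mulr0.
    by rewrite mulr0 !add0r mulrN mulrC.
  rewrite normrN normrM (gtr0_norm s0) mulr1; apply => //=.
  + split; rewrite /half_space /= ?addr0 //; apply/andP; split; lra.
  + by rewrite addr0.
Qed.

(** The gradient of a test function at a local maximum point is a jet. *)
Lemma jet_sub_solution T B H u :
  glued T u -> (forall i, {within cylinder T, continuous (u i)}) ->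
  jet_sub T 0 B H u -> sub_solution T B H u.
Proof.
move=> gl cu [h1 h2]; split=> // phi Dphi phit tf; split=> [i x t x0 tT lm|x' t tT x lm].
  apply: (h1 i (x, t) (Dphi i (x, t), phit i (x, t))) => //.
  apply: local_max_jet lm; first exact: tf.2.
  split; first exact: ltW.
  by case/andP: tT => /ltW -> /=.
apply/bigmin_le0; rewrite subr_le0.
have [K0 _|i0] := pickP (fun _ : 'I_K => true); last first.
  have [i|hB|[i]] := h2 (x, t) 0 (fun=> 0) 0 erefl tT.
  - by have := i0 i.
  - by left; move: hB; rewrite !big1 // => i; have := i0 i.
  - by have := i0 i.
pose p' := (Dphi K0 (x, t)).1; pose a := phit K0 (x, t).
have tg i : (Dphi i (x, t), phit i (x, t)) = tgrad p' (Dphi i (x, t)).2 a.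
  have [e1 e2] := test_function_tangent i K0 x' tf tT.
  by rewrite /tgrad /p' /a -e1 -e2; case: (Dphi i (x, t)).
have [|hs|[i hi]] := h2 (x, t) p' (fun i => (Dphi i (x, t)).2) a erefl tT.
- move=> i; rewrite -tg; apply: local_max_jet (lm i); first exact: tf.2.
  by split; rewrite /half_space //=; case/andP: tT => /ltW -> /=.
- by left.
- by right; exists i; move: hi; rewrite -tg.
Qed.

Definition quad g z (C : R) w : R := ip g (w - z) + C * sqn (w - z).
Definition quad_grad g z (C : R) w : stpoint R d := g + (2 * C) *: (w - z).

Lemma quad_expand g z C w0 w : quad g z C w - quad g z C w0
  - ip (quad_grad g z C w0) (w - w0) = C * sqn (w - w0).
Proof.
rewrite /quad /quad_grad.
rewrite /sqn !ipE (ipC w0 w) (ipC z w) (ipC z w0); ring.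
Qed.

(** The affine-plus-quadratic functions are test functions whose second-order expansion
    is exact (quad_expand). *)
Lemma quad_C1 T g z C : C1_on_cylinder T (quad g z C)
  (fun w => (quad_grad g z C w).1) (fun w => (quad_grad g z C w).2).
Proof.
have cg : continuous (quad_grad g z C).
  move=> w; apply: cvgD; first exact: cvg_cst.
  by apply: cvgZr; apply: cvgB; [exact: cvg_id|exact: cvg_cst].
split.
- apply: continuous_subspaceT => w; apply: (cvg_comp _ fst (cg w)); exact: cvg_fst.
- apply: continuous_subspaceT => w; apply: (cvg_comp _ snd (cg w)); exact: cvg_snd.
- move=> w0 cw0 e e0; apply/within_normP.
  have D0 := dimn_gt0 (R := R) (d := d).
  have C1 : 0 < `|C| * dimn R d + 1 by rewrite ltr_pwDr // mulr_ge0 // ltW.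
  exists (e / (`|C| * dimn R d + 1)); first by rewrite divr_gt0.
  move=> w cw; rewrite ltr_pdivlMr // => wz.
  rewrite -[X in _ - X](_ : ip (quad_grad g z C w0) (w - w0) = _) // quad_expand.
  rewrite normrM (ger0_norm (sqn_ge0 _)).
  apply: (@le_trans _ _ (`|C| * (dimn R d * `|w - w0| ^+ 2))).
    by rewrite ler_wpM2l // sqn_le.
  rewrite mulrA expr2 mulrA ler_wpM2r //; apply: le_trans (ltW wz).
  by rewrite mulrC ler_wpM2l // lerDl.
Qed.

Lemma qjet_local_max T f z g : qjet T f z g ->
  exists C, local_max_on (cylinder T) (fun w => f w - quad g z C w) z.
Proof.
move=> [C [r r0 hr]]; exists C; apply/within_normP; exists r => // w cw wz.
rewrite /quad subrr ip0r sqn0 mulr0 addr0 subr0; have := hr w cw wz; lra.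
Qed.

Lemma quad_grad_self g z C : quad_grad g z C z = g.
Proof. by rewrite /quad_grad subrr scaler0 addr0. Qed.

Lemma sqn_le_quad T f z g C C' : C <= C' ->
  local_max_on (cylinder T) (fun w => f w - quad g z C w) z ->
  local_max_on (cylinder T) (fun w => f w - quad g z C' w) z.
Proof.
move=> CC' /within_normP[r r0 hr]; apply/within_normP; exists r => // w cw wz.
have := hr w cw wz; rewrite /quad !subrr !ip0r !sqn0 !mulr0.
have : C * sqn (w - z) <= C' * sqn (w - z) by rewrite ler_wpM2r // sqn_ge0.
lra.
Qed.

(** A quadratic jet is touched by a polynomial test function; on the junction the
    polynomials of the branches are glued because they share their tangential
    coefficients. *)
Lemma sub_solution_qjet T B H u : sub_solution T B H u -> qjet_sub T 0 B H u.
Proof.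
move=> [[gl _] hu]; split=> [i z g z0 zt /qjet_local_max[C hC]|z p' r a z0 zt hJ].
  have [h _] := hu (fun=> quad g z C) (fun=> fun w => (quad_grad g z C w).1)
    (fun=> fun w => (quad_grad g z C w).2)
    (conj (fun i j x' t _ => erefl) (fun=> quad_C1 T g z C)).
  case: z z0 zt hC h => x t x0 tT hC /(_ i x t x0 tT hC).
  by rewrite quad_grad_self.
have [C hC] : exists C, forall i, local_max_on (cylinder T)
    (fun w => u i w - quad (tgrad p' (r i) a) z C w) z.
  have /boolp.choice[C hC] := fun i => qjet_local_max (hJ i).
  exists (\big[Num.max/0]_i C i) => i; apply: sqn_le_quad (hC i).
  exact: le_bigmax.
pose G i := tgrad p' (r i) a.
have tf : test_function T (fun i => quad (G i) z C)
    (fun i w => (quad_grad (G i) z C w).1) (fun i w => (quad_grad (G i) z C w).2).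
  split=> [i j x' t _|i]; last exact: quad_C1.
  by rewrite /quad /ip /dotp /= z0 subrr !mulr0.
have [_ h] := hu _ _ _ tf.
case: z z0 zt hJ hC tf h => -[x' x] t; rewrite [X in X = _]/= => -> tT hJ hC tf /(_ x' t tT hC).
move=> /bigmin_le0[|[i]].
  rewrite subr_le0; under eq_bigr do rewrite quad_grad_self /=; by left.
by rewrite quad_grad_self; right; exists i.
Qed.

Lemma test_functionN T (phi : 'I_K -> stpoint R d -> R) Dphi phit :
  test_function T phi Dphi phit ->
  test_function T (fun i w => - phi i w) (fun i w => - Dphi i w) (fun i w => - phit i w).
Proof.
move=> [gl hC]; split=> [i j x' t tT|i]; first by rewrite (gl i j).
have [c1 c2 c3] := hC i; split.
- by move=> w; apply: cvgN; exact: c1.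
- by move=> w; apply: cvgN; exact: c2.
- move=> z cz e e0; apply: filterS (c3 z cz e e0) => w hw.
  have dN : dotp (- Dphi i z) (w.1 - z.1) = - dotp (Dphi i z) (w.1 - z.1).
    by rewrite -scaleN1r dotpZl mulN1r.
  by apply: le_trans hw; rewrite -[leRHS]normrN dN le_eqVlt; apply/orP; left;
    apply/eqP; congr (Num.norm _); ring.
Qed.

(** Changing the sign of the function and of the test functions exchanges maxima and
    minima, hence the two generalized boundary conditions. *)
Lemma super_sub_dual T B H v :
  super_solution T B H v <-> sub_solution T (- B) (dual_ham H) (fun i w => - v i w).
Proof.
have lmm D (f1 f2 : stpoint R d -> R) z : (forall w, f1 w = - f2 w) ->
    local_max_on D f1 z -> local_min_on D f2 z.
  move=> e; apply: filterS => w; rewrite !e; lra.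
have lmm' D (f1 f2 : stpoint R d -> R) z : (forall w, f1 w = - f2 w) ->
    local_min_on D f1 z -> local_max_on D f2 z.
  move=> e; apply: filterS => w; rewrite !e; lra.
have [dP dN] : (forall i p c x t, H i (- p) c x t = - dual_ham H i p (- c) x t) /\
    (forall i p c x t, H i p c x t = - dual_ham H i (- p) (- c) x t).
  by split=> *; rewrite /dual_ham !opprK.
split=> -[[gl cv] h]; (split; [split=> [i j x' t tT|i]|]).
- by rewrite (gl i j).
- by move=> w; apply: cvgN; exact: cv.
- move=> phi Dphi phit /test_functionN /h[h1 h2]; split=> [i x t x0 tT lm|x' t tT x lm].
    have := h1 i x t x0 tT; rewrite dP -opprD oppr_ge0; apply.
    by apply: lmm lm => w; rewrite opprB addrC.
  have : forall i, local_min_on (cylinder T) (fun w => v i w - - phi i w) (x, t).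
    by move=> i; apply: lmm (lm i) => w; rewrite opprB addrC.
  move=> /(h2 x' t tT) /bigmax_ge0 hh; apply/bigmin_le0.
  case: hh => [hB|[i hi]]; [left|right; exists i].
    by move: hB; rewrite sumrN; lra.
  by move: hi; rewrite dP -opprD oppr_ge0.
- by rewrite -[LHS]opprK (gl i j) // opprK.
- have -> : v i = (fun w => - - v i w) by apply/funext => w; rewrite opprK.
  by move=> w; apply: cvgN; exact: cv.
- move=> phi Dphi phit /test_functionN /h[h1 h2]; split=> [i x t x0 tT lm|x' t tT x lm].
    rewrite dN -[phit _ _]opprK -opprD oppr_ge0; apply: h1 => //.
    by apply: lmm' lm => w; rewrite opprB opprK addrC.
  have : forall i, local_max_on (cylinder T) (fun w => - v i w - - phi i w) (x, t).
    by move=> i; apply: lmm' (lm i) => w; rewrite opprB opprK addrC.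
  move=> /(h2 x' t tT) /bigmin_le0 hh; apply/bigmax_ge0.
  case: hh => [hB|[i hi]]; [left|right; exists i].
    by move: hB; rewrite sumrN; lra.
  by rewrite dN -[phit _ _]opprK -opprD oppr_ge0.
Qed.

End Jets.

(** * Stability of the subsolution property *)

Section Stability.
Context {R : realType} {d K : nat}.
Implicit Types (g w z y : stpoint R d) (f : stpoint R d -> R) (u : 'I_K -> stpoint R d -> R).
Implicit Types (T B tau : R) (H : 'I_K -> spoint R d -> R -> spoint R d -> R -> R).

Lemma common_radius (P : 'I_K -> R -> Prop) :
  (forall i, exists2 r : R, 0 < r & forall s, 0 < s -> s < r -> P i s) ->
  exists2 r : R, 0 < r & forall i s, 0 < s -> s < r -> P i s.
Proof.
move=> h; have /choice[r hr] : forall i, exists r : R, 0 < r /\ forall s, 0 < s -> s < r -> P i s.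
  by move=> i; have [r r0 hr] := h i; exists r.
exists (\big[Num.min/1]_i r i).
  by elim/big_ind : _ => // [x y x0 y0|i _]; [rewrite lt_min x0|case: (hr i)].
move=> i s s0 sr; apply: (hr i).2 => //; apply: lt_le_trans sr _.
exact: bigmin_le_cond.
Qed.

Lemma ham_continuous T (h : spoint R d -> R -> spoint R d -> R -> R) g z (c e : R) :
  unif_continuous_ham T h -> cylinder T z -> 0 < e ->
  exists2 r : R, 0 < r & forall g' z' (c' : R), cylinder T z' ->
    `|g'.1 - g.1| < r -> `|c' - c| < r -> `|z' - z| < r ->
    `|h g'.1 c' z'.1 z'.2 - h g.1 c z.1 z.2| < e.
Proof.
move=> hu cz e0; pose M := `|g.1| + `|c| + 1.
have [r r0 hr] := hu M e e0.
exists (Num.min 1 r); first by rewrite lt_min ltr01.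
move=> g' z' c' cz'; rewrite !lt_min => /andP[g1 gr] /andP[c1 cr] /andP[_ zr].
have gn := normr_ge0 g.1; have cn := normr_ge0 c.
have := hr (g'.1, c', z') (g.1, c, z); apply.
- split=> //=; rewrite /M.
    by rewrite -[g'.1](subrK g.1); apply: le_trans (ler_normD _ _) _; qlra.
  by rewrite -[c'](subrK c); apply: le_trans (ler_normD _ _) _; qlra.
- by split=> //=; rewrite /M; qlra.
- have hh : Num.max `|g'.1 - g.1| `|c' - c| < r by rewrite gt_max; apply/andP.
  rewrite -[ltLHS]/(Num.max (Num.max `|g'.1 - g.1| `|c' - c|) `|z' - z|).
  by rewrite gt_max; apply/andP.
Qed.

(** The last term is a barrier at the time of z: it keeps maximum points of w - psi
    strictly in the past of z. *)
Definition psi g z (k mu : R) y : R :=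
  ip g (y - z) + k * sqn (y - z) + mu / (z.2 - y.2).

(** The quadratic term of psi makes the jet strict at distance r, and the barrier in
    time costs little at time z.2 - s. So any w close to f has, near z, a local maximum
    point of w - psi strictly in the past of z, where the one-sidedness of the jet is no
    longer felt. *)
Lemma perturbed_max T f z g (e : R) : cylinder T z -> 0 < z.2 -> 0 < e ->
  jet T f z g -> exists2 r0 : R, 0 < r0 & forall r : R, 0 < r -> r < r0 ->
  forall w : stpoint R d -> R, unif_continuous_on (cylinder T) w ->
    (forall y, cylinder T y -> w y <= f y + e * r / 8) -> f z - e * r / 8 <= w z ->
  exists2 s0 : R, 0 < s0 & forall s : R, 0 < s -> s < s0 ->
  exists z' : stpoint R d, [/\ cylinder T z', z'.2 < z.2, `|z' - z| < r,
    (forall y, cylinder T y -> y.2 < z.2 -> `|y - z| <= r ->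
      w y - psi g z (2 * e / r) (s ^+ 2) y <= w z' - psi g z (2 * e / r) (s ^+ 2) z') &
    `|w z' - f z| <= r * (dimn R d * `|g| + 2 * e)].
Proof.
move=> cz z0 e0 hj; have [r0 r00 hr0] := hj e e0.
exists r0 => // r rp rr0 w uw wu wz.
set del := e * r / 8 in wu wz *.
have del0 : 0 < del by rewrite /del divr_gt0 // mulr_gt0.
have er8 : e * r = 8 * del by rewrite /del; qlra.
set k := 2 * e / r.
have k0 : 0 < k by rewrite /k divr_gt0 //; qlra.
have [rho rho0 hrho] := uw del del0.
pose A := `|g.2| + k + 1.
have A1 : 1 <= A by rewrite /A; have := normr_ge0 g.2; qlra.
have A0 : 0 < A by qlra.
exists (\big[Num.min/1]_(i <- [:: rho; z.2; r; del / A; e * r + 5 * del]) i).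
  rewrite !big_cons big_nil !lt_min rho0 z0 rp ltr01 divr_gt0 //=; qlra.
move=> s sp; rewrite !big_cons big_nil !lt_min.
move=> /and5P[srho sz sr sA /andP[ser s1]].
set mu := s ^+ 2; have mu0 : 0 < mu by rewrite exprn_gt0.
have er0 : 0 < e * r + 5 * del by qlra.
(* between the times z.2 - nu and z.2 the barrier exceeds all the other terms *)
pose nu := mu / (e * r + 5 * del).
have nu0 : 0 < nu by rewrite divr_gt0.
have nus : nu < s.
  by rewrite /nu /mu ltr_pdivrMr // expr2 ltr_pM2l.
have munu : mu / nu = e * r + 5 * del.
  by rewrite /nu invf_div mulrCA divff ?mulr1 // gt_eqF.
have zT : z.2 <= T by case: cz => _ /andP[].
have ub y : cylinder T y -> y.2 < z.2 -> `|y - z| <= r ->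
    w y - psi g z k mu y <= f z + 9 * del - k * `|y - z| ^+ 2 - mu / (z.2 - y.2).
  move=> cy yz yr; have h1 := wu y cy.
  have h2 := hr0 y cy (ltW yz) (le_lt_trans yr rr0).
  have h3 : e * `|y - z| <= e * r by rewrite ler_wpM2l // ltW.
  have h4 : k * `|y - z| ^+ 2 <= k * sqn (y - z).
    by rewrite ler_wpM2l ?(ltW k0) // sqr_norm_le_sqn.
  rewrite /psi; qlra.
(* the competitor: at this time the barrier mu / s is equal to s, which is small *)
pose zr : stpoint R d := (z.1, z.2 - s).
have zrz : zr - z = (0, - s) :> stpoint R d.
  by rewrite /zr -[LHS]/(z.1 - z.1, z.2 - s - z.2) subrr addrAC subrr add0r.
have nzr : `|zr - z| = s.
  by rewrite zrz stnormE /= !normr0 maxxx normrN gtr0_norm // max_r // ltW.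
have czr : cylinder T zr.
  case: cz => hz _; split=> //=; apply/andP; split; qlra.
have vr : f z - 3 * del <= w zr - psi g z k mu zr.
  have h1 : `|w zr - w z| < del by apply: hrho => //; rewrite nzr.
  have h2 : psi g z k mu zr = - (s * g.2) + k * s ^+ 2 + s.
    rewrite /psi zrz /ip sqnE /ip /dotp /= !big1 => [|i _|i _]; rewrite ?mxE ?mulr0 ?expr0n //.
    rewrite (_ : z.2 - (z.2 - s) = s); last by ring.
    rewrite /mu (_ : s ^+ 2 / s = s); last by rewrite expr2 mulfK // gt_eqF.
    rewrite /= mulr0n; ring.
  have h3 : psi g z k mu zr <= s * A.
    rewrite h2 /A; have : - (s * g.2) <= s * `|g.2|.
      by rewrite -mulrN ler_wpM2l ?(ltW sp) //; rewrite -normrN ler_norm.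
    have : k * s ^+ 2 <= s * k by rewrite mulrC ler_wpM2r ?(ltW k0) // expr2 ler_piMl ?ltW.
    qlra.
  have h4 : s * A <= del by move: sA; rewrite ltr_pdivlMr // => /ltW.
  move: h1; rewrite ltr_norml => /andP[h1 _]; qlra.
pose F y := (w \o clamp T) y - (ip g (y - z) + k * sqn (y - z) + mu * (Num.max nu (z.2 - y.2))^-1).
have FE y : cylinder T y -> y.2 <= z.2 - nu -> F y = w y - psi g z k mu y.
  move=> cy yn; rewrite /F /= clamp_id // /psi max_r //; qlra.
have T0 : 0 <= T by qlra.
have cF : continuous F.
  move=> y; apply: cvgB; first exact: continuous_clamp.
  have cyz : (y' - z @[y' --> y]) --> y - z by apply: cvgB; [exact: cvg_id|exact: cvg_cst].
  apply: cvgD; first apply: cvgD.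
  - by apply: (cvg_comp _ _ cyz); exact: continuous_ip.
  - by apply: cvgMr; apply: (cvg_comp _ _ cyz); exact: continuous_sqn.
  - apply: cvgMr; apply: cvgV; first by rewrite gt_eqF // lt_max nu0.
    have : continuous (fun y : stpoint R d => Num.max nu (z.2 - y.2)).
      apply: continuous_loc_lip => x; exists 1 => x' _; rewrite mul1r.
      apply: le_trans (dist_maxr _ _ _) _.
      rewrite (_ : z.2 - x'.2 - (z.2 - x.2) = - (x' - x).2); last by rewrite /=; ring.
      by rewrite normrN; exact: norm2_le.
    by apply.
pose D := [set y : stpoint R d | y.1.2 <= 0 /\ 0 <= y.2 <= z.2 - nu] `&` [set y | `|y - z| - r <= 0].
have cD : closed D.
  apply: closedI; first exact: closed_cyl.
  apply: closed_le0 => y; apply: cvgB; last exact: cvg_cst.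
  by apply: cvg_norm; apply: cvgB; [exact: cvg_id|exact: cvg_cst].
have Dzr : D zr.
  split; last by rewrite /= nzr; qlra.
  by case: czr => h /andP[h1 h2]; split=> //=; apply/andP; split; [qlra|rewrite /zr /=; qlra].
have [|z' [[x0 /andP[t0 t1]] /= zr'] hmax] := EVT_closed (w0 := zr) (r := `|z| + r) (@proper_st R d) cF cD Dzr.
  move=> y [_ /= hy]; rewrite -{1}(subrK z y) => /lt_le_trans /(_ (ler_normD _ _)); qlra.
have cz' : cylinder T z' by split=> //=; rewrite t0 /=; qlra.
have DcE y : D y -> F y = w y - psi g z k mu y.
  case=> -[? /andP[? ?]] _; apply: FE => //.
  by split=> //; apply/andP; split => //; qlra.
have Dz' : D z' by split=> //=; rewrite t0 t1.
have val : f z - 3 * del <= w z' - psi g z k mu z'.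
  by rewrite -DcE //; apply: le_trans vr _; rewrite -DcE //; exact: hmax.
have z'z : z'.2 < z.2 by qlra.
have mup : 0 < mu / (z.2 - z'.2) by rewrite divr_gt0 // subr_gt0.
have z'r : `|z' - z| <= r by qlra.
exists z'; split=> //.
- rewrite lt_neqAle z'r andbT; apply/negP => /eqP er.
  have := ub z' cz' z'z z'r; rewrite er.
  have -> : k * r ^+ 2 = 16 * del.
    by rewrite /k expr2 mulrA divfK ?gt_eqF //; qlra.
  qlra.
- move=> y cy yz yr; have [yn|yn] := leP y.2 (z.2 - nu).
    have Dy : D y by case: cy => hy /andP[h1 h2]; split=> /=; [rewrite h1 yn|qlra].
    by rewrite -!DcE //; exact: hmax.
  apply: le_trans val; apply: le_trans (ub y cy yz yr) _.
  have : mu / nu <= mu / (z.2 - y.2).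
    by rewrite ler_wpM2l ?(ltW mu0) // lef_pV2 ?posrE; qlra.
  have : 0 <= k * `|y - z| ^+ 2 by rewrite mulr_ge0 ?(ltW k0) // sqr_ge0.
  rewrite munu; qlra.
- have gb : `|ip g (z' - z)| <= dimn R d * `|g| * r.
    apply: le_trans (ip_le _ _) _; rewrite ler_wpM2l //.
    by rewrite mulr_ge0 //; exact/ltW/dimn_gt0.
  have h1 := wu z' cz'.
  have h2 := hr0 z' cz' (ltW z'z) (le_lt_trans z'r rr0).
  have h3 : e * `|z' - z| <= e * r by rewrite ler_wpM2l // ltW.
  have h4 : 0 <= k * sqn (z' - z) by rewrite mulr_ge0 ?(ltW k0) // sqn_ge0.
  move: gb val; rewrite ler_norml /psi => /andP[g1 g2] val.
  rewrite ler_norml; apply/andP; split; qlra.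
Qed.

Definition psi_grad g z (k mu : R) y : stpoint R d :=
  g + (2 * k) *: (y - z) + (0, mu / (z.2 - y.2) ^+ 2).

(** psi is smooth in the past of z. *)
Lemma psi_qjet T (w : stpoint R d -> R) g z (k mu r : R) z' :
  0 <= mu -> z'.2 < z.2 -> `|z' - z| < r ->
  (forall y, cylinder T y -> y.2 < z.2 -> `|y - z| <= r ->
     w y - psi g z k mu y <= w z' - psi g z k mu z') ->
  qjet T w z' (psi_grad g z k mu z').
Proof.
move=> mu0 z'z z'r hm; set s' := z.2 - z'.2.
have s0 : 0 < s' by rewrite subr_gt0.
exists (k + 2 * mu / s' ^+ 3), (Num.min (r - `|z' - z|) (s' / 2)).
  by rewrite lt_min subr_gt0 z'r divr_gt0.
move=> y cy; rewrite lt_min => /andP[yr ys].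
have yz : `|y - z| <= r.
  have -> : y - z = (y - z') + (z' - z) by rewrite addrA subrK.
  by apply: le_trans (ler_normD _ _) _; qlra.
have tt := le_lt_trans (norm2_le (y - z')) ys.
have {}tt : `|y.2 - z'.2| < s' / 2 := tt.
move: (tt); rewrite ltr_norml => /andP[t1 t2].
have sy : s' / 2 < z.2 - y.2 by move: t2; rewrite /s'; qlra.
have := hm y cy _ yz; rewrite -subr_gt0 => /(_ _)/wrap[]; first by qlra.
move=> h.
have e1 : ip g (y - z) + k * sqn (y - z) - (ip g (z' - z) + k * sqn (z' - z)) =
    ip (g + (2 * k) *: (z' - z)) (y - z') + k * sqn (y - z').
  rewrite /sqn !ipE (ipC z' y) (ipC z y) (ipC z z'); ring.
have e2 : mu / (z.2 - y.2) - mu / s' <=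
    mu / s' ^+ 2 * (y.2 - z'.2) + 2 * mu / s' ^+ 3 * sqn (y - z').
  have -> : mu / (z.2 - y.2) - mu / s' = mu / s' ^+ 2 * (y.2 - z'.2) +
      mu / ((z.2 - y.2) * s' ^+ 2) * (y.2 - z'.2) ^+ 2.
    rewrite /s'; field; rewrite !gt_eqF //; qlra.
  rewrite lerD2l; apply: ler_pM; [|exact: sqr_ge0| |].
  - by rewrite divr_ge0 // mulr_ge0 ?sqr_ge0 //; qlra.
  - have -> : 2 * mu / s' ^+ 3 = mu / (s' / 2 * s' ^+ 2) by field; rewrite gt_eqF.
    rewrite ler_wpM2l // lef_pV2 ?posrE.
    + by rewrite ler_wpM2r ?sqr_ge0 // ltW.
    + by rewrite mulr_gt0 ?exprn_gt0 //; qlra.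
    + by rewrite mulr_gt0 ?exprn_gt0 //; qlra.
  - exact: (sqr_time_le_sqn (y - z')).
have e3 : ip (psi_grad g z k mu z') (y - z') =
    ip (g + (2 * k) *: (z' - z)) (y - z') + mu / s' ^+ 2 * (y.2 - z'.2).
  rewrite /psi_grad ipDl; congr (_ + _); rewrite /ip /dotp /= big1 => [|i _].
    by rewrite mul0r !add0r.
  by rewrite mxE mul0r.
have e4 : (k + 2 * mu / s' ^+ 3) * sqn (y - z') =
    k * sqn (y - z') + 2 * mu / s' ^+ 3 * sqn (y - z') by rewrite mulrDl.
rewrite e3 e4; move: h e1 e2; rewrite /psi -/s'; clear.
move: (2 * mu / s' ^+ 3 * _) (mu / s' ^+ 2 * _) (k * sqn (y - z')) (mu / s')
  (mu / _) => A1 A2 A3 A4 A5; move: (ip _ (y - z')) (k * _) (k * _) => *; qlra.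
Qed.

End Stability.

Section StabilityTheorem.
Context {R : realType} {d K : nat}.
Implicit Types (g w z y : stpoint R d) (f : stpoint R d -> R) (u : 'I_K -> stpoint R d -> R).
Implicit Types (T B tau : R) (H : 'I_K -> spoint R d -> R -> spoint R d -> R -> R).

(** The barrier increases the time slope by an unbounded but nonnegative amount, which
    can only worsen a violated inequality. *)
Lemma psi_grad_close g z (e r mu : R) z' : 0 < e -> 0 < r -> 0 <= mu ->
  `|z' - z| < r -> let G := psi_grad g z (2 * e / r) mu z' in
  `|G.1 - g.1| <= 4 * e /\ g.2 - 4 * e <= G.2.
Proof.
move=> e0 r0 mu0 zr G.
have e4 : `|(2 * (2 * e / r)) *: (z' - z)| <= 4 * e.
  rewrite normrZ ger0_norm; last by rewrite !mulr_ge0 ?invr_ge0 // ltW.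
  have -> : 2 * (2 * e / r) * `|z' - z| = 4 * e * (`|z' - z| / r) by ring.
  rewrite -[leRHS]mulr1 ler_wpM2l //; first by clear -e0; lra.
  by rewrite ler_pdivrMr // mul1r ltW.
split.
  rewrite (_ : G.1 - g.1 = ((2 * (2 * e / r)) *: (z' - z)).1).
    exact: le_trans (norm1_le _) e4.
  by rewrite /G /psi_grad /= addr0 addrAC subrr add0r.
rewrite /G /psi_grad /=.
have h1 := le_trans (norm2_le _) e4.
have {}h1 : `|2 * (2 * e / r) * (z'.2 - z.2)| <= 4 * e := h1.
have h2 : 0 <= mu / (z.2 - z'.2) ^+ 2 by rewrite divr_ge0 ?sqr_ge0.
rewrite -[_ *: (_ - _)]/(2 * (2 * e / r) * (z'.2 - z.2)).
move: h1 h2; move: (_ * (z'.2 - z.2)) (mu / _) => A C; rewrite ler_norml => /andP[h _] h2.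
by clear -h h2; lra.
Qed.

(** The Hamiltonian varies little near the point, and increasing the time slope
    increases the left-hand side of the equation. *)
Lemma ham_robust T H i z g (c : R) : unif_continuous_ham T (H i) -> cylinder T z ->
  0 < ham_at H i z g c -> exists2 r : R, 0 < r & forall s, 0 < s -> s < r ->
  forall z' G (c' : R), cylinder T z' -> `|G.1 - g.1| <= s -> g.2 - s <= G.2 ->
    `|c' - c| <= s -> `|z' - z| <= s -> 0 < ham_at H i z' G c'.
Proof.
move=> hu cz h0; have h2 : 0 < ham_at H i z g c / 2 by rewrite divr_gt0.
have [r r0 hr] := ham_continuous g c hu cz h2.
exists (Num.min r (ham_at H i z g c / 2)); first by rewrite lt_min r0.
move=> s s0; rewrite lt_min => /andP[sr sh] z' G c' cz' h3 h4 h5 h6.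
have := hr G z' c' cz' (le_lt_trans h3 sr) (le_lt_trans h5 sr) (le_lt_trans h6 sr).
rewrite ltr_norml => /andP[h7 _]; move: sh h7; rewrite /ham_at; clear -h4.
by move: (H i G.1 _ _ _) (H i g.1 _ _ _) => A C h1 h7; lra.
Qed.

(** If the inequality failed at a jet of u, it would fail with a margin, hence also at
    the nearby jets of the approximants w given by perturbed_max. On the junction one
    takes the branch where w - psi is largest, so that, if the maximum point falls on
    the junction again, psi touches w there on all branches at once. With w = u this
    turns quadratic jets into arbitrary ones; it also shows that suprema and uniform
    limits of subsolutions are subsolutions. *)
Lemma jet_sub_stability T tau B H u : 0 <= tau -> (0 < K)%N ->
  (forall i, unif_continuous_ham T (H i)) -> glued T u ->
  (forall i0 z (delta : R), cylinder T z -> 0 < delta -> exists w : 'I_K -> stpoint R d -> R, [/\ glued T w,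
     forall i, unif_continuous_on (cylinder T) (w i), qjet_sub T tau B H w,
     forall i y, cylinder T y -> w i y <= u i y + delta &
     u i0 z - delta <= w i0 z]) ->
  jet_sub T tau B H u.
Proof.
move=> tau0 K0 hH gu happ; pose i0 := Ordinal K0; split=> [i z g zx /andP[taut tT] hj|z p' ra a zx /andP[taut tT] hj].
  have cz : cylinder T z.
    by split; [exact: ltW|apply/andP; split => //; exact: le_trans tau0 (ltW taut)].
  rewrite leNgt; apply/negP => hpos.
  have [rho rho0 hrho] := ham_robust (hH i) cz hpos.
  pose e := rho / 8.
  have e0 : 0 < e by rewrite divr_gt0.
  have [r0 r00 hr0] := perturbed_max cz (le_lt_trans tau0 taut) e0 hj.
  set A := dimn R d * `|g| + 2 * e in hr0.
  have A0 : 0 < A.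
    by rewrite ltr_wpDl ?mulr_gt0 ?mulr_ge0 // ltW ?dimn_gt0.
  pose m := \big[Num.min/1]_(i <- [:: r0; rho / 2; rho / (2 * A); - z.1.2; z.2 - tau]) i.
  have m0 : 0 < m.
    by rewrite /m !big_cons big_nil !lt_min r00 ltr01 !divr_gt0 ?mulr_gt0 //= oppr_gt0 zx subr_gt0 taut.
  pose r := m / 2.
  have r_gt0 : 0 < r by rewrite divr_gt0.
  have : r < m by clear -m0; rewrite /r; lra.
  rewrite {1}/m !big_cons big_nil !lt_min => /and5P[rr0 rrho rA rz /andP[rt _]].
  have del0 : 0 < e * r / 8 by rewrite divr_gt0 // mulr_gt0.
  have [w [gw uw qw wu wz]] := happ i z _ cz del0.
  have [s0 s00 hs] := hr0 r r_gt0 rr0 (w i) (uw i) (wu i) wz.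
  have s02 : s0 / 2 < s0 by clear -s00; lra.
  have s0p : 0 < s0 / 2 by rewrite divr_gt0.
  have [z' [cz' z'z z'r hm hw]] := hs (s0 / 2) s0p s02.
  have qj := psi_qjet (sqr_ge0 _) z'z z'r hm.
  have [G1 G2] := psi_grad_close g e0 r_gt0 (sqr_ge0 (s0 / 2)) z'r.
  have : 0 < ham_at H i z' (psi_grad g z (2 * e / r) ((s0 / 2) ^+ 2) z') (w i z').
    have e4 : 4 * e = rho / 2 by rewrite /e; clear; lra.
    rewrite e4 in G1 G2.
    apply: (hrho (rho / 2)) => //; [exact: divr_gt0|by clear -rho0; lra| |].
      apply: le_trans hw _; rewrite -/A; apply: ltW.
      move: rA; rewrite ltr_pdivlMr ?mulr_gt0 // => hh; clear -hh; lra.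
    exact/ltW/(lt_trans z'r).
  rewrite ltNge => /negP; apply; apply: qw.1 => //.
  - have := le_lt_trans (norm12_le (z' - z)) z'r; rewrite /= ltr_norml => /andP[_ h].
    by clear -h rz; lra.
  - have := le_lt_trans (norm2_le (z' - z)) z'r; rewrite /= ltr_norml => /andP[h _].
    by case: cz' => _ /andP[_ ->]; rewrite andbT; clear -h rt; lra.
have cz : cylinder T z.
  by split; [rewrite /half_space /= zx|apply/andP; split => //; exact: le_trans tau0 (ltW taut)].
have [hB|hB] := leP (\sum_i ra i) B; first by left.
have [[i hi]|/forallNP hn] := pselect (exists i, ham_at H i z (tgrad p' (ra i) a) (u i z) <= 0).
  by right; exists i.
exfalso; pose G i := tgrad p' (ra i) a.
have [rho rho0 hrho] : exists2 r : R, 0 < r & forall i s, 0 < s -> s < r ->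
  forall z' g (c' : R), cylinder T z' -> `|g.1 - (G i).1| <= s -> (G i).2 - s <= g.2 ->
    `|c' - u i z| <= s -> `|z' - z| <= s -> 0 < ham_at H i z' g c'.
  by apply: common_radius => i; apply: ham_robust => //; rewrite ltNge; apply/negP/hn.
pose Kr : R := K%:R + 1.
have Kr0 : 0 < Kr by rewrite ltr_wpDl.
pose e := Num.min (rho / 8) ((\sum_i ra i - B) / (5 * Kr)).
have e0 : 0 < e by rewrite lt_min !divr_gt0 ?subr_gt0 ?mulr_gt0.
have z0 : 0 < z.2 := le_lt_trans tau0 taut.
have [r0 r00 hr0] := common_radius (fun i => perturbed_max cz z0 e0 (hj i)).
pose A := \sum_i (dimn R d * `|G i| + 2 * e) + 1.
have Ai i : dimn R d * `|G i| + 2 * e <= A.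
  rewrite /A (bigD1 i) //= -addrA lerDl addr_ge0 // sumr_ge0 // => j _.
  by rewrite addr_ge0 ?mulr_ge0 // ltW // dimn_gt0.
have A0 : 0 < A.
  rewrite ltr_wpDl // sumr_ge0 // => j _.
  by rewrite addr_ge0 ?mulr_ge0 // ltW // dimn_gt0.
pose m := \big[Num.min/1]_(i <- [:: r0; rho / 2; rho / (2 * A); z.2 - tau]) i.
have m0 : 0 < m.
  by rewrite /m !big_cons big_nil !lt_min r00 ltr01 !divr_gt0 ?mulr_gt0 //= subr_gt0 taut.
pose r := m / 2.
have r_gt0 : 0 < r by rewrite divr_gt0.
have : r < m by clear -m0; rewrite /r; lra.
rewrite {1}/m !big_cons big_nil !lt_min => /and5P[rr0 rrho rA rt _].
have del0 : 0 < e * r / 8 by rewrite divr_gt0 // mulr_gt0.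
have [w [gw uw qw wu wz]] := happ i0 z _ cz del0.
have geq (v : 'I_K -> stpoint R d -> R) i j y : glued T v -> cylinder T y -> y.1.2 = 0 -> v i y = v j y.
  by case: y => -[y' yx] t gv [_ /= yt] ->; exact: gv.
have [s0 s00 hs] := common_radius (fun i => hr0 i r r_gt0 rr0 (w i) (uw i) (wu i) 
  ltac:(rewrite (geq u i i0) // (geq w i i0) //)).
have s02 : s0 / 2 < s0 by clear -s00; lra.
have s0p : 0 < s0 / 2 by rewrite divr_gt0.
have /choice[zi hzi] := fun i => hs i (s0 / 2) s0p s02.
set k := 2 * e / r in hzi; set mu := (s0 / 2) ^+ 2 in hzi.
(* the branch with the largest maximum *)
have [j _ hjmax] := @Order.TotalTheory.arg_maxP _ _ _ i0 xpredT (fun i => w i (zi i) - psi (G i) z k mu (zi i)) isT.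
have [cz' z'z z'r hm hw] := hzi j.
set z' := zi j in cz' z'z z'r hm hw.
have clo i : `|w i z' - u i z| <= r * A -> 0 < ham_at H i z' (psi_grad (G i) z k mu z') (w i z').
  move=> hwi; have [G1 G2] := psi_grad_close (G i) e0 r_gt0 (sqr_ge0 (s0 / 2)) z'r.
  have e4 : 4 * e <= rho / 2 by have : e <= rho / 8 by [rewrite ge_min lexx]; clear; lra.
  apply: (hrho i (rho / 2)) => //; [exact: divr_gt0|by clear -rho0; lra| | | |].
  - exact: le_trans G1 e4.
  - by apply: le_trans G2; rewrite lerD2l lerN2.
  - apply: le_trans hwi _; apply: ltW.
    move: rA; rewrite ltr_pdivlMr ?mulr_gt0 // => hh; clear -hh; lra.
  - exact/ltW/(lt_trans z'r).
have z't : tau < z'.2 <= T.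
  have := le_lt_trans (norm2_le (z' - z)) z'r; rewrite /= ltr_norml => /andP[h _].
  by case: cz' => _ /andP[_ ->]; rewrite andbT; clear -h rt; lra.
have hwj : `|w j z' - u j z| <= r * A.
  by apply: le_trans hw _; apply: ler_wpM2l; [exact: ltW|exact: Ai].
have [x0|x0] := ltP z'.1.2 0.
  have := clo j hwj; rewrite ltNge => /negP; apply; apply: qw.1 => //.
  exact: psi_qjet (sqr_ge0 _) z'z z'r hm.
have {}x0 : z'.1.2 = 0 by apply/eqP; rewrite eq_le x0 andbT; case: cz'.
have psiE i y : y.1.2 = 0 -> psi (G i) z k mu y = psi (G j) z k mu y.
  by move=> y0; rewrite /psi /ip /dotp /= y0 zx subrr !mulr0.
have mu0 : 0 <= mu := sqr_ge0 _.
have qji i : qjet T (w i) z' (psi_grad (G i) z k mu z').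
  apply: (psi_qjet mu0 z'z z'r) => y cy yz yr.
  have [_ _ _ hmi _] := hzi i; apply: le_trans (hmi y cy yz yr) _.
  by rewrite (geq w i j z') // (psiE i z') //; exact: hjmax.
pose Gz := psi_grad (G j) z k mu z'.
have GE i : psi_grad (G i) z k mu z' = tgrad Gz.1.1 (psi_grad (G i) z k mu z').1.2 Gz.2.
  by rewrite /Gz /psi_grad /tgrad.
have [|hs'|[i]] := qw.2 z' Gz.1.1 (fun i => (psi_grad (G i) z k mu z').1.2) Gz.2 x0 z't.
- by move=> i; rewrite -GE.
- have : \sum_i (ra i - 4 * e) <= B.
    apply: le_trans hs'; apply: ler_sum => i _.
    have [G1 _] := psi_grad_close (G i) e0 r_gt0 (sqr_ge0 (s0 / 2)) z'r.
    have : `|(psi_grad (G i) z k mu z').1.2 - ra i| <= `|(psi_grad (G i) z k mu z').1 - (G i).1|.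
      by rewrite -[leRHS]/(Num.max _ `|(psi_grad (G i) z k mu z').1.2 - ra i|) le_max lexx orbT.
    move=> h1; have {h1} := le_trans h1 G1; rewrite ler_norml => /andP[h1 _].
    move: h1; move: (psi_grad _ _ _ _ _).1.2 => q h1; clear -h1; lra.
  rewrite sumrB sumr_const card_ord -mulr_natr => hh.
  have : e <= (\sum_i ra i - B) / (5 * Kr) by rewrite ge_min lexx orbT.
  rewrite ler_pdivlMr ?mulr_gt0 // => h2.
  have : 0 < e * Kr by rewrite mulr_gt0.
  have : e * Kr = e * K%:R + e by rewrite /Kr; ring.
  clear -hh h2 hB e0; nra.
- rewrite -GE leNgt => /negP; apply; apply: clo.
  by rewrite (geq w i j) // (geq u i j).
Qed.

End StabilityTheorem.

(** * Separation of slopes in one variable *)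

Section Slopes.
Context {R : realType}.
Implicit Types (f h F : R -> R).

Definition slopes f : set R :=
  [set r | exists2 eta : R, 0 < eta & forall x, - eta <= x <= 0 -> f x <= r * x].

(** What a viscosity inequality says about a function of one variable: when a parabola
    of bounded slopes, minus f, has an interior minimum in ]a, b[, one of its slopes
    there is good, that is, satisfies the inequality. *)
Definition touching_slopes (eta0 Rb : R) f (good : R -> Prop) :=
  forall r k a b x1, - eta0 <= a -> a < x1 -> x1 < b -> b <= 0 ->
    `|r| + 2 * `|k * a| <= 2 * Rb ->
    f a - (r * a + k * a ^+ 2) < f x1 - (r * x1 + k * x1 ^+ 2) ->
    f b - (r * b + k * b ^+ 2) < f x1 - (r * x1 + k * x1 ^+ 2) ->
    0 <= f x1 - (r * x1 + k * x1 ^+ 2) ->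
    exists2 x, a < x < b & good (r + 2 * k * x).

Lemma slopes_down f r s : slopes f r -> s <= r -> slopes f s.
Proof.
move=> [eta e0 h] sr; exists eta => // x /[dup] /andP[_ x0] /h hx.
by apply: le_trans hx _; rewrite ler_wnM2r.
Qed.

Lemma not_slopes f r : ~ slopes f r -> forall eta : R, 0 < eta ->
  exists2 x, - eta <= x < 0 & r * x < f x \/ 0 < f 0.
Proof.
move=> hn eta e0; have : ~ forall x, - eta <= x <= 0 -> f x <= r * x.
  by move=> h; apply: hn; exists eta.
move=> /existsNP[x /not_implyP[/andP[x1 x2] /negP]]; rewrite -ltNge => hx.
move: x2; rewrite le_eqVlt => /orP[/eqP x0|x0]; last first.
  by exists x; [rewrite x1 x0|left].
exists (- eta / 2); first by apply/andP; split; qlra.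
by right; rewrite x0 mulr0 in hx.
Qed.

(** Let P be the largest slope of a line through the origin above f on the left of 0. A
    line of slope slightly larger than P is exceeded by f arbitrarily close to 0, and
    bending it slightly makes it exceed f at the left end: the parabola then has an
    interior contact point, where its slope is close to P. *)
Lemma edge_slope (eta0 Rb : R) f good (P : R) : 0 < eta0 -> f 0 = 0 ->
  `|P| <= Rb -> 1 <= Rb ->
  touching_slopes eta0 Rb f good ->
  (forall s, 0 < s -> slopes f (P - s)) -> (forall s, 0 < s -> ~ slopes f (P + s)) ->
  forall s, 0 < s -> exists2 r, `|r - P| < s & good r.
Proof.
move=> eta00 f0 PL LR hT h1 h2 s0 s00.
have [s [s1 s2 s3]] : exists s, [/\ 0 < s, 20 * s <= s0 & 20 * s <= 1].
  exists (Num.min s0 1 / 20); case: (leP s0 1) => h; split; qlra.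
have [eta1 eta10 heta] := h1 s s1.
pose eta := Num.min eta0 eta1.
have e0 : 0 < eta by rewrite lt_min eta00.
have ee0 : eta <= eta0 by rewrite ge_min lexx.
have ee1 : eta <= eta1 by rewrite ge_min lexx orbT.
have [k ke] : exists k, k * eta = 4 * s.
  by exists (4 * s / eta); rewrite divfK // gt_eqF.
have k0 : 0 < k by rewrite -(pmulr_lgt0 _ e0) ke mulr_gt0.
have mk : 0 < Num.min (eta / 2) (s / (2 * k)) by rewrite lt_min; apply/andP; split; apply: divr_gt0 => //; apply: mulr_gt0.
have [x1 /andP[x1m x10] [hx1|]] := not_slopes (h2 s s1) mk; last by rewrite f0 ltxx.
have [x1a x1b] : - (eta / 2) <= x1 /\ - (s / (2 * k)) <= x1.
  have : - x1 <= Num.min (eta / 2) (s / (2 * k)) by rewrite lerNl.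
  by rewrite le_min => /andP[? ?]; split; rewrite lerNl.
have kx : k * - x1 <= s / 2.
  have : - x1 <= s / (2 * k) by qlra.
  rewrite ler_pdivlMr ?mulr_gt0 // => h; qlra.
pose r := P + 2 * s.
have q1 : 0 < f x1 - (r * x1 + k * x1 ^+ 2).
  have : (k * - x1) * - x1 <= s / 2 * - x1 by rewrite ler_wpM2r //; qlra.
  have : 0 < s * - x1 by rewrite mulr_gt0 // oppr_gt0.
  move: hx1; rewrite /r; nra.
have [||||||||x /andP[xa xb] gx] := hT r k (- eta) 0 x1; [qlra|qlra|by []|by []| | | |by apply: ltW|].
- rewrite mulrN ke normrN (ger0_norm (_ : 0 <= 4 * s)); last qlra.
  rewrite /r; apply: (@le_trans _ _ (`|P| + `|2 * s| + 2 * (4 * s))).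
    by rewrite lerD2r ler_normD.
  rewrite (ger0_norm (_ : 0 <= 2 * s)); qlra.
- apply: lt_trans q1.
  have := heta (- eta); rewrite lerN2 ee1 oppr_le0 ltW // => /(_ isT) hh.
  have : 0 < s * eta by rewrite mulr_gt0.
  have : k * (- eta) ^+ 2 = 4 * s * eta by rewrite sqrrN expr2 mulrA ke.
  rewrite /r; move: hh; clear; nra.
- by rewrite f0 expr2 !mulr0 addr0 subr0.
exists (r + 2 * k * x) => //.
have : k * - x <= 4 * s by rewrite -ke ler_wpM2l ?(ltW k0) // lerNl ltW.
have : 0 <= k * - x by rewrite mulr_ge0 ?(ltW k0) // oppr_ge0 ltW.
rewrite /r ltr_norml => h3 h4; apply/andP; split; qlra.
Qed.

(** If f crosses a line infinitely often near 0, a parallel line touches f between two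
    crossings. *)
Lemma oscillation_slope (eta0 Rb t : R) f good : 0 < eta0 -> `|t| <= Rb ->
  touching_slopes eta0 Rb f good ->
  (forall eta : R, 0 < eta -> exists2 x, - eta <= x < 0 & t * x < f x) ->
  (forall eta : R, 0 < eta -> exists2 x, - eta <= x < 0 & - eta0 <= x -> f x < t * x) ->
  good t.
Proof.
move=> eta00 tb hT hup hdn.
have [a /andP[a1 a2] ha] := hdn _ eta00.
have [|x1 /andP[x11 x12] hx1] := hup (- a / 2); first by qlra.
have [|b /andP[b1 b2] hb] := hdn (- x1 / 2); first by qlra.
have ax1 : a < x1 by qlra.
have x1b : x1 < b by qlra.
have {}ha := ha a1.
have {}hb : f b < t * b by apply: hb; qlra.
have [||||x _] := hT t 0 a b x1 a1 ax1 x1b (ltW b2).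
- by rewrite mul0r normr0 mulr0 addr0; have := normr_ge0 t; qlra.
- by rewrite !mul0r !addr0; qlra.
- by rewrite !mul0r !addr0; qlra.
- by rewrite !mul0r !addr0; qlra.
by rewrite mulr0 mul0r addr0.
Qed.

(** The inequality for f is F <= b1, the one for h is b2 <= F (in the opposite slope),
    and b1 < b2. By edge_slope, F <= b1 at the largest slope P of f, whereas b2 <= F (-
    Rb); so F crosses the level (b1 + b2) / 2 between - Rb and P, for the last time at
    r0, say. Slopes r near r0 are smaller than P, hence slopes of f, and - r must be a
    slope of h: otherwise the largest slope Q of h satisfies b2 <= F (- Q), although
    either - Q is at most P, and then F (- Q) < b2 by the choice of r0, or it exceeds P,
    and then the lines with slopes between P and - Q are crossed infinitely often by f
    and by - h, so that F would have to be both below b1 and above b2 there. *)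
Lemma slope_separation (eta0 L Rb b1 b2 : R) f h F : 0 < eta0 -> 0 <= L ->
  L + 1 <= Rb -> b1 < b2 -> continuous F -> f 0 = 0 -> h 0 = 0 ->
  (forall x, - eta0 <= x <= 0 -> f x + h x <= 0) ->
  (forall x, - eta0 <= x <= 0 -> `|f x| <= L * - x) ->
  b2 <= F (- Rb) ->
  touching_slopes eta0 Rb f (fun r => F r <= b1) ->
  touching_slopes eta0 Rb h (fun r => b2 <= F (- r)) ->
  exists r0 s, 0 < s /\ forall r, `|r - r0| <= s ->
    [/\ b1 < F r, F r < b2, `|r| <= Rb, slopes f r & slopes h (- r)].
Proof.
move=> eta00 L0 LR b12 cF f0 h0 fh fL FR hTf hTh.
have Fe x (e : R) : 0 < e -> exists2 dl : R, 0 < dl & forall y, `|y - x| < dl -> `|F y - F x| < e.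
  move=> e0; have /cvgrPdist_lt/(_ e e0)/nbhs_normP[dl /= dl0 hd] := cF x.
  exists dl => // y yx; rewrite distrC; apply: hd => /=; by rewrite distrC.
have LRb : L <= Rb by qlra.
have Rb1 : 1 <= Rb by qlra.
have near0 eta : 0 < eta -> exists2 x, - eta <= x <= 0 & - eta0 <= x < 0.
  move=> e0; exists (- Num.min eta eta0); case: (leP eta eta0) => ?; apply/andP; split; qlra.
have fL1 : slopes f (- L).
  exists eta0 => // x xx; apply: le_trans (ler_norm _) _; rewrite mulNr -mulrN; exact: fL.
have hL1 : slopes h (- L).
  exists eta0 => // x xx; have := fh x xx; have := fL x xx.
  rewrite ler_norml => /andP[h1 _] h2; rewrite mulNr; qlra.
have fL2 r : slopes f r -> r <= L.
  move=> [eta e0 hr]; have [x xx /andP[xe x0]] := near0 eta e0.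
  have := hr x xx; have := fL x; rewrite xe (ltW x0) => /(_ isT).
  rewrite ler_norml => /andP[h1 _] h2.
  have : (L - r) * - x >= 0 by qlra.
  by rewrite pmulr_lge0 ?oppr_gt0 // subr_ge0.
have hsf : has_sup (slopes f) by split; [exists (- L)|exists L].
pose P := sup (slopes f).
have PL : `|P| <= L.
  rewrite ler_norml; apply/andP; split; first exact: sup_upper_bound.
  by apply: sup_le_ub => //; exists (- L).
have Pdn s : 0 < s -> slopes f (P - s).
  move=> s0; have [r hr hs] := sup_adherent s0 hsf; exact: slopes_down hr (ltW hs).
have Pup s : 0 < s -> ~ slopes f (P + s).
  by move=> s0 /(sup_upper_bound hsf); rewrite -/P; qlra.
(* by edge_slope, good slopes accumulate at the largest slope of f *)
have FP : F P <= b1.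
  rewrite leNgt; apply/negP => hlt.
  have [dl dl0 hdl] := Fe P (F P - b1) (ltac:(qlra)).
  have [r rP hr] := edge_slope eta00 f0 (le_trans PL LRb) Rb1 hTf Pdn Pup dl0.
  have := hdl r rP; rewrite ltr_norml => /andP[]; qlra.
pose bm := (b1 + b2) / 2.
have [PL1 PL2] : - L <= P /\ P <= L by apply/andP; rewrite -ler_norml.
(* the last crossing of the middle level below P *)
pose S := [set r | - Rb <= r <= P /\ bm <= F r].
have hS : has_sup S.
  split; last by exists P => r [/andP[]].
  by exists (- Rb); split; [apply/andP; split; qlra|rewrite /bm; qlra].
pose r0 := sup S.
have r0P : r0 <= P by apply: sup_le_ub; [case: hS|move=> r [/andP[]]].
have r0R : - Rb <= r0 by apply: sup_upper_bound => //; split; [apply/andP; split; qlra|rewrite /bm; qlra].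
have Fgt y : r0 < y -> y <= P -> F y < bm.
  move=> ry yP; rewrite ltNge; apply/negP => hy; have := sup_upper_bound hS.
  have Sy : S y by split => //; apply/andP; split => //; qlra.
  by move=> /(_ y Sy); rewrite leNgt ry.
have Fr0 : F r0 = bm.
  apply/eqP; rewrite eq_le !leNgt; apply/andP; split; apply/negP => hlt.
    have [dl dl0 hdl] := Fe r0 (F r0 - bm) (ltac:(qlra)).
    have r0P' : r0 < P.
      rewrite lt_neqAle r0P andbT; apply/negP => /eqP e; move: hlt; rewrite e /bm; qlra.
    pose y := Num.min P (r0 + dl / 2).
    have yr : r0 < y by rewrite lt_min r0P'; qlra.
    have yd : y <= r0 + dl / 2 by rewrite ge_min lexx orbT.
    have := Fgt y yr (ltac:(by rewrite ge_min lexx)).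
    have := hdl y; rewrite gtr0_norm ?subr_gt0 // => /(_ (ltac:(qlra))).
    rewrite ltr_norml => /andP[]; qlra.
  have [dl dl0 hdl] := Fe r0 (bm - F r0) (ltac:(qlra)).
  have [r Sr rr] := sup_adherent dl0 hS; have Fr := Sr.2.
  have rr0 : r <= r0 by exact: sup_upper_bound.
  have := hdl r; rewrite ler0_norm ?subr_le0 // => /(_ (ltac:(rewrite -/r0 in rr; qlra))).
  rewrite ltr_norml => /andP[]; qlra.
have [dl dl0 hdl] := Fe r0 ((b2 - b1) / 2) (ltac:(qlra)).
have near_r0 y : `|y - r0| < dl -> b1 < F y < b2.
  move=> /hdl; rewrite Fr0 ltr_norml /bm => /andP[? ?]; apply/andP; split; qlra.
have Pfar : r0 + dl <= P.
  rewrite leNgt; apply/negP => hh; have := near_r0 P; rewrite ger0_norm ?subr_ge0 //.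
  move=> /(_ (ltac:(qlra))) /andP[]; qlra.
have Rfar : - Rb + dl <= r0.
  rewrite leNgt; apply/negP => hh; have := near_r0 (- Rb); rewrite ler0_norm ?subr_le0 //.
  move=> /(_ (ltac:(qlra))) /andP[]; qlra.
exists r0, (dl / 2); split; first qlra.
move=> r rr; move: (rr); rewrite ler_norml => /andP[r1 r2].
have /andP[Fr1 Fr2] : b1 < F r < b2 by apply: near_r0; qlra.
split=> //; [by rewrite ler_norml; apply/andP; split; qlra| |].
  apply: slopes_down (Pdn (dl / 2) _) _; qlra.
apply: contrapT => hN.
have hsh : has_sup (slopes h).
  split; [by exists (- L)|exists (- r)] => q hq; rewrite leNgt; apply/negP => /ltW qr.
  by apply: hN; exact: slopes_down hq qr.
pose Q := sup (slopes h).
have Qr : Q <= - r.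
  apply: sup_le_ub; first by exists (- L).
  move=> q hq; rewrite leNgt; apply/negP => /ltW qr.
  by apply: hN; exact: slopes_down hq qr.
have QL : - L <= Q by exact: sup_upper_bound.
have Qdn s : 0 < s -> slopes h (Q - s).
  move=> s0; have [q hq hs] := sup_adherent s0 hsh; exact: slopes_down hq (ltW hs).
have Qup s : 0 < s -> ~ slopes h (Q + s).
  by move=> s0 /(sup_upper_bound hsh); rewrite -/Q; qlra.
(* if - Q is at most P, the choice of r0 bounds F (- Q) *)
have [QP|QP] := leP (- P) Q.
  have Qabs : `|Q| <= Rb by rewrite ler_norml; apply/andP; split; qlra.
  have FQ : F (- Q) < b2.
    have [hh|hh] := ltP (`|- Q - r0|) dl; first by have /andP[] := near_r0 _ hh.
    apply: (@lt_trans _ _ bm); last by rewrite /bm; qlra.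
    apply: Fgt; last qlra.
    rewrite ltNge; apply/negP => Qr0; move: hh; rewrite ler0_norm ?subr_le0 //; qlra.
  have [dl' dl0' hdl'] := Fe (- Q) (b2 - F (- Q)) (ltac:(qlra)).
  have [q qQ hq] := edge_slope eta00 h0 Qabs Rb1 hTh Qdn Qup dl0'.
  have := hdl' (- q); rewrite -opprD normrN => /(_ qQ).
  rewrite ltr_norml => /andP[]; qlra.
(* a slope strictly between P and - Q, which neither f nor h admits *)
pose t := (P - Q) / 2.
have nf : ~ slopes f t by have := Pup (t - P); rewrite subrKC; apply; rewrite /t; qlra.
have nh : ~ slopes h (- t) by have := Qup (- t - Q); rewrite subrKC; apply; rewrite /t; qlra.
have tb : `|t| <= Rb by rewrite ler_norml /t; apply/andP; split; qlra.
have pf eta : 0 < eta -> exists2 x, - eta <= x < 0 & t * x < f x.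
  by move=> /(not_slopes nf)[x xx [hx|]]; [exists x|rewrite f0 ltxx].
have ph eta : 0 < eta -> exists2 x, - eta <= x < 0 & - t * x < h x.
  by move=> /(not_slopes nh)[x xx [hx|]]; [exists x|rewrite h0 ltxx].
have t1 : F t <= b1.
  apply: (oscillation_slope eta00 tb hTf pf) => eta /ph[x /[dup] xx /andP[x1 x2] hx].
  exists x => // xe; have := fh x; rewrite xe (ltW x2) => /(_ isT).
  by clear -hx; qlra.
have t2 : b2 <= F t.
  rewrite -[t]opprK.
  apply: (oscillation_slope eta00 _ hTh ph); first by rewrite normrN.
  move=> eta /pf[x /[dup] xx /andP[x1 x2] hx].
  exists x => // xe; have := fh x; rewrite xe (ltW x2) => /(_ isT).
  by clear -hx; qlra.
by clear -t1 t2 b12; qlra.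
Qed.

End Slopes.

(** * Functions penalized in the tangential directions *)

Section Envelope.
Context {R : realType} {d : nat}.
Implicit Types (g w z a : stpoint R d).

(** The tangential variables and the time, which are the ones that get doubled. *)
Definition tang w : stpoint R d := ((w.1.1, 0), w.2).
Definition sqt w : R := sqn (tang w).
(** The normal direction. *)
Definition ed (c : R) : stpoint R d := ((0, c), 0).

Lemma tangB w z : tang (w - z) = tang w - tang z.
Proof.
by rewrite /tang; congr (_, _); congr (_, _); rewrite /= subr0.
Qed.

Lemma tang_ed w : w = tang w + ed w.1.2.
Proof.
case: w => -[w' x] t; rewrite /tang /ed /=.
by congr (_, _); [congr (_, _)|]; rewrite /= ?addr0 ?add0r.
Qed.

Lemma ip_ed (c : R) w : ip (ed c) w = c * w.1.2.
Proof.
rewrite /ip /dotp /= big1 => [|k _]; last by rewrite mxE mul0r.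
by rewrite mul0r addr0 add0r.
Qed.

Lemma ip_tang g w : ip (tang g) (tang w) = ip (tang g) w.
Proof. by rewrite /ip /dotp /tang /= !mul0r. Qed.

Lemma sqn_tang w : sqn w = sqt w + w.1.2 ^+ 2.
Proof.
rewrite {1}[w]tang_ed sqnD -/(sqt w) [X in 2 * X]ipC ip_ed.
by rewrite [sqn (ed _)]ip_ed /= mulr0 mulr0 addr0 expr2.
Qed.

Lemma sqt_ge0 w : 0 <= sqt w. Proof. exact: sqn_ge0. Qed.

Lemma sqt_le w : sqt w <= sqn w.
Proof. by rewrite sqn_tang lerDl sqr_ge0. Qed.

Lemma continuous_sqt : continuous (@sqt).
Proof.
have e : sqt = fun w => sqn w - w.1.2 ^+ 2.
  by apply/funext => w; rewrite sqn_tang addrK.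
rewrite e => w; apply: cvgB; first exact: continuous_sqn.
by rewrite expr2; under eq_fun do rewrite expr2; apply: cvgM; exact: continuous_xd.
Qed.

Definition cyt (tau T : R) w := w.1.2 <= 0 /\ tau <= w.2 <= T.

Lemma cyt_cylinder (tau T : R) w : 0 <= tau -> cyt tau T w -> cylinder T w.
Proof.
move=> t0 [h /andP[h1 h2]]; split => //; rewrite h2 andbT; exact: le_trans h1.
Qed.

(** The contribution of one of the two points to an upper bound for the variation of the
    doubling term sqn (w1 - w2) / (2 * eps): dividing sqt by eps rather than by 2 * eps
    absorbs the cross term when both points move. *)
Definition pen (eps : R) z a w : R := ip a (w - z) + sqt (w - z) / eps.

Lemma pen_expand eps z a w0 w : pen eps z a w - pen eps z a w0 =
  ip (a + (2 / eps) *: tang (w0 - z)) (w - w0) + sqt (w - w0) / eps.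
Proof.
rewrite /pen /sqt !tangB /sqn !ipE.
rewrite -(ip_tang w0 w) -(ip_tang z w) -(ip_tang w0 w0) -(ip_tang z w0).
rewrite (ipC (tang z) (tang w)) (ipC (tang w0) (tang w)) (ipC (tang z) (tang w0)).
ring.
Qed.

(** What the maximality of the doubled function says of one of the two functions;
    displacements in the normal direction, which is not doubled, are paid with a
    Lipschitz constant. *)
Definition bounded_growth (L eps : R) (tau T : R) (G : stpoint R d -> R) z a :=
  forall w, cyt tau T w -> G w <= G z + ip a (w - z) + sqt (w - z) / (2 * eps)
     + L * `|w.1.2 - z.1.2|.

(** The quadratic part of pen is twice the one of the growth bound, so F tends to minus
    infinity in the strip. *)
Lemma strip_max (L eps tau T sg r k al be : R) G z a w0 :
  0 < eps -> 0 <= L -> sg ^+ 2 = 1 -> continuous G -> bounded_growth L eps tau T G z a ->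
  al <= be -> be <= 0 ->
  cyt tau T w0 -> al <= sg * (w0.1.2 - z.1.2) <= be ->
  let q x := r * x + k * x ^+ 2 in
  let F w := G w - pen eps z a w - q (sg * (w.1.2 - z.1.2)) in
  exists w, [/\ cyt tau T w, al <= sg * (w.1.2 - z.1.2) <= be &
    forall w', cyt tau T w' -> al <= sg * (w'.1.2 - z.1.2) <= be -> F w' <= F w].
Proof.
move=> eps0 L0 sg1 cG bG ab b0 cw0 w0ab q F.
have cxi : continuous (fun w : stpoint R d => sg * (w.1.2 - z.1.2)).
  move=> w; apply: cvgMr; apply: cvgB; [exact: continuous_xd|exact: cvg_cst].
have cwz w : (w' - z @[w' --> w]) --> w - z by apply: cvgB; [exact: cvg_id|exact: cvg_cst].
have cF : continuous F.
  move=> w; apply: cvgB; first apply: cvgB.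
  - exact: cG.
  - apply: cvgD; first by apply: (cvg_comp _ _ (cwz w)); exact: continuous_ip.
    by apply: cvgMl; apply: (cvg_comp _ _ (cwz w)); exact: continuous_sqt.
  - apply: cvgD; first by apply: cvgMr; exact: cxi.
    by apply: cvgMr; rewrite expr2; under eq_fun do rewrite expr2; apply: cvgM; exact: cxi.
pose D := [set w : stpoint R d | w.1.2 <= 0 /\ tau <= w.2 <= T] `&`
  ([set w | al - sg * (w.1.2 - z.1.2) <= 0] `&` [set w | sg * (w.1.2 - z.1.2) - be <= 0]).
have DE w : D w <-> cyt tau T w /\ al <= sg * (w.1.2 - z.1.2) <= be.
  rewrite /D /= !subr_le0; split=> [[h [h1 h2]]|[h /andP[h1 h2]]]; split=> //.
  by apply/andP.
have cD : closed D.
  apply: closedI; first exact: closed_cyl.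
  apply: closedI; apply: closed_le0 => w.
    by apply: cvgB; [exact: cvg_cst|exact: cxi].
  by apply: cvgB; [exact: cxi|exact: cvg_cst].
have Dw0 : D w0 by apply/DE.
pose A := - al; have A0 : 0 <= A by rewrite oppr_ge0; exact: le_trans ab b0.
pose Q := `|r| * A + `|k| * A ^+ 2.
pose c := `|G z + L * A + Q - F w0|.
(* beyond this distance the quadratic term exceeds all the others *)
pose rho := 1 + 2 * eps * c + A ^+ 2.
have [|w Dw hw] := EVT_closed (w0 := w0) (r := `|z| + rho) (@proper_st R d) cF cD Dw0.
  move=> w /DE[cw /andP[w1 w2]] hz.
  have wz : rho < `|w - z|.
    by have := ler_normD (w - z) z; rewrite subrK; clear -hz; lra.
  set xi := sg * (w.1.2 - z.1.2) in w1 w2.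
  have xiE : `|w.1.2 - z.1.2| = - xi.
    have : `|xi| = `|w.1.2 - z.1.2|.
      rewrite /xi normrM; have -> : `|sg| = 1; last by rewrite mul1r.
      by apply/eqP; rewrite -sqrp_eq1 // real_normK ?num_real // sg1.
    by move=> <-; rewrite ler0_norm //; exact: le_trans w2 b0.
  have xiA : - xi <= A by rewrite /A lerN2.
  have xi0 : 0 <= - xi by rewrite oppr_ge0; exact: le_trans w2 b0.
  have hg := bG w cw; rewrite xiE in hg.
  have qb : - q xi <= Q.
    apply: le_trans (ler_norm _) _; rewrite normrN /q /Q.
    apply: le_trans (ler_normD _ _) _; rewrite normrM [`|k * _|]normrM normrX -(normrN xi) (ger0_norm xi0).
    by apply: lerD; rewrite ler_wpM2l // ler_sqr.
  have sq : 2 * eps * c <= sqt (w - z).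
    have h1 : sqn (w - z) = sqt (w - z) + xi ^+ 2.
      rewrite sqn_tang; congr (_ + _).
      by rewrite -[(w - z).1.2]/(w.1.2 - z.1.2) /xi exprMn sg1 mul1r.
    have h2 := sqr_norm_le_sqn (w - z).
    have h3 : xi ^+ 2 <= A ^+ 2 by rewrite -sqrrN ler_sqr.
    have h4 : rho <= `|w - z| ^+ 2.
      have r1 : 1 <= rho.
        by rewrite /rho -addrA lerDl addr_ge0 ?sqr_ge0 // !mulr_ge0 ?normr_ge0 // ltW.
      apply: (@le_trans _ _ (rho ^+ 2)); last first.
        by rewrite ler_sqr ?nnegrE ?(ltW wz) // ?normr_ge0 //; exact: le_trans r1.
      by rewrite expr2 ler_peMl //; exact: le_trans r1.
    by move: h4; rewrite /rho; clear -h1 h2 h3; lra.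
  have sq2 : c <= sqt (w - z) / (2 * eps).
    by rewrite ler_pdivlMr ?mulr_gt0 // mulrC.
  have LA : L * - xi <= L * A by rewrite ler_wpM2l.
  have s2 : sqt (w - z) / eps = 2 * (sqt (w - z) / (2 * eps)).
    by field; rewrite gt_eqF.
  have cc : G z + L * A + Q - F w0 <= c by exact: ler_norm.
  rewrite {1}/F /pen -/xi s2; clear -hg qb sq2 LA cc; lra.
exists w; have [cw wab] := (DE w).1 Dw; split=> // w' cw' wab'.
by apply: hw; apply/DE.
Qed.

Lemma norm_tang w : `|tang w| <= `|w|.
Proof.
by rewrite norm_le_st /= normr0 normr_ge0 norm11_le norm2_le.
Qed.

(** Interior maximum points of F are quadratic jets of G, as pen and q are polynomials. *)
Lemma qjet_strip (eps tau T sg r k al be : R) G z a w0 :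
  0 < eps -> sg ^+ 2 = 1 -> 0 <= tau -> cyt tau T w0 -> tau < w0.2 ->
  al < sg * (w0.1.2 - z.1.2) < be ->
  let q x := r * x + k * x ^+ 2 in
  let F w := G w - pen eps z a w - q (sg * (w.1.2 - z.1.2)) in
  (forall w, cyt tau T w -> al <= sg * (w.1.2 - z.1.2) <= be -> F w <= F w0) ->
  qjet T G w0 (a + (2 / eps) *: tang (w0 - z) + ed (sg * (r + 2 * k * (sg * (w0.1.2 - z.1.2))))).
Proof.
move=> eps0 sg1 tau0 cw0 tw0 /andP[al0 be0] q F hm.
set x0 := sg * (w0.1.2 - z.1.2) in al0 be0 *.
have sgn : `|sg| = 1 by apply/eqP; rewrite -sqrp_eq1 // real_normK ?num_real // sg1.
exists (eps^-1 + `|k|), (Num.min (w0.2 - tau) (Num.min (x0 - al) (be - x0))).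
  by rewrite !lt_min !subr_gt0 tw0 al0 be0.
move=> w [hw /andP[_ wT]]; rewrite !lt_min => /and3P[wt wa wb].
set D := w - w0 in wt wa wb *.
have xE : sg * (w.1.2 - z.1.2) = x0 + sg * D.1.2.
  by rewrite /x0 /D /=; ring.
have xn : `|sg * D.1.2| <= `|D| by rewrite normrM sgn mul1r norm12_le.
have t1 : w0.2 - w.2 <= `|D|.
  by apply: le_trans (norm2_le D); rewrite -normrN -[(D).2]/(w.2 - w0.2) opprB ler_norm.
have cw : cyt tau T w.
  by split=> //; rewrite wT andbT; clear -t1 wt; lra.
have := hm w cw; rewrite xE => /(_ _)/wrap[].
  move: xn; rewrite ler_norml => /andP[x1 x2].
  by apply/andP; split; clear -x1 x2 wa wb; lra.
rewrite /F xE -/x0 => hF.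
have e1 := pen_expand eps z a w0 w; rewrite -/D in e1.
have e2 : q (x0 + sg * D.1.2) - q x0 = sg * (r + 2 * k * x0) * D.1.2 + k * D.1.2 ^+ 2.
  by rewrite /q; transitivity (sg * (r + 2 * k * x0) * D.1.2 + k * (sg ^+ 2 * D.1.2 ^+ 2)); [ring|rewrite sg1; ring].
have e3 : k * D.1.2 ^+ 2 <= `|k| * sqn D.
  apply: (@le_trans _ _ (`|k| * D.1.2 ^+ 2)).
    by rewrite ler_wpM2r ?sqr_ge0 // ler_norm.
  by rewrite ler_wpM2l // sqn_tang lerDr sqt_ge0.
have e4 : sqt D / eps <= eps^-1 * sqn D.
  by rewrite mulrC ler_wpM2l ?invr_ge0 ?(ltW eps0) // sqt_le.
have e5 : (eps^-1 + `|k|) * sqn D = eps^-1 * sqn D + `|k| * sqn D by rewrite mulrDl.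
rewrite ipDl ip_ed e5; move: hF e1 e2 e3 e4; clear.
move: (q x0) (q (x0 + sg * D.1.2)) (pen eps z a w0) (pen eps z a w)
  (k * D.1.2 ^+ 2) (`|k| * sqn D) (sqt D / eps) (eps^-1 * sqn D)
  (sg * (r + 2 * k * x0) * D.1.2) (ip _ D) => *; lra.
Qed.

Lemma jetD (T : R) (f1 f2 : stpoint R d -> R) w g1 g2 : jet T f1 w g1 -> jet T f2 w g2 ->
  jet T (fun y => f1 y + f2 y) w (g1 + g2).
Proof.
move=> h1 h2 e e0; have e2 : 0 < e / 2 by rewrite divr_gt0.
have [r r0 hr] := h1 _ e2; have [s s0 hs] := h2 _ e2.
exists (Num.min r s); first by rewrite lt_min r0.
move=> y cy yw; rewrite lt_min => /andP[/(hr y cy yw) h3 /(hs y cy yw) h4].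
rewrite ipDl; have : e * `|y - w| = e / 2 * `|y - w| + e / 2 * `|y - w| by field.
by clear -h3 h4; lra.
Qed.

(** One of the two functions of a doubling, on one branch: G is a subsolution G0 minus a
    smooth function N0 with gradient N. It describes both u, with N0 = 0, and - v, for
    which N0 is the penalty at infinity. *)
Record branch_eq (eps L tau T Rb : R) (G G0 N0 : stpoint R d -> R)
    (N : stpoint R d -> stpoint R d) z a
    (h : spoint R d -> R -> spoint R d -> R -> R) : Prop := BranchEq {
  be_eps : 0 < eps; be_L : 0 <= L; be_tau : 0 <= tau; be_Rb : 0 < Rb;
  be_z : cyt tau T z; be_tz : tau < z.2;
  be_cG0 : continuous G0; be_cG : continuous G;
  be_G : forall w, G0 w = G w + N0 w;
  be_growth : bounded_growth L eps tau T G z a;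
  be_N0 : forall w, cylinder T w -> jet T N0 w (N w);
  be_N : forall e : R, 0 < e -> exists2 r : R, 0 < r &
    forall w, `|w - z| < r -> `|N w - N z| < e;
  be_ham : unif_continuous_ham T h;
  be_eq : forall w g, w.1.2 < 0 -> tau < w.2 <= T -> jet T G0 w g ->
     g.2 + h g.1 (G0 w) w.1 w.2 <= 0 }.

(** The equation at z as a function of the normal slope alone. *)
Definition slope_ham (G0 : stpoint R d -> R) (N : stpoint R d -> stpoint R d) z a
    (h : spoint R d -> R -> spoint R d -> R -> R) (r : R) : R :=
  (a + N z).2 + h (a + ed r + N z).1 (G0 z) z.1 z.2.

(** At touching points close to z the gradient is close to the one with the same normal
    slope at z, and the Hamiltonian is uniformly continuous. *)
Lemma touch_slope_ham eps L tau T Rb G G0 N0 N z a h (e : R) :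
  branch_eq eps L tau T Rb G G0 N0 N z a h -> 0 < e ->
  exists2 rho : R, 0 < rho & forall w r, cyt tau T w -> w.1.2 < 0 -> `|w - z| < rho ->
    `|r| <= 2 * Rb -> qjet T G w (a + (2 / eps) *: tang (w - z) + ed r) ->
    slope_ham G0 N z a h r <= e.
Proof.
move=> [eps0 L0 tau0 Rb0 cz tz cG0 cG hG bG hN0 hN hh hpde] e0; pose M := `|a| + 2 * Rb + `|N z| + `|G0 z| + 1.
have e2 : 0 < e / 2 by rewrite divr_gt0.
have [rho rho0 hrho] := hh M _ e2.
have [rh [rh0 rhrho rhe rh1]] : exists rh, [/\ 0 < rh, rh <= rho, rh <= e / 2 & rh <= 1].
  exists (Num.min rho (Num.min (e / 2) 1)).
  by rewrite !lt_min rho0 e2 ltr01 !ge_min !lexx !orbT.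
have rh2 : 0 < rh / 2 by rewrite divr_gt0.
have [rN rN0 hrN] := hN _ rh2.
have [rG rG0 hrG] : exists2 r : R, 0 < r & forall w, `|w - z| < r -> `|G0 w - G0 z| < rh.
  have /cvgrPdist_lt/(_ rh rh0)/nbhs_normP[r /= r0 hr] := cG0 z.
  exists r => // w wz; rewrite distrC; apply: hr => /=; by rewrite distrC.
exists (\big[Num.min/1]_(i <- [:: rN; rG; rh; z.2 - tau; rh * eps / 4]) i).
  rewrite !big_cons big_nil; rewrite 5!lt_min rN0 rG0 rh0 subr_gt0 tz ltr01 andbT.
  by rewrite divr_gt0 ?mulr_gt0.
move=> w r cw w0; rewrite !big_cons big_nil !lt_min => /and5P[w1 w2 w3 w4 /andP[w5 _]] r2 qj.
have czc := cyt_cylinder tau0 cz; have cwc := cyt_cylinder tau0 cw.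
set g := _ + ed r in qj.
have jG0 : jet T G0 w (g + N w).
  rewrite (_ : G0 = (fun y => G y + N0 y)); last by apply/funext => y; exact: hG.
  by apply: jetD; [exact: qjet_jet|exact: hN0].
have wT : tau < w.2 <= T.
  case: cw => _ /andP[_ ->]; rewrite andbT.
  have := le_lt_trans (norm2_le (w - z)) w4; rewrite ltr_norml => /andP[+ _].
  by rewrite -[(w - z).2]/(w.2 - z.2); clear; lra.
have hp := hpde _ _ w0 wT jG0.
set g0 := a + ed r + N z.
have gg0 : `|(g + N w) - g0| < rh.
  have -> : (g + N w) - g0 = (2 / eps) *: tang (w - z) + (N w - N z).
    have key (A X E n m : stpoint R d) : A + X + E + n - (A + E + m) = X + (n - m).
      by rewrite [A + X + E]addrAC -[A + E + X + n]addrA [A + E + (X + n)]addrC addrKA addrA.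
    exact: key.
  apply: le_lt_trans (ler_normD _ _) _.
  have h1 := hrN w w1.
  have h2 : `|(2 / eps) *: tang (w - z)| < rh / 2.
    rewrite normrZ gtr0_norm ?divr_gt0 //.
    apply: (@le_lt_trans _ _ (2 / eps * `|w - z|)).
      by rewrite ler_wpM2l ?norm_tang // ltW // divr_gt0.
    by rewrite mulrAC ltr_pdivrMr //; clear -w5; lra.
  by clear -h1 h2; lra.
have ned : `|ed r| <= `|r|.
  by rewrite norm_le_st /= !normr0 lexx normr_ge0.
have ng0 : `|g0| <= `|a| + 2 * Rb + `|N z|.
  rewrite /g0; apply: le_trans (ler_normD _ _) _; rewrite lerD2r.
  by apply: le_trans (ler_normD _ _) _; rewrite lerD2l; exact: le_trans r2.
have ng : `|g + N w| <= `|a| + 2 * Rb + `|N z| + 1.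
  rewrite -[g + N w](subrK g0); apply: le_trans (ler_normD _ _) _.
  by clear -ng0 gg0 rh1; lra.
have hG0 := hrG w w2.
have nG0 : `|G0 w| <= `|G0 z| + 1.
  rewrite -[G0 w](subrK (G0 z)); apply: le_trans (ler_normD _ _) _.
  by clear -hG0 rh1; lra.
have na := normr_ge0 a; have nN := normr_ge0 (N z); have nG := normr_ge0 (G0 z).
have := hrho ((g + N w).1, G0 w, w) (g0.1, G0 z, z).
move=> /(_ _)/wrap[].
  split=> //.
    apply: (le_trans (norm1_le (g + N w))); apply: le_trans ng _.
    by rewrite /M; clear -nG; lra.
  by apply: le_trans nG0 _; rewrite /M; clear -na nN Rb0; lra.
move=> /(_ _)/wrap[].
  split=> //.
    apply: (le_trans (norm1_le g0)); apply: le_trans ng0 _.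
    by rewrite /M; clear -nG; lra.
  by rewrite /M -[leLHS]/(`|G0 z|); clear -na nN Rb0; lra.
move=> /(_ _)/wrap[].
  have hh1 : Num.max `|(g + N w).1 - g0.1| `|G0 w - G0 z| < rho.
    rewrite gt_max; apply/andP; split; last exact: lt_le_trans hG0 rhrho.
    apply: lt_le_trans rhrho; apply: le_lt_trans gg0; exact: (norm1_le (g + N w - g0)).
  rewrite -[ltLHS]/(Num.max (Num.max `|(g + N w).1 - g0.1| `|G0 w - G0 z|) `|w - z|).
  by rewrite gt_max; apply/andP; split=> //; exact: lt_le_trans w3 rhrho.
rewrite /uncurry_ham /= ltr_norml => /andP[h1 h2].
have := le_lt_trans (norm2_le _) gg0; rewrite ltr_norml => /andP[h3 _].
have g02 : g0.2 = (a + N z).2 by rewrite /g0 /= addr0.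
rewrite /slope_ham -/g0 -g02.
move: hp h3 h1 rhe; rewrite -[(_ - g0).2]/((g + N w).2 - g0.2); clear.
move: (h _ _ _ _) (h _ _ _ _) => H1 H2; move: (g + N w).2 g0.2 => q1 q2.
by move=> *; lra.
Qed.

End Envelope.

(** * Envelopes over slices parallel to the junction *)

Section SliceEnvelope.
Context {R : realType} {d : nat}.
Implicit Types (g w z a : stpoint R d).

(** Here f x is the maximum of G - pen - G z over the slice at distance - x from z, on
    the side given by sg. A maximum point w of G - pen minus a function of the normal
    variable satisfies sqt (w - z) = O(|x|) by the growth bound; hence it tends to z,
    and the inequality of G at w passes to the normal slope frozen at z. *)
Lemma envelope eps L tau T Rb sg eta G G0 N0 N z a h (e : R) :
  @branch_eq R d eps L tau T Rb G G0 N0 N z a h ->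
  sg = 1 \/ sg = -1 /\ eta <= - z.1.2 -> 0 < eta -> 0 < e ->
  exists f eta', [/\ 0 < eta' <= eta, f 0 = 0,
    forall x, - eta' <= x <= 0 -> exists w, [/\ cyt tau T w, w.1.2 = z.1.2 + sg * x &
      f x = G w - pen eps z a w - G z],
    forall w, cyt tau T w -> - eta' <= sg * (w.1.2 - z.1.2) <= 0 ->
      G w - pen eps z a w - G z <= f (sg * (w.1.2 - z.1.2)) &
    touching_slopes eta' Rb f (fun r => slope_ham G0 N z a h (sg * r) <= e)].
Proof.
move=> BE sgE eta0 e0.
have [rho rho0 hrho] := touch_slope_ham BE e0.
have [eps0 L0 tau0 Rb0 cz tz cG0 cG hG bG hN0 hN hh hpde] := BE.
have sg1 : sg ^+ 2 = 1 by case: sgE => [->|[-> _]]; rewrite ?sqrrN expr1n.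
have slice x : - eta <= x <= 0 -> cyt tau T (z + ed (sg * x)).
  move=> /andP[x1 x2]; case: cz => h1 h2; split; last by rewrite /= addr0.
  by rewrite /=; case: sgE => [->|[-> h3]]; clear -h1 h3 x1 x2 || clear -h1 x1 x2; lra.
have sgK x : sg * (z.1.2 + sg * x - z.1.2) = x.
  by rewrite addrAC subrr add0r mulrA -expr2 sg1 mul1r.
have sgK' w : w.1.2 = z.1.2 + sg * (sg * (w.1.2 - z.1.2)).
  by rewrite mulrA -expr2 sg1 mul1r addrC subrK.
have /choice[W hW] : forall x, exists w, - eta <= x <= 0 -> [/\ cyt tau T w,
    w.1.2 = z.1.2 + sg * x & forall w', cyt tau T w' -> w'.1.2 = z.1.2 + sg * x ->
    G w' - pen eps z a w' <= G w - pen eps z a w].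
  move=> x; have [xx|xx] := boolP (- eta <= x <= 0); last by exists z.
  have xi : x <= sg * ((z + ed (sg * x)).1.2 - z.1.2) <= x by rewrite sgK lexx.
  have x0 : x <= 0 by case/andP: xx.
  have [w [cw /andP[w1 w2] hw]] := strip_max 0 0 eps0 L0 sg1 cG bG (lexx x) x0 (slice x xx) xi.
  exists w => _; split=> //.
    by rewrite {1}(sgK' w); congr (_ + sg * _); apply/eqP; rewrite eq_le w1 w2.
  move=> w' cw' w'x; have := hw w' cw'; rewrite w'x sgK lexx => /(_ isT).
  by rewrite !mul0r !addr0 !subr0.
pose f x := G (W x) - pen eps z a (W x) - G z.
pose C := 2 * eps * (L + 2 * Rb) + 1.
have C0 : 0 < C by rewrite ltr_wpDl // !mulr_ge0 ?addr_ge0 ?mulr_ge0 // ltW.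
have [m [m0 mrho mt]] : exists m, [/\ 0 < m, m <= rho & m <= z.2 - tau].
  by exists (Num.min rho (z.2 - tau)); rewrite lt_min rho0 subr_gt0 tz !ge_min !lexx orbT.
(* maximum points over slices at distance at most eta' are within m of z, since
   their squared distance to z is at most C times that of the slice *)
pose eta' := Num.min eta (Num.min 1 (m ^+ 2 / (2 * C))).
have [e'0 e'1 e'2 e'3] : [/\ 0 < eta', eta' <= eta, eta' <= 1 & C * eta' < m ^+ 2].
  have m2 : 0 < m ^+ 2 / (2 * C) by rewrite divr_gt0 ?exprn_gt0 ?mulr_gt0.
  split; rewrite /eta' ?lt_min ?ge_min ?lexx ?orbT ?eta0 ?ltr01 ?m2 //.
  apply: (@le_lt_trans _ _ (C * (m ^+ 2 / (2 * C)))).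
    by rewrite ler_wpM2l ?(ltW C0) // !ge_min lexx !orbT.
  have -> : C * (m ^+ 2 / (2 * C)) = m ^+ 2 / 2 by field; rewrite gt_eqF.
  by have := exprn_gt0 2 m0; clear; lra.
clearbody eta'.
have penz : pen eps z a z = 0.
  by rewrite /pen subrr ip0r /sqt (_ : tang 0 = 0) ?sqn0 ?mul0r ?addr0.
exists f, eta'; split.
- by rewrite e'0.
- have z0 : - eta <= 0 <= (0 : R) by rewrite lexx andbT oppr_le0 ltW.
  have [cW WE hw] := hW 0 z0.
  have := hw z cz; rewrite mulr0 addr0 => /(_ erefl); rewrite penz subr0 => h1.
  have h2 := bG _ cW; move: h2; rewrite WE mulr0 addr0 subrr normr0 mulr0 addr0 => h2.
  have h3 : sqt (W 0 - z) / eps = 2 * (sqt (W 0 - z) / (2 * eps)) by field; rewrite gt_eqF.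
  have h4 : 0 <= sqt (W 0 - z) / (2 * eps).
    by rewrite divr_ge0 ?sqt_ge0 // mulr_ge0 // ltW.
  apply/eqP; rewrite eq_le /f; apply/andP; split.
    by rewrite /pen h3; clear -h2 h4; lra.
  by clear -h1; lra.
- move=> x /andP[x1 x2]; have xx : - eta <= x <= 0.
    by rewrite x2 andbT; clear -e'1 x1; lra.
  by have [cW WE _] := hW x xx; exists (W x).
- move=> w cw /andP[x1 x2]; set x := sg * _ in x1 x2 *.
  have xx : - eta <= x <= 0 by rewrite x2 andbT; clear -e'1 x1; lra.
  have [_ _ hw] := hW x xx; rewrite /f lerD2r; exact: hw.
move=> r k al be x1 ale ax1 x1b be0 rk.
set q := fun x => r * x + k * x ^+ 2; rewrite -![_ * _ + k * _ ^+ 2]/(q _).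
move=> hal hbe h0.
have inr x : al <= x -> x <= be -> - eta <= x <= 0.
  by move=> h1 h2; apply/andP; split; clear -h1 h2 ale be0 e'1; lra.
have x1r : - eta <= x1 <= 0 by apply: inr; exact: ltW.
have [cW1 W1E _] := hW x1 x1r.
have W1i : sg * ((W x1).1.2 - z.1.2) = x1 by rewrite W1E sgK.
have W1s : al <= sg * ((W x1).1.2 - z.1.2) <= be by rewrite W1i (ltW ax1) (ltW x1b).
have [w [cw ws hw]] := strip_max r k eps0 L0 sg1 cG bG (ltW (lt_trans ax1 x1b)) be0 cW1 W1s.
have hw1 := hw _ cW1 W1s; rewrite W1i in hw1.
set x := sg * (w.1.2 - z.1.2) in ws hw hw1 *.
have xdef : x = sg * (w.1.2 - z.1.2) := erefl.
clearbody x.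
have fle : G w - pen eps z a w - G z <= f x.
  have [_ _ hwx] := hW x (inr x (andP ws).1 (andP ws).2).
  by rewrite /f lerD2r; apply: hwx => //; rewrite xdef -sgK'.
have fge : f x1 - q x1 <= G w - pen eps z a w - G z - q x.
  by move: hw1; rewrite /f /q; clear; lra.
have xa : al < x.
  rewrite lt_neqAle (andP ws).1 andbT; apply/negP => /eqP ex.
  by move: hal; rewrite ex; clear -fle fge; lra.
have xb : x < be.
  rewrite lt_neqAle (andP ws).2 andbT; apply/negP => /eqP ex.
  by move: hbe; rewrite -ex; clear -fle fge; lra.
have x0 : x < 0 := lt_le_trans xb be0.
have kx : `|k * x| <= `|k * al|.
  rewrite !normrM ler_wpM2l // (ler0_norm (ltW x0)) (ler0_norm (ltW (lt_trans xa x0))).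
  by rewrite lerN2 ltW.
have slope : `|r + 2 * k * x| <= 2 * Rb.
  apply: le_trans (ler_normD _ _) _; apply: le_trans rk; rewrite lerD2l.
  by rewrite -mulrA normrM ger0_norm // ler_wpM2l.
have qx : - (2 * Rb * - x) <= q x.
  have hs : `|r + k * x| <= 2 * Rb.
    apply: le_trans (ler_normD _ _) _; apply: le_trans rk; rewrite lerD2l.
    by apply: le_trans kx _; have := normr_ge0 (k * al); clear; lra.
  have -> : q x = - ((r + k * x) * - x) by rewrite /q; ring.
  rewrite lerN2 ler_wpM2r //; first by rewrite oppr_ge0 ltW.
  by apply: le_trans hs; exact: ler_norm.
have xE : `|w.1.2 - z.1.2| = - x.
  have sgn : `|sg| = 1 by apply/eqP; rewrite -sqrp_eq1 // real_normK ?num_real // sg1.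
  by rewrite -[LHS]mul1r -sgn -normrM -xdef ltr0_norm.
have bw := bG w cw; rewrite xE in bw.
have sq1 : sqt (w - z) / (2 * eps) <= (L + 2 * Rb) * - x.
  have h3 : sqt (w - z) / eps = 2 * (sqt (w - z) / (2 * eps)) by field; rewrite gt_eqF.
  move: fge; rewrite /pen h3 => fge; clear -fge bw qx h0; lra.
rewrite ler_pdivrMr ?mulr_gt0 // in sq1.
have wm : `|w - z| < m.
  have h1 := sqr_norm_le_sqn (w - z); rewrite sqn_tang in h1.
  have h2 : (w - z).1.2 ^+ 2 <= - x.
    rewrite -[(w - z).1.2]/(w.1.2 - z.1.2) -real_normK ?num_real // xE expr2 ler_piMr //.
      by rewrite oppr_ge0 ltW.
    by clear -e'2 xa ale; lra.
  have h3 : `|w - z| ^+ 2 <= C * eta'.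
    apply: le_trans h1 _; apply: (@le_trans _ _ (C * - x)).
      by rewrite /C; clear -sq1 h2; lra.
    by rewrite ler_wpM2l ?(ltW C0) //; clear -xa ale; lra.
  by rewrite -ltr_sqr ?nnegrE ?(ltW m0) // (le_lt_trans h3).
have wrho := lt_le_trans wm mrho.
have wt : tau < w.2.
  have := le_lt_trans (norm2_le (w - z)) (lt_le_trans wm mt).
  by rewrite ltr_norml => /andP[+ _]; rewrite -[(w - z).2]/(w.2 - z.2); clear; lra.
have w0 : w.1.2 < 0.
  rewrite (sgK' w) -xdef; case: sgE => [->|[-> h3]]; case: cz => hz _.
    by clear -x0 hz; lra.
  by clear -xa ale h3 e'1; lra.
exists x; first by rewrite xa xb.
apply: (hrho w) => //.
  by rewrite normrM; case: sgE => [->|[-> _]]; rewrite ?normrN normr1 mul1r.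
rewrite xdef; apply: (qjet_strip (tau := tau) (al := al) (be := be)) => //.
  by rewrite -xdef xa xb.
by move=> w' cw' ws'; rewrite -xdef; exact: hw.
Qed.

End SliceEnvelope.

(** * Exponential gauge and penalty at infinity *)

Section Gauge.
Context {R : realType} {d : nat}.
Implicit Types (g w z a : stpoint R d).

(** For x close to 0, from 1 + x <= exp x applied to x and to - x. *)
Lemma expR_quad (x : R) : `|x| <= 2^-1 -> `|expR x - 1 - x| <= 2 * x ^+ 2.
Proof.
move=> xh; have h1 := expR_ge1Dx x; have h2 := expR_ge1Dx (- x).
have [x1 x2] : - 2^-1 <= x /\ x <= 2^-1 by apply/andP; rewrite -ler_norml.
have e0 : 0 < expR x by exact: expR_gt0.
have h3 : expR x * (1 - x) <= 1.
  apply: (@le_trans _ _ (expR x * expR (- x))); first by rewrite ler_wpM2l // ltW.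
  by rewrite expRN divff // gt_eqF.
have h4 : 0 <= x ^+ 2 := sqr_ge0 x.
have h5 : expR x - 1 - x <= 2 * x ^+ 2.
  have : (expR x - (1 + x + 2 * x ^+ 2)) * (1 - x) <= 0.
    have : (1 + x + 2 * x ^+ 2) * (1 - x) - 1 = x ^+ 2 * (1 - 2 * x) by ring.
    have : 0 <= x ^+ 2 * (1 - 2 * x) by rewrite mulr_ge0 //; clear -x2; lra.
    by rewrite mulrBl; clear -h3; lra.
  have h6 : 0 < 1 - x by clear -x2; lra.
  by rewrite pmulr_lle0 //; clear; lra.
by rewrite ler_norml; apply/andP; split; clear -h1 h4 h5; lra.
Qed.

Definition gauge (lam t : R) : R := expR (lam * t).

Lemma gauge_gt0 lam t : 0 < gauge lam t. Proof. exact: expR_gt0. Qed.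

Lemma gauge_ge1 lam t : 0 <= lam -> 0 <= t -> 1 <= gauge lam t.
Proof.
move=> l0 t0; apply: le_trans (expR_ge1Dx _); rewrite lerDl; exact: mulr_ge0.
Qed.

Lemma gauge_le lam s t : 0 <= lam -> s <= t -> gauge lam s <= gauge lam t.
Proof. by move=> l0 st; rewrite /gauge ler_expR ler_wpM2l. Qed.

Lemma gauge_quad lam t : exists2 r : R, 0 < r & forall s, `|s - t| < r ->
  `|gauge lam s - gauge lam t - lam * gauge lam t * (s - t)| <=
  2 * gauge lam t * lam ^+ 2 * (s - t) ^+ 2.
Proof.
have l1 : 0 < `|lam| + 1 by rewrite ltr_wpDl.
exists (2^-1 / (`|lam| + 1)); first by rewrite divr_gt0.
move=> s; rewrite ltr_pdivlMr // => st.
have xs : `|lam * (s - t)| <= 2^-1.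
  rewrite normrM mulrC; apply: le_trans (ltW st).
  by rewrite ler_wpM2l // lerDl.
have -> : gauge lam s = gauge lam t * expR (lam * (s - t)).
  by rewrite /gauge -expRD; congr expR; ring.
have -> : gauge lam t * expR (lam * (s - t)) - gauge lam t - lam * gauge lam t * (s - t)
   = gauge lam t * (expR (lam * (s - t)) - 1 - lam * (s - t)) by ring.
rewrite normrM (gtr0_norm (gauge_gt0 _ _)).
apply: (@le_trans _ _ (gauge lam t * (2 * (lam * (s - t)) ^+ 2))).
  by rewrite ler_wpM2l ?(ltW (gauge_gt0 _ _)) // expR_quad.
by rewrite exprMn le_eqVlt; apply/orP; left; apply/eqP; ring.
Qed.

Lemma continuous_gauge lam : continuous (gauge lam).
Proof.
move=> t; apply: (@continuous_comp _ _ _ (fun t => lam * t) expR); last exact: continuous_expR.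
by apply: cvgMr; exact: cvg_id.
Qed.

Definition spart w : stpoint R d := (w.1, 0).
(** The first term makes the supersolution strict, the second confines maximum points. *)
Definition penalty (lam th kap : R) w : R := th * gauge lam w.2 + kap * sqn (spart w).
Definition penalty_grad (lam th kap : R) w : stpoint R d :=
  ((2 * kap) *: w.1, th * (lam * gauge lam w.2)).

Lemma spartB w z : spart (w - z) = spart w - spart z.
Proof. by rewrite /spart; congr (_, _); rewrite /= subr0. Qed.

Lemma ip_spart w z : ip (spart w) (spart z) = ip (spart w) z.
Proof. by rewrite /ip /spart /= mulr0 mul0r. Qed.

Lemma sqn_spart w : sqn w = sqn (spart w) + w.2 ^+ 2.
Proof. by rewrite {2}/sqn /spart /ip /= mul0r addr0. Qed.

Lemma penalty_grad_split lam th kap w : penalty_grad lam th kap w =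
  (2 * kap) *: spart w + (0, th * (lam * gauge lam w.2)).
Proof.
rewrite /penalty_grad /spart; congr (_, _); first by rewrite /= addr0.
by rewrite /= -[_ *: (0 : R)]/(2 * kap * 0) mulr0 add0r.
Qed.

Lemma ip_time (c : R) w : ip (0, c) w = c * w.2.
Proof.
rewrite /ip /dotp /= big1 => [|k _]; last by rewrite mxE mul0r.
by rewrite mul0r !add0r.
Qed.

Lemma penalty_qjet T lam th kap w : 0 <= th -> 0 <= kap ->
  qjet T (penalty lam th kap) w (penalty_grad lam th kap w).
Proof.
move=> th0 kap0; have [r r0 hr] := gauge_quad lam w.2.
pose C := th * (2 * gauge lam w.2 * lam ^+ 2).
have C0 : 0 <= C.
  by rewrite /C mulr_ge0 // mulr_ge0 ?sqr_ge0 // mulr_ge0 // ltW // gauge_gt0.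
exists (C + kap), r => // y cy yw.
have yw2 : `|y.2 - w.2| < r := le_lt_trans (norm2_le (y - w)) yw.
have := hr y.2 yw2; rewrite ler_norml => /andP[_ h1].
have {}h1 : th * (gauge lam y.2 - gauge lam w.2 - lam * gauge lam w.2 * (y.2 - w.2)) <=
    C * (y.2 - w.2) ^+ 2 by rewrite /C -[leRHS]mulrA ler_wpM2l.
have h2 : C * (y.2 - w.2) ^+ 2 <= C * sqn (y - w).
  by rewrite ler_wpM2l //; exact: (sqr_time_le_sqn (y - w)).
have h3 : kap * sqn (spart (y - w)) <= kap * sqn (y - w).
  by rewrite ler_wpM2l // [leRHS]sqn_spart lerDl sqr_ge0.
have h4 : kap * sqn (spart y) = kap * sqn (spart w) + ip ((2 * kap) *: spart w) (y - w)
   + kap * sqn (spart (y - w)).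
  have -> : spart y = spart w + spart (y - w) by rewrite spartB addrC subrK.
  by rewrite sqnD ip_spart ipZl; ring.
rewrite penalty_grad_split ipDl ip_time /penalty -[(y - w).2]/(y.2 - w.2).
rewrite h4; move: h1 h2 h3; clear; move: (kap * sqn (spart _)) (kap * sqn (spart w)).
move: (ip _ _) (gauge lam _) (gauge lam _) => i0 g1 g2 A1 A2.
rewrite mulrDl; move: (C * sqn _) (C * _ ^+ 2) (kap * _) => B1 B2 B3.
by move=> h1 h2 h3; have := le_trans h1 h2; clear -h3; lra.
Qed.

Lemma continuous_penalty lam th kap : continuous (penalty lam th kap).
Proof.
move=> w; apply: cvgD.
  apply: cvgMr; apply: (@continuous_comp _ _ _ (fun w : stpoint R d => w.2) (gauge lam)).
    exact: continuous_time.
  exact: continuous_gauge.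
have csp : continuous (fun x : stpoint R d => sqn (spart x)).
  have -> : (fun x : stpoint R d => sqn (spart x)) = (fun x => sqn x - x.2 * x.2).
    by apply/funext => y; rewrite [sqn y]sqn_spart expr2 addrK.
  move=> x; apply: cvgB; first exact: continuous_sqn.
  by apply: cvgM; exact: continuous_time.
by apply: cvgMr; exact: csp.
Qed.

Lemma continuous_penalty_grad lam th kap z (e : R) : 0 < e -> exists2 r : R, 0 < r &
  forall w, `|w - z| < r -> `|penalty_grad lam th kap w - penalty_grad lam th kap z| < e.
Proof.
move=> e0; have e2 : 0 < e / 2 by rewrite divr_gt0.
have cg : continuous (fun w : stpoint R d => th * (lam * gauge lam w.2)).
  move=> w; apply: cvgMr; apply: cvgMr.
  apply: (@continuous_comp _ _ _ (fun w : stpoint R d => w.2) (gauge lam)).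
    exact: continuous_time.
  exact: continuous_gauge.
have /cvgrPdist_lt/(_ e e0)/nbhs_normP[r /= r0 hr] := cg z.
have k0 : 0 < `|2 * kap| + 1 by rewrite ltr_wpDl.
exists (Num.min r (e / (`|2 * kap| + 1))); first by rewrite lt_min r0 divr_gt0.
move=> w; rewrite lt_min ltr_pdivlMr // => /andP[w1 w2].
rewrite -[ltLHS]/(Num.max `|(2 * kap) *: w.1 - (2 * kap) *: z.1|
  `|th * (lam * gauge lam w.2) - th * (lam * gauge lam z.2)|) gt_max.
apply/andP; split; last by rewrite distrC; apply: hr => /=; rewrite distrC.
rewrite -scalerBr normrZ; apply: le_lt_trans w2; rewrite mulrC.
apply: ler_pM => //; [exact: (norm1_le (w - z))|by rewrite lerDl].
Qed.

End Gauge.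

(** * Slopes of the two functions on one branch *)

Section BranchSlopes.
Context {R : realType} {d : nat}.
Implicit Types (g w z a : stpoint R d) (G : stpoint R d -> R).

(** A bound with normal slope r that is only required on one side of z. *)
Definition side_touch (eps tau T sg : R) G z a (r : R) := exists2 eta : R, 0 < eta &
  forall w, cyt tau T w -> - eta <= sg * (w.1.2 - z.1.2) <= 0 ->
    G w <= G z + pen eps z a w + r * (w.1.2 - z.1.2).

Lemma edB (r s : R) : ed (r - s) = ed r - ed s :> stpoint R d.
Proof. by rewrite /ed; congr (_, _); [congr (_, _)|]; rewrite /= subr0. Qed.

Lemma norm_ed_le (r : R) : `|ed r : stpoint R d| <= `|r|.
Proof. by rewrite norm_le_st /= !normr0 lexx normr_ge0. Qed.

Lemma touching_bounded (eta Rb : R) f good : touching_slopes eta Rb f good ->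
  touching_slopes eta Rb f (fun r => good r /\ `|r| <= 2 * Rb).
Proof.
move=> hT r k al be x1 h1 h2 h3 h4 hr h5 h6 h7.
have [x /andP[x1' x2] gx] := hT r k al be x1 h1 h2 h3 h4 hr h5 h6 h7.
exists x; rewrite ?x1' //; split=> //.
apply: le_trans (ler_normD _ _) _; apply: le_trans hr; rewrite lerD2l.
rewrite -mulrA normrM ger0_norm // ler_wpM2l // !normrM ler_wpM2l //.
have x0 : x < 0 by exact: lt_le_trans h4.
have a0 : al < 0 by exact: lt_trans x0.
by rewrite (ler0_norm (ltW x0)) (ler0_norm (ltW a0)) lerN2 ltW.
Qed.

Lemma touching_weaken (eta eta' Rb : R) f (good good' : R -> Prop) : eta' <= eta ->
  (forall r, good r -> good' r) ->
  touching_slopes eta Rb f good -> touching_slopes eta' Rb f good'.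
Proof.
move=> ee gg hT r k al be x1 h1 h2 h3 h4 hr h5 h6 h7.
have [|x xx gx] := hT r k al be x1 _ h2 h3 h4 hr h5 h6 h7; last by exists x => //; exact: gg.
by apply: le_trans h1; rewrite lerN2.
Qed.

Lemma continuous_slope_ham T (G0 : stpoint R d -> R) N z a h :
  unif_continuous_ham T h -> cylinder T z -> continuous (slope_ham G0 N z a h).
Proof.
move=> hh cz; apply: continuous_of_eps => r e e0.
have [rho rho0 hrho] := ham_continuous (a + ed r + N z) (G0 z) hh cz e0.
have key (A x y : R) : A + x - (A + y) = x - y by ring.
exists rho => // s sr; rewrite /slope_ham key.
apply: (hrho (a + ed s + N z) z) => //; rewrite ?subrr ?normr0 //.
have -> : (a + ed s + N z).1 - (a + ed r + N z).1 = (ed (s - r)).1.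
  have key2 (A x y B : stpoint R d) : (A + x + B) - (A + y + B) = x - y.
    by rewrite (addrAC A x B) (addrAC A y B) [- _]opprD addrACA subrr add0r.
  by have -> : ed (s - r) = (a + ed s + N z) - (a + ed r + N z) by rewrite key2 edB.
by apply: le_lt_trans (norm1_le _) _; apply: le_lt_trans sr; exact: norm_ed_le.
Qed.

Lemma pen_ed (eps : R) z a (x : R) : a.1.2 = 0 -> pen eps z a (z + ed x) = 0.
Proof.
move=> a0; have zE : z + ed x - z = ed x by rewrite addrAC subrr add0r.
rewrite /pen zE ipC ip_ed a0 mulr0 add0r.
rewrite /sqt (_ : tang (ed x) = 0) ?sqn0 ?mul0r //.
Qed.

(** The envelopes of the two functions satisfy the hypotheses of slope_separation: their
    sum is nonpositive because the doubled function is maximal, and del <= Fu (- r) + Fv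
    r turns the inequality for the second function into a lower bound for Fu. *)
Lemma separated_slopes (eps L tau T Rb sg eta del : R) u vm v0m N0 N z1 z2 a h hd :
  branch_eq eps L tau T Rb u u (fun=> 0) (fun=> 0) z1 a h ->
  branch_eq eps L tau T Rb vm v0m N0 N z2 (- a) hd ->
  a.1.2 = 0 -> z1.1.2 = z2.1.2 ->
  sg = 1 \/ sg = -1 /\ eta <= - z1.1.2 -> 0 < eta -> 0 < del -> L + 1 <= Rb ->
  (forall w1 w2, cyt tau T w1 -> cyt tau T w2 -> w1.1.2 = w2.1.2 ->
     u w1 - pen eps z1 a w1 - u z1 + (vm w2 - pen eps z2 (- a) w2 - vm z2) <= 0) ->
  (forall x, cyt tau T (z1 + ed x) -> u z1 - L * `|x| <= u (z1 + ed x)) ->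
  let Fu := slope_ham u (fun=> 0) z1 a h in
  let Fv := slope_ham v0m N z2 (- a) hd in
  (forall r, `|r| <= 2 * Rb -> del <= Fu (- r) + Fv r) ->
  del <= Fu Rb -> del <= Fu (- Rb) ->
  exists r0 s, 0 < s /\ forall r, `|r - r0| <= s ->
    [/\ 0 < Fu r, 0 < Fv (- r), side_touch eps tau T sg u z1 a r &
        side_touch eps tau T sg vm z2 (- a) (- r)].
Proof.
move=> BE1 BE2 a0 z12 sgE eta0 del0 LR hsum hlip Fu Fv hcmp hR1 hR2.
have e0 : 0 < del / 4 by rewrite divr_gt0.
have sgE2 : sg = 1 \/ sg = -1 /\ eta <= - z2.1.2 by rewrite -z12.
have [f [ef [/andP[ef0 efe] f0 f1 f2 fT]]] := envelope BE1 sgE eta0 e0.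
have [k [ek [/andP[ek0 eke] k0 k1 k2 kT]]] := envelope BE2 sgE2 eta0 e0.
have sg1 : sg ^+ 2 = 1 by case: sgE => [->|[-> _]]; rewrite ?sqrrN expr1n.
have sgn x : `|sg * x| = `|x|.
  by rewrite normrM; case: sgE => [->|[-> _]]; rewrite ?normrN normr1 mul1r.
have cz1 := be_z BE1; have L0 := be_L BE1; have tau0 := be_tau BE1.
have eps0 := be_eps BE1.
pose e := Num.min ef ek.
have ep : 0 < e by rewrite lt_min ef0.
have [ee1 ee2] : e <= ef /\ e <= ek by rewrite !ge_min !lexx orbT.
clearbody e.
have inf x : - e <= x <= 0 -> - ef <= x <= 0.
  by move=> /andP[h1 ->]; rewrite andbT; clear -h1 ee1; lra.
have ink x : - e <= x <= 0 -> - ek <= x <= 0.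
  by move=> /andP[h1 ->]; rewrite andbT; clear -h1 ee2; lra.
have cF : continuous (fun r => Fu (sg * r)).
  move=> r; apply: (@continuous_comp _ _ _ (fun r => sg * r) Fu).
    by apply: cvgMr; exact: cvg_id.
  apply: continuous_slope_ham; [exact: be_ham BE1|exact: cyt_cylinder cz1].
have fk x : - e <= x <= 0 -> f x + k x <= 0.
  move=> xx; have [w1 [cw1 w1x ->]] := f1 x (inf x xx).
  have [w2 [cw2 w2x ->]] := k1 x (ink x xx).
  by apply: hsum => //; rewrite w1x w2x z12.
have fL x : - e <= x <= 0 -> `|f x| <= L * - x.
  move=> xx; have /andP[_ x0] := xx; have [w1 [cw1 w1x fx]] := f1 x (inf x xx).
  have xn : `|w1.1.2 - z1.1.2| = - x by rewrite w1x addrAC subrr add0r sgn ler0_norm.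
  have cy : cyt tau T (z1 + ed (sg * x)).
    by move: cw1 cz1 => [h1 _] [_ h2]; split; rewrite /= ?addr0 // -w1x.
  have hy := hlip _ cy; rewrite sgn ler0_norm // in hy.
  have yE : sg * ((z1 + ed (sg * x)).1.2 - z1.1.2) = x.
    by rewrite /= addrAC subrr add0r mulrA -expr2 sg1 mul1r.
  have h3 := f2 _ cy; rewrite yE pen_ed // in h3; have {}h3 := h3 (inf x xx).
  have h4 := be_growth BE1 cw1; rewrite xn in h4.
  have h5 : sqt (w1 - z1) / eps = 2 * (sqt (w1 - z1) / (2 * eps)) by field; rewrite gt_eqF.
  have h6 : 0 <= sqt (w1 - z1) / (2 * eps) by rewrite divr_ge0 ?sqt_ge0 // mulr_ge0 // ltW.
  rewrite ler_norml; apply/andP; split; first by clear -h3 hy; lra.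
  by rewrite fx /pen h5; clear -h4 h6; lra.
have b12 : del / 4 < del - del / 4 by clear -del0; lra.
have fT' : touching_slopes e Rb f (fun r => Fu (sg * r) <= del / 4).
  exact: touching_weaken ee1 (fun r h => h) fT.
have kT' : touching_slopes e Rb k (fun r => del - del / 4 <= Fu (sg * - r)).
  apply: (touching_weaken ee2 _ (touching_bounded kT)) => r [h1 h2].
  have := hcmp (sg * r); rewrite sgn => /(_ h2); rewrite mulrN.
  by rewrite /Fv; clear -h1; lra.
have hb2 : del - del / 4 <= Fu (sg * - Rb).
  by case: sgE => [->|[-> _]]; rewrite ?mulrNN mul1r; clear -hR1 hR2 del0; lra.
have [r0 [s [s0 hs]]] := slope_separation ep L0 LR b12 cF f0 k0 fk fL hb2 fT' kT'.
exists (sg * r0), s; split=> // r rr.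
have rr' : `|sg * r - r0| <= s.
  rewrite -(sgn (_ - r0)) mulrBr mulrA -expr2 sg1 mul1r; exact: rr.
have [h1 h2 h3 h4 h5] := hs _ rr'.
have sgr : sg * (sg * r) = r by rewrite mulrA -expr2 sg1 mul1r.
rewrite sgr in h1 h2; rewrite sgn in h3; split.
- exact: lt_trans h1.
- have := hcmp (- r); rewrite normrN opprK => /(_ _)/wrap[].
    by have := normr_ge0 r; move: h3; clear; lra.
  by move: h2 del0; clear; lra.
- case: h4 => eta1 eta10 hf; exists (Num.min e eta1); first by rewrite lt_min ep.
  move=> w cw /andP[w1 w2]; have [m1 m2] : Num.min e eta1 <= e /\ Num.min e eta1 <= eta1.
    by rewrite !ge_min !lexx orbT.
  have := f2 w cw; rewrite w2 andbT => /(_ _)/wrap[]; first by clear -w1 m1 ee1; lra.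
  have := hf (sg * (w.1.2 - z1.1.2)); rewrite w2 andbT => /(_ _)/wrap[]; first by clear -w1 m2; lra.
  have -> : sg * r * (sg * (w.1.2 - z1.1.2)) = r * (w.1.2 - z1.1.2).
    by transitivity (sg ^+ 2 * r * (w.1.2 - z1.1.2)); [ring|rewrite sg1 mul1r].
  by clear; lra.
- case: h5 => eta1 eta10 hf; exists (Num.min e eta1); first by rewrite lt_min ep.
  move=> w cw /andP[w1 w2]; have [m1 m2] : Num.min e eta1 <= e /\ Num.min e eta1 <= eta1.
    by rewrite !ge_min !lexx orbT.
  have := k2 w cw; rewrite w2 andbT => /(_ _)/wrap[]; first by clear -w1 m1 ee2; lra.
  have := hf (sg * (w.1.2 - z2.1.2)); rewrite w2 andbT => /(_ _)/wrap[]; first by clear -w1 m2; lra.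
  have -> : - (sg * r) * (sg * (w.1.2 - z2.1.2)) = - r * (w.1.2 - z2.1.2).
    by transitivity (sg ^+ 2 * - r * (w.1.2 - z2.1.2)); [ring|rewrite sg1 mul1r].
  by clear; lra.
Qed.

(** On the junction a bound from inside the branch is a jet. At interior points, bounds
    from the two sides with slopes rr <= rl leave room for a common slope r in between. *)
Lemma side_qjet (eps tau T r rl rr : R) G z a : 0 < eps -> cyt tau T z -> tau < z.2 ->
  side_touch eps tau T 1 G z a rl -> r <= rl ->
  z.1.2 = 0 \/ (side_touch eps tau T (-1) G z a rr /\ rr <= r) ->
  qjet T G z (a + ed r).
Proof.
move=> eps0 cz tz [eta eta0 hl] rrl hr.
have [eta' eta'0 hr'] : exists2 eta' : R, 0 < eta' & forall w, cyt tau T w ->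
    0 < w.1.2 - z.1.2 < eta' -> G w <= G z + pen eps z a w + r * (w.1.2 - z.1.2).
  case: hr => [z0|[[eta' eta'0 h] hrr]].
    by exists 1 => // w [hw _] /andP[w0 _]; move: w0; rewrite z0 subr0 ltNge hw.
  exists eta' => // w cw /andP[w1 w2].
  apply: (@le_trans _ _ (G z + pen eps z a w + rr * (w.1.2 - z.1.2))).
    by apply: h => //; apply/andP; split; clear -w1 w2; lra.
  by rewrite lerD2l ler_wpM2r // ltW.
exists eps^-1, (Num.min (z.2 - tau) (Num.min eta eta')).
  by rewrite !lt_min subr_gt0 tz eta0 eta'0.
move=> w [hw /andP[_ wT]]; rewrite !lt_min => /and3P[wt w1 w2].
have cw : cyt tau T w.
  split=> //; rewrite wT andbT; have := norm2_le (w - z).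
  rewrite ler_norml => /andP[+ _]; rewrite -[(w - z).2]/(w.2 - z.2).
  by clear -wt; lra.
have := norm12_le (w - z); rewrite -[(w - z).1.2]/(w.1.2 - z.1.2) ler_norml => /andP[x1 x2].
apply: (@le_trans _ _ (G z + pen eps z a w + r * (w.1.2 - z.1.2))).
  have [x0|x0] := leP (w.1.2 - z.1.2) 0; last first.
    by apply: hr' => //; rewrite x0; exact: le_lt_trans w2.
  apply: (@le_trans _ _ (G z + pen eps z a w + rl * (w.1.2 - z.1.2))).
    apply: hl => //; rewrite mul1r x0 andbT.
    by clear -x1 w1; lra.
  by rewrite lerD2l ler_wnM2r.
rewrite ipDl ip_ed /pen -[(w - z).1.2]/(w.1.2 - z.1.2).
have : sqt (w - z) / eps <= eps^-1 * sqn (w - z).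
  by rewrite mulrC ler_wpM2l ?invr_ge0 ?(ltW eps0) // sqt_le.
by clear; lra.
Qed.

End BranchSlopes.

(** * Doubling the tangential variables and time *)

Section Doubling.
Context {R : realType} {d K : nat}.
Implicit Types (g w z a : stpoint R d) (u v : 'I_K -> stpoint R d -> R).
Implicit Types (H : 'I_K -> spoint R d -> R -> spoint R d -> R -> R).

Definition doubled (lam th kap eps : R) (f k : stpoint R d -> R) w1 w2 : R :=
  f w1 - (k w2 + penalty lam th kap w2) - sqn (w1 - w2) / (2 * eps).

(** The normal variable is not doubled: the two points lie on the same branches, in
    particular both or none on the junction. *)
Definition paired (tau T : R) w1 w2 :=
  [/\ cyt tau T w1, cyt tau T w2 & w1.1.2 = w2.1.2].

(** The penalty bounds w2, and the doubling term bounds w1 - w2. *)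
Lemma doubling_max1 lam th kap eps tau T M (f k : stpoint R d -> R) w0 :
  0 < kap -> 0 < eps -> 0 <= th -> 0 <= tau -> continuous f -> continuous k ->
  (forall w, cylinder T w -> `|f w| <= M) -> (forall w, cylinder T w -> `|k w| <= M) ->
  cyt tau T w0 ->
  exists p : stpoint R d * stpoint R d, paired tau T p.1 p.2 /\
    forall w1 w2, paired tau T w1 w2 ->
      doubled lam th kap eps f k w1 w2 <= doubled lam th kap eps f k p.1 p.2.
Proof.
move=> kap0 eps0 th0 tau0 cf ck Mf Mk cw0.
pose V := (stpoint R d * stpoint R d)%type.
pose F (p : V) := doubled lam th kap eps f k p.1 p.2.
have c1 : continuous (fun p : V => p.1) by move=> p; exact: cvg_fst.
have c2 : continuous (fun p : V => p.2) by move=> p; exact: cvg_snd.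
have cF : continuous F.
  move=> p; apply: cvgB; first apply: cvgB.
  - by apply: (@continuous_comp _ _ _ (fun p : V => p.1) f); [exact: c1|exact: cf].
  - apply: cvgD; first by apply: (@continuous_comp _ _ _ (fun p : V => p.2) k); [exact: c2|exact: ck].
    apply: (@continuous_comp _ _ _ (fun p : V => p.2) (penalty lam th kap)); first exact: c2.
    exact: continuous_penalty.
  - apply: cvgMl; apply: (@continuous_comp _ _ _ (fun p : V => p.1 - p.2) (@sqn R d)).
      by apply: cvgB; [exact: c1|exact: c2].
    exact: continuous_sqn.
pose cy := [set w : stpoint R d | w.1.2 <= 0 /\ tau <= w.2 <= T].
have ccy : closed cy by exact: closed_cyl.
pose D : set V := (fun p : V => p.1) @^-1` cy `&` ((fun p : V => p.2) @^-1` cy `&`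
  ([set p : V | p.1.1.2 - p.2.1.2 <= 0] `&` [set p : V | p.2.1.2 - p.1.1.2 <= 0])).
have cx1 : continuous (fun p : V => p.1.1.2).
  by move=> p; apply: (@continuous_comp _ _ _ (fun p : V => p.1) (fun w : stpoint R d => w.1.2)); [exact: c1|exact: continuous_xd].
have cx2 : continuous (fun p : V => p.2.1.2).
  by move=> p; apply: (@continuous_comp _ _ _ (fun p : V => p.2) (fun w : stpoint R d => w.1.2)); [exact: c2|exact: continuous_xd].
have cD : closed D.
  apply: closedI; first by apply: closed_comp => // p _; exact: c1.
  apply: closedI; first by apply: closed_comp => // p _; exact: c2.
  by apply: closedI; apply: closed_le0 => p; apply: cvgB; (exact: cx1 || exact: cx2).
have DE (p : V) : D p <-> paired tau T p.1 p.2.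
  split=> [[h1 [h2 [/= h3 h4]]]|[h1 h2 h3]].
    by split=> //; apply/eqP; rewrite eq_le -![(_ <= _.1.2)]subr_le0 h3 h4.
  by split=> //; split=> //; split; rewrite /= h3 subrr.
have D0 : D (w0, w0) by apply/DE; split.
pose c := `|2 * M - F (w0, w0)|.
have c0 : 0 <= c := normr_ge0 _.
(* beyond these radii the penalty, respectively the doubling term, exceeds c *)
pose r1 := 1 + c / kap; pose r2 := 1 + 2 * eps * c.
have r11 : 1 <= r1 by rewrite /r1 lerDl divr_ge0 // ltW.
have r21 : 1 <= r2 by rewrite /r2 lerDl !mulr_ge0 // ltW.
have kr1 : c <= kap * r1 ^+ 2.
  apply: (@le_trans _ _ (kap * r1)).
    by rewrite /r1 mulrDr mulr1 mulrCA divff ?gt_eqF // mulr1 lerDr ltW.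
  by rewrite ler_wpM2l ?(ltW kap0) // expr2 ler_peMl //; exact: le_trans r11.
have kr2 : c <= r2 ^+ 2 / (2 * eps).
  rewrite ler_pdivlMr ?mulr_gt0 // mulrC; apply: (@le_trans _ _ r2).
    by rewrite /r2 lerDr.
  by rewrite expr2 ler_peMl //; exact: le_trans r21.
have [p Dp hp] : exists2 p, D p & forall p', D p' -> F p' <= F p.
  apply: (EVT_closed (w0 := (w0, w0)) (r := r1 + r2 + `|T|)) => //.
    by apply: proper_prod; exact: proper_st.
  move=> [w1 w2] /DE [/= cw1 cw2 w12] hr.
  have cy1 := cyt_cylinder tau0 cw1; have cy2 := cyt_cylinder tau0 cw2.
  have /andP[_ u1] : - M <= f w1 <= M by rewrite -ler_norml; exact: Mf.
  have /andP[l1 _] : - M <= k w2 <= M by rewrite -ler_norml; exact: Mk.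
  have q0 : 0 <= sqn (w1 - w2) / (2 * eps) by rewrite divr_ge0 ?sqn_ge0 // mulr_ge0 // ltW.
  have g0 : 0 <= th * gauge lam w2.2 by rewrite mulr_ge0 // ltW // gauge_gt0.
  have k0 : 0 <= kap * sqn (spart w2) by rewrite mulr_ge0 ?sqn_ge0 // ltW.
  have cc : 2 * M - F (w0, w0) <= c by exact: ler_norm.
  have big : c <= kap * sqn (spart w2) \/ c <= sqn (w1 - w2) / (2 * eps).
    have [h1|h1] := ltP r1 `|w2.1|.
      left; apply: le_trans kr1 _; rewrite ler_wpM2l ?(ltW kap0) //.
      apply: le_trans (sqr_norm_le_sqn (spart w2)); rewrite ler_sqr ?nnegrE //.
        by apply: le_trans (ltW h1) _; exact: (norm1_le (spart w2)).
      exact: le_trans r11.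
    have [h2|h2] := ltP r2 `|w1 - w2|.
      right; apply: le_trans kr2 _; rewrite ler_wpM2r ?invr_ge0 ?mulr_ge0 ?(ltW eps0) //.
      apply: le_trans (sqr_norm_le_sqn _); rewrite ler_sqr ?nnegrE ?(ltW h2) //.
      exact: le_trans r21.
    exfalso; move: hr; rewrite ltNge => /negP; apply.
    have w2b : `|w2| <= r1 + `|T|.
      rewrite -[leLHS]/(Num.max `|w2.1| `|w2.2|) ge_max; apply/andP; split.
        by apply: le_trans h1 _; rewrite lerDl.
      case: cy2 => _ /andP[t0 tT]; rewrite ger0_norm //.
      apply: le_trans tT _; apply: le_trans (ler_norm T) _; rewrite lerDr.
      exact: le_trans r11.
    rewrite -[leLHS]/(Num.max `|w1| `|w2|) ge_max; apply/andP; split.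
      rewrite -(subrK w2 w1); apply: le_trans (ler_normD _ _) _.
      by clear -w2b h2; lra.
    apply: le_trans w2b _; have : 0 <= r2 by exact: le_trans r21.
    by clear; lra.
  rewrite {1}/F /doubled /penalty /=.
  by case: big => hb; clear -u1 l1 q0 g0 k0 cc hb; lra.
exists p; split; first by apply/DE.
by move=> w1 w2 hw; apply: (hp (w1, w2)); apply/DE.
Qed.

Lemma doubling_max lam th kap eps tau T M u v w0 (i0 : 'I_K) :
  0 < kap -> 0 < eps -> 0 <= th -> 0 <= tau ->
  (forall i, continuous (u i)) -> (forall i, continuous (v i)) ->
  (forall i w, cylinder T w -> `|u i w| <= M) -> (forall i w, cylinder T w -> `|v i w| <= M) ->
  cyt tau T w0 ->
  exists j z1 z2, paired tau T z1 z2 /\ forall i w1 w2, paired tau T w1 w2 ->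
      doubled lam th kap eps (u i) (v i) w1 w2 <= doubled lam th kap eps (u j) (v j) z1 z2.
Proof.
move=> kap0 eps0 th0 tau0 cu cv Mu Mv cw0.
have /choice[p hp] := fun i => doubling_max1 lam kap0 eps0 th0 tau0 (cu i) (cv i) (Mu i) (Mv i) cw0.
have [j _ hj] := @Order.TotalTheory.arg_maxP _ _ _ i0 xpredT
  (fun i => doubled lam th kap eps (u i) (v i) (p i).1 (p i).2) isT.
exists j, (p j).1, (p j).2; split; first exact: (hp j).1.
by move=> i w1 w2 /((hp i).2) /le_trans; apply; exact: hj.
Qed.

Lemma glued_eq T u i j z : glued T u -> cylinder T z -> z.1.2 = 0 -> u i z = u j z.
Proof. by case: z => -[z' x] t gu [_ /= zt] ->; exact: gu. Qed.

Lemma jet0 T w : jet T (fun=> 0) w (0 : stpoint R d).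
Proof.
move=> e e0; exists 1 => // y _ _ _; rewrite ip0l !add0r.
by rewrite mulr_ge0 // ltW.
Qed.

Lemma ip_tang0 g y : g.1.2 = 0 -> ip g (tang y) = ip g y.
Proof. by move=> g0; rewrite [in RHS](tang_ed y) ipDr (ipC g (ed _)) ip_ed g0 mulr0 addr0. Qed.

Lemma tang_part z w : w - (z + tang (w - z)) = ed (w.1.2 - z.1.2).
Proof. by rewrite opprD addrA {1}(tang_ed (w - z)) addrAC subrr add0r. Qed.

Lemma cyt_tang tau T z w : cyt tau T z -> cyt tau T w -> cyt tau T (z + tang (w - z)).
Proof.
move=> [hz _] [_ hw]; split; first by rewrite /= addr0.
by rewrite /= addrC subrK.
Qed.

Definition is_doubled_max lam th kap eps tau T u v (j : 'I_K) z1 z2 :=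
  paired tau T z1 z2 /\ forall i w1 w2, paired tau T w1 w2 ->
   doubled lam th kap eps (u i) (v i) w1 w2 <= doubled lam th kap eps (u j) (v j) z1 z2.

(** Moving the first point parallel to the junction keeps the points paired; the
    remaining normal displacement is paid by the Lipschitz constant of the first
    function. *)
Lemma doubled_u_growth lam th kap eps tau T Lu u v j z1 z2 i :
  0 < eps -> 0 <= Lu -> is_doubled_max lam th kap eps tau T u v j z1 z2 ->
  (forall w w', cyt tau T w -> cyt tau T w' -> `|u i w - u i w'| <= Lu * `|w - w'|) ->
  u i z1 = u j z1 -> v i z2 = v j z2 ->
  bounded_growth Lu eps tau T (u i) z1 (eps^-1 *: (z1 - z2)).
Proof.
move=> eps0 Lu0 [[cz1 cz2 z12] hm] hL ui vi w cw.
pose w' := z1 + tang (w - z1).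
have cw' : cyt tau T w' by exact: cyt_tang.
have h1 : u i w - u i w' <= Lu * `|w.1.2 - z1.1.2|.
  apply: le_trans (ler_norm _) _; apply: le_trans (hL _ _ cw cw') _.
  by rewrite ler_wpM2l // tang_part norm_ed_le.
have w'x : w'.1.2 = z2.1.2 by rewrite -z12 /= addr0.
have := hm i w' z2 (And3 cw' cz2 w'x).
rewrite /doubled -ui -vi => h2.
have z120 : (z1 - z2).1.2 = 0 by rewrite /= z12 subrr.
have e1 : sqn (w' - z2) = sqn (z1 - z2) + 2 * ip (z1 - z2) (w - z1) + sqt (w - z1).
  have -> : w' - z2 = (z1 - z2) + tang (w - z1) by rewrite /w' addrAC.
  by rewrite sqnD ip_tang0.
have e2 : (sqn (z1 - z2) + 2 * ip (z1 - z2) (w - z1) + sqt (w - z1)) / (2 * eps) =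
  sqn (z1 - z2) / (2 * eps) + eps^-1 * ip (z1 - z2) (w - z1) + sqt (w - z1) / (2 * eps).
  by field; rewrite gt_eqF.
move: h2; rewrite e1 ipZl e2; move: h1; clear; lra.
Qed.

(** When the second point moves in the normal direction the first one has to follow,
    which is again paid by the Lipschitz constant of the first function. *)
Lemma doubled_v_growth lam th kap eps tau T Lu u v j z1 z2 i :
  0 < eps -> 0 <= Lu -> is_doubled_max lam th kap eps tau T u v j z1 z2 ->
  (forall w w', cyt tau T w -> cyt tau T w' -> `|u i w - u i w'| <= Lu * `|w - w'|) ->
  u i z1 = u j z1 -> v i z2 = v j z2 ->
  bounded_growth Lu eps tau T (fun w => - v i w - penalty lam th kap w) z2
    (- (eps^-1 *: (z1 - z2))).
Proof.
move=> eps0 Lu0 [[cz1 cz2 z12] hm] hL ui vi w cw.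
pose x := w.1.2 - z2.1.2; pose w' := z1 + ed x.
have w'x : w'.1.2 = w.1.2 by rewrite /w' /x /= z12 addrC subrK.
have cw' : cyt tau T w'.
  by case: cw cz1 => hw _ [_ hz]; split; rewrite ?w'x //= addr0.
have h1 : u i z1 - u i w' <= Lu * `|x|.
  apply: le_trans (ler_norm _) _; apply: le_trans (hL _ _ cz1 cw') _.
  rewrite ler_wpM2l // -normrN opprB /w' addrAC subrr add0r; exact: norm_ed_le.
have := hm i w' w (And3 cw' cw w'x); rewrite /doubled -ui -vi => h2.
have z120 : (z1 - z2).1.2 = 0 by rewrite /= z12 subrr.
have e1 : sqn (w' - w) = sqn (z1 - z2) - 2 * ip (z1 - z2) (w - z2) + sqt (w - z2).
  have -> : w' - w = (z1 - z2) - tang (w - z2).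
    have -> : tang (w - z2) = w - z2 - ed x by rewrite {2}(tang_ed (w - z2)) addrK.
    by rewrite !opprB addrCA subrKA addrA [ed x + z1]addrC.
  by rewrite sqnB ip_tang0.
have e2 : (sqn (z1 - z2) - 2 * ip (z1 - z2) (w - z2) + sqt (w - z2)) / (2 * eps) =
  sqn (z1 - z2) / (2 * eps) - eps^-1 * ip (z1 - z2) (w - z2) + sqt (w - z2) / (2 * eps).
  by field; rewrite gt_eqF.
move: h2; rewrite e1 ipNl ipZl e2; move: h1; rewrite -/x; clear; lra.
Qed.

Lemma doubled_slices lam th kap eps tau T u v j z1 z2 i w1 w2 :
  0 < eps -> is_doubled_max lam th kap eps tau T u v j z1 z2 ->
  u i z1 = u j z1 -> v i z2 = v j z2 ->
  cyt tau T w1 -> cyt tau T w2 -> w1.1.2 = w2.1.2 ->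
  u i w1 - pen eps z1 (eps^-1 *: (z1 - z2)) w1 - u i z1 +
    (- v i w2 - penalty lam th kap w2 - pen eps z2 (- (eps^-1 *: (z1 - z2))) w2
     - (- v i z2 - penalty lam th kap z2)) <= 0.
Proof.
move=> eps0 [[cz1 cz2 z12] hm] ui vi cw1 cw2 w12.
have := hm i w1 w2 (And3 cw1 cw2 w12); rewrite /doubled -ui -vi => h2.
have z120 : (z1 - z2).1.2 = 0 by rewrite /= z12 subrr.
set y1 := w1 - z1; set y2 := w2 - z2.
have yx : tang (y1 - y2) = y1 - y2.
  have yx0 : (y1 - y2).1.2 = 0 by rewrite /y1 /y2 /= w12 z12 subrr.
  rewrite [in RHS](tang_ed (y1 - y2)) yx0.
  by rewrite (_ : ed 0 = 0) ?addr0.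
have e1 : w1 - w2 = (z1 - z2) + (y1 - y2).
  by rewrite /y1 /y2 opprB addrCA !subrKA.
have e2 : sqn (w1 - w2) <= sqn (z1 - z2) + 2 * ip (z1 - z2) (y1 - y2) + 2 * (sqt y1 + sqt y2).
  rewrite e1 sqnD lerD2l -yx tangB sqnB -/(sqt y1) -/(sqt y2).
  have := sqn_ge0 (tang y1 + tang y2); rewrite sqnD -/(sqt y1) -/(sqt y2); clear; lra.
have e3 : sqn (w1 - w2) / (2 * eps) <= sqn (z1 - z2) / (2 * eps) +
    eps^-1 * ip (z1 - z2) (y1 - y2) + (sqt y1 / eps + sqt y2 / eps).
  have -> : sqn (z1 - z2) / (2 * eps) + eps^-1 * ip (z1 - z2) (y1 - y2) +
     (sqt y1 / eps + sqt y2 / eps) =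
    (sqn (z1 - z2) + 2 * ip (z1 - z2) (y1 - y2) + 2 * (sqt y1 + sqt y2)) / (2 * eps).
    by field; rewrite gt_eqF.
  by rewrite ler_wpM2r // invr_ge0 mulr_ge0 // ltW.
rewrite /pen -/y1 -/y2 ipNl !ipZl; move: e3; rewrite ipBr mulrBr.
move: h2; clear; lra.
Qed.

End Doubling.

(** * Contradiction at a doubled maximum *)

Section Contradiction.
Context {R : realType} {d K : nat}.
Implicit Types (g w z a : stpoint R d) (u v : 'I_K -> stpoint R d -> R).
Implicit Types (H : 'I_K -> spoint R d -> R -> spoint R d -> R -> R).

Lemma dual_ham_unif T H i : unif_continuous_ham T (H i) ->
  unif_continuous_ham T (dual_ham H i).
Proof.
move=> hH M e e0; have [r r0 hr] := hH M e e0; exists r => // q q' Dq Dq' qq.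
pose f (q : spoint R d * R * stpoint R d) := (- q.1.1, - q.1.2, q.2).
have Df p : ham_domain T M p -> ham_domain T M (f p).
  by move=> [h1 h2 h3]; split; rewrite /= ?normrN.
have h := hr (f q) (f q') (Df _ Dq) (Df _ Dq').
have fq : `|f q - f q'| < r.
  rewrite -[ltLHS]/(Num.max (Num.max `|- q.1.1 - - q'.1.1| `|- q.1.2 - - q'.1.2|) `|q.2 - q'.2|).
  by rewrite -!opprD !normrN; exact: qq.
have := h fq; rewrite /uncurry_ham /dual_ham /f /=.
move: (H i _ _ _ _) (H i _ _ _ _) => x y.
by rewrite -opprD normrN.
Qed.

Lemma tgrad_split (b n : stpoint R d) (s : R) :
  b + ed s + n = tgrad (b + n).1.1 (s + (b + n).1.2) (b + n).2.
Proof.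
rewrite /tgrad; apply/pair_equal_spec; split; last by rewrite /= addr0.
apply/pair_equal_spec; split; first by rewrite /= addr0.
by rewrite /=; ring.
Qed.

(** At an interior point, apply separated_slopes on both sides. If the slope rr found on
    the right is at most the slope rl found on the left, rl is the normal slope of a jet
    of u and violates its equation; otherwise - rl is one for - v. On the junction each
    branch has an interval of slopes of centre r i and radius s i; the equations being
    violated, the Kirchhoff conditions must hold for u with the slopes r i + s i and for
    v with r i - s i, which is impossible as the s i are positive. *)
Lemma doubled_contradiction lam th kap eps tau T B Lu Rb del H u v (j : 'I_K) z1 z2 :
  0 < eps -> 0 <= kap -> 0 <= th -> 0 <= tau -> 0 <= Lu -> Lu + 1 <= Rb -> 0 < del ->
  (forall i, unif_continuous_ham T (H i)) ->
  (forall i, continuous (u i)) -> (forall i, continuous (v i)) ->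
  glued T u -> glued T v ->
  (forall i w w', cyt tau T w -> cyt tau T w' -> `|u i w - u i w'| <= Lu * `|w - w'|) ->
  jet_sub T tau B H u -> jet_sub T tau (- B) (dual_ham H) (fun i w => - v i w) ->
  is_doubled_max lam th kap eps tau T u v j z1 z2 -> tau < z1.2 -> tau < z2.2 ->
  let a := eps^-1 *: (z1 - z2) in
  (forall i, u i z1 = u j z1 -> v i z2 = v j z2 ->
    let Fu := slope_ham (u i) (fun=> 0) z1 a (H i) in
    let Fv := slope_ham (fun w => - v i w) (penalty_grad lam th kap) z2 (- a) (dual_ham H i) in
    [/\ forall r, `|r| <= 2 * Rb -> del <= Fu (- r) + Fv r, del <= Fu Rb & del <= Fu (- Rb)]) ->
  False.
Proof.
move=> eps0 kap0 th0 tau0 Lu0 LR del0 hH cu cv gu gv hL su sv hmax t1 t2 a hF.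
have [[cz1 cz2 z12] _] := hmax.
have ccz1 := cyt_cylinder tau0 cz1; have ccz2 := cyt_cylinder tau0 cz2.
have Rb0 : 0 < Rb by clear -Lu0 LR; lra.
have a0 : a.1.2 = 0 by rewrite /a /= z12 subrr scaler0.
pose vm i w := - v i w - penalty lam th kap w.
have cvm i : continuous (vm i).
  move=> w; apply: cvgB; last exact: continuous_penalty.
  by apply: cvgN; exact: cv.
have cvN i : continuous (fun w => - v i w) by move=> w; apply: cvgN; exact: cv.
pose N0 := penalty (d := d) lam th kap; pose N := penalty_grad (d := d) lam th kap.
have vE i w : - v i w = vm i w + N0 w by rewrite /vm subrK.
have jetu i r : qjet T (u i) z1 (a + ed r) -> jet T (u i) z1 (a + ed r + 0).
  by rewrite addr0; exact: qjet_jet.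
have jetv i s : qjet T (vm i) z2 (- a + ed s) -> jet T (fun w => - v i w) z2 (- a + ed s + N z2).
  move=> hq; rewrite (_ : (fun w => - v i w) = (fun w => vm i w + N0 w)).
    by apply: jetD; [exact: qjet_jet|apply/qjet_jet; exact: penalty_qjet].
  by apply/funext => w; exact: vE.
have sep i sg eta : u i z1 = u j z1 -> v i z2 = v j z2 ->
    sg = 1 \/ sg = -1 /\ eta <= - z1.1.2 -> 0 < eta ->
  exists r0 s, 0 < s /\ forall r, `|r - r0| <= s ->
    [/\ 0 < slope_ham (u i) (fun=> 0) z1 a (H i) r,
        0 < slope_ham (fun w => - v i w) N z2 (- a) (dual_ham H i) (- r),
        side_touch eps tau T sg (u i) z1 a r &
        side_touch eps tau T sg (vm i) z2 (- a) (- r)].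
  move=> ui vi sgE eta0; have [h1 h2 h3] := hF i ui vi.
  have BE1 : branch_eq eps Lu tau T Rb (u i) (u i) (fun=> 0) (fun=> 0) z1 a (H i).
    split=> //; first by move=> w; rewrite addr0.
    - exact: doubled_u_growth hmax (hL i) ui vi.
    - by move=> w _; exact: jet0.
    - by move=> e e0; exists 1 => // w _; rewrite subrr normr0.
    - by move=> w g; apply: su.1.
  have BE2 : branch_eq eps Lu tau T Rb (vm i) (fun w => - v i w) N0 N z2 (- a) (dual_ham H i).
    split=> //.
    - exact: doubled_v_growth hmax (hL i) ui vi.
    - by move=> w _; apply/qjet_jet; exact: penalty_qjet.
    - by move=> e e0; exact: continuous_penalty_grad.
    - exact: dual_ham_unif.
    - by move=> w g; apply: sv.1.
  apply: (separated_slopes (eta := eta) (del := del) BE1 BE2) => //.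
  - by move=> w1 w2 cw1 cw2 w12; exact: doubled_slices hmax ui vi cw1 cw2 w12.
  - move=> x cx; have := hL i z1 _ cz1 cx.
    rewrite opprD addrA subrr add0r normrN ler_norml => /andP[_ hx].
    have : Lu * `|ed x : stpoint R d| <= Lu * `|x| by rewrite ler_wpM2l // norm_ed_le.
    by move: hx; clear; lra.
have slopeu i r : slope_ham (u i) (fun=> 0) z1 a (H i) r =
    ham_at H i z1 (a + ed r + 0) (u i z1).
  by rewrite /slope_ham /ham_at /= !addr0.
have slopev i r : slope_ham (fun w => - v i w) N z2 (- a) (dual_ham H i) r =
    ham_at (dual_ham H) i z2 (- a + ed r + N z2) (- v i z2).
  by rewrite /slope_ham /ham_at /= addr0.
have tT1 : tau < z1.2 <= T by rewrite t1; case: cz1 => _ /andP[].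
have tT2 : tau < z2.2 <= T by rewrite t2; case: cz2 => _ /andP[].
have [x0|x0] := ltP z1.1.2 0.
  have x0' : 0 < - z1.1.2 by rewrite oppr_gt0.
  have [rl [sl [sl0 hl]]] := sep j 1 _ erefl erefl (or_introl erefl) x0'.
  have [rr [sr [sr0 hr]]] := sep j (-1) _ erefl erefl (or_intror (conj erefl (lexx _))) x0'.
  have [l1 l2 l3 l4] := hl rl (ltac:(by rewrite subrr normr0 ltW)).
  have [r1 r2 r3 r4] := hr rr (ltac:(by rewrite subrr normr0 ltW)).
  have [rrl|rrl] := leP rr rl.
    move: l1; rewrite ltNge slopeu => /negP; apply; apply: su.1 => //.
    apply: jetu; apply: (side_qjet eps0 cz1 t1 l3 (lexx _)).
    by right; split; [exact: r3|].
  move: l2; rewrite ltNge slopev => /negP; apply; apply: sv.1 => //.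
    by rewrite -z12.
  apply: jetv; apply: (side_qjet eps0 cz2 t2 l4 (lexx _)).
  by right; split; [exact: r4|rewrite lerN2 ltW].
have z10 : z1.1.2 = 0 by apply/eqP; rewrite eq_le x0 andbT; case: cz1.
have z20 : z2.1.2 = 0 by rewrite -z12.
have ui i : u i z1 = u j z1 by exact: (glued_eq i j gu ccz1 z10).
have vi i : v i z2 = v j z2 by exact: (glued_eq i j gv ccz2 z20).
have /choice[r hr] := fun i => sep i 1 1 (ui i) (vi i) (or_introl erefl) ltr01.
have /choice[s hs] := hr.
have us : \sum_i (r i + s i) <= B.
  have [i|h|[i]] := su.2 z1 (a + 0).1.1 (fun i => r i + s i + (a + 0).1.2) (a + 0).2 z10 tT1.
  - have [si0 /(_ (r i + s i))] := hs i; rewrite addrC addKr ger0_norm ?(ltW si0) // => /(_ (lexx _)).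
    move=> [_ _ h3 _]; rewrite -tgrad_split; apply: jetu.
    by apply: (side_qjet (rr := 0) eps0 cz1 t1 h3 (lexx _)); left.
  - by move: h; under eq_bigr do rewrite addr0 a0 addr0.
  - have [si0 /(_ (r i + s i))] := hs i; rewrite addrC addKr ger0_norm ?(ltW si0) // => /(_ (lexx _)).
    by move=> [h1 _ _ _]; rewrite -tgrad_split -slopeu leNgt h1.
have vs : \sum_i - (r i - s i) <= - B.
  have Nz : (- a + N z2).1.2 = 0.
    rewrite -[LHS]/(- a.1.2 + 2 * kap * z2.1.2).
    by rewrite a0 z20 mulr0 oppr0 addr0.
  have rs i : `|r i - s i - r i| <= s i.
    by have [si0 _] := hs i; rewrite addrAC subrr add0r normrN ger0_norm ?(ltW si0).
  have [i|h|[i]] := sv.2 z2 (- a + N z2).1.1 (fun i => - (r i - s i) + (- a + N z2).1.2)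
     (- a + N z2).2 z20 tT2.
  - have [si0 /(_ (r i - s i) (rs i))[_ _ _ h4]] := hs i.
    rewrite -tgrad_split; apply: jetv.
    by apply: (side_qjet (rr := 0) eps0 cz2 t2 h4 (lexx _)); left.
  - by move: h; under eq_bigr do rewrite Nz addr0.
  - have [si0 /(_ (r i - s i) (rs i))[_ h2 _ _]] := hs i.
    by rewrite -tgrad_split -slopev leNgt h2.
have s0 : 0 < \sum_i s i.
  rewrite (bigD1 j) //=; have [sj0 _] := hs j; rewrite ltr_wpDr // sumr_ge0 // => i _.
  by have [/ltW] := hs i.
move: us vs; rewrite sumrN big_split /= sumrB; move: s0; clear; lra.
Qed.

End Contradiction.

(** * Comparison with a Lipschitz subsolution *)

Section ComparisonLip.
Context {R : realType} {d K : nat}.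
Implicit Types (g w z a : stpoint R d) (u v : 'I_K -> stpoint R d -> R).
Implicit Types (H : 'I_K -> spoint R d -> R -> spoint R d -> R -> R).

Definition lipschitz_bound (T Lam : R) (h : spoint R d -> R -> spoint R d -> R -> R) :=
  forall p (b c : R) x (s t : R), cylinder T (x, s) -> cylinder T (x, t) ->
    `|h p b x s - h p c x t| <= Lam * (`|b - c| + `|s - t|).

Lemma sp_norm2_le (p : spoint R d) : `|p.2| <= `|p|.
Proof. by rewrite -[leRHS]/(Num.max `|p.1| `|p.2|) le_max lexx orbT. Qed.

(** Compare with the value at (z2, z2). *)
Lemma doubled_gap_or_eq lam th kap eps tau T Lu u v (j : 'I_K) z1 z2 :
  0 < eps -> is_doubled_max lam th kap eps tau T u v j z1 z2 ->
  (forall w w', cyt tau T w -> cyt tau T w' -> `|u j w - u j w'| <= Lu * `|w - w'|) ->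
  `|z1 - z2| <= 2 * eps * Lu /\ `|eps^-1 *: (z1 - z2)| <= 2 * Lu \/ z1 = z2.
Proof.
move=> eps0 [[cz1 cz2 z12] hm] hL.
have := hm j z2 z2 (And3 cz2 cz2 erefl); rewrite /doubled subrr sqn0 mul0r subr0 => h1.
have h2 := le_trans (ler_norm _) (hL _ _ cz1 cz2).
have h3 : sqn (z1 - z2) / (2 * eps) <= Lu * `|z1 - z2| by clear -h1 h2; lra.
rewrite ler_pdivrMr ?mulr_gt0 // in h3.
have [e0|n0] := eqVneq (z1 - z2) 0; first by right; apply/eqP; rewrite -subr_eq0 e0.
have np : 0 < `|z1 - z2| by rewrite normr_gt0.
have h4 : `|z1 - z2| <= 2 * eps * Lu.
  rewrite -(ler_pM2r np); apply: le_trans (_ : _ <= sqn (z1 - z2)) _.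
    by rewrite -expr2 sqr_norm_le_sqn.
  by apply: le_trans h3 _; rewrite le_eqVlt; apply/orP; left; apply/eqP; ring.
left; split=> //; rewrite normrZ gtr0_norm ?invr_gt0 // mulrC ler_pdivrMr //.
by apply: le_trans h4 _; rewrite le_eqVlt; apply/orP; left; apply/eqP; ring.
Qed.

Lemma doubled_gap_bound lam th kap eps tau T Lu u v (j : 'I_K) z1 z2 :
  0 < eps -> 0 <= Lu -> is_doubled_max lam th kap eps tau T u v j z1 z2 ->
  (forall w w', cyt tau T w -> cyt tau T w' -> `|u j w - u j w'| <= Lu * `|w - w'|) ->
  `|z1 - z2| <= 2 * eps * Lu /\ `|eps^-1 *: (z1 - z2)| <= 2 * Lu.
Proof.
move=> eps0 Lu0 hm hL; have [//|->] := doubled_gap_or_eq eps0 hm hL.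
by rewrite subrr scaler0 normr0; split; rewrite !mulr_ge0 // ltW.
Qed.

(** The strictness th * lam * gauge brought by the penalty exceeds the errors made in
    replacing the point z1, the value of u and the gradient of u by those of v. *)
Lemma ham_gap T lam th kap Lam om rho del (Mb : R) (h : spoint R d -> R -> spoint R d -> R -> R)
    (fu fv : stpoint R d -> R) z1 z2 a (r : R) :
  cylinder T z1 -> cylinder T z2 ->
  lipschitz_bound T Lam h ->
  (forall q q', ham_domain T Mb q -> ham_domain T Mb q' -> `|q - q'| < rho ->
     `|uncurry_ham h q - uncurry_ham h q'| < om) ->
  `|a| + `|r| + 1 <= Mb -> `|fv z2| <= Mb -> 0 <= kap ->
  2 * kap * `|z2.1| < rho -> 2 * kap * `|z2.1| <= 1 -> `|z1 - z2| < rho ->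
  del <= th * (lam * gauge lam z2.2) - Lam * (`|fu z1 - fv z2| + `|z1 - z2|) - om ->
  0 <= Lam ->
  del <= slope_ham fu (fun=> 0) z1 a h (- r) +
    slope_ham (fun w => - fv w) (penalty_grad lam th kap) z2 (- a)
      (fun p c x t => - h (- p) (- c) x t) r.
Proof.
move=> cz1 cz2 hl hu Ma Mv kap0 kr k1 z12 hdel Lam0.
rewrite /slope_ham opprK addr0.
set P := (a + ed (- r) + 0).1; set P' := - (- a + ed r + penalty_grad lam th kap z2).1.
have cz12 : cylinder T (z1.1, z2.2).
  by case: cz1 cz2 => [h1 _] [_ h2].
have PP : P - P' = (2 * kap) *: z2.1.
  rewrite /P /P' /penalty_grad opprK /= addr0.
  have -> : (0, - r) = - (0, r) :> spoint R d by congr (_, _); rewrite oppr0.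
  by rewrite addrA addrA [a.1 - _ + _]addrAC subrr add0r [- _ + _]addrC subrr add0r.
have nP : `|P| <= `|a| + `|r|.
  rewrite /P addr0; apply: le_trans (norm1_le _) _; apply: le_trans (ler_normD _ _) _.
  by rewrite lerD2l -(normrN r); exact: norm_ed_le.
have nP' : `|P'| <= Mb.
  have -> : P' = P - (P - P') by rewrite opprB addrC subrK.
  apply: le_trans (ler_normB _ _) _; apply: le_trans Ma; apply: lerD => //.
  by rewrite PP normrZ ger0_norm // mulr_ge0.
have h1 := hl P (fu z1) (fv z2) z1.1 z1.2 z2.2.
have {}h1 := h1 (ltac:(by case: (z1) cz1)) cz12.
have h2 : `|h P (fv z2) z1.1 z2.2 - h P' (fv z2) z2.1 z2.2| < om.
  have := hu (P, fv z2, (z1.1, z2.2)) (P', fv z2, z2).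
  apply.
  - by split=> //=; apply: le_trans nP _; apply: le_trans Ma; rewrite lerDl.
  - by split.
  - have hh : Num.max `|P - P'| `|fv z2 - fv z2| < rho.
      rewrite subrr normr0 gt_max PP normrZ ger0_norm ?mulr_ge0 // kr.
      by rewrite (le_lt_trans _ kr) // !mulr_ge0.
    rewrite -[ltLHS]/(Num.max (Num.max `|P - P'| `|fv z2 - fv z2|) `|(z1.1, z2.2) - z2|).
    rewrite gt_max hh /=; rewrite -[ltLHS]/(Num.max `|z1.1 - z2.1| `|z2.2 - z2.2|).
    rewrite gt_max subrr normr0 (le_lt_trans (norm1_le (z1 - z2)) z12).
    by rewrite (le_lt_trans _ z12).
have h3 : Lam * (`|fu z1 - fv z2| + `|z1.2 - z2.2|) <= Lam * (`|fu z1 - fv z2| + `|z1 - z2|).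
  by rewrite ler_wpM2l // lerD2l; exact: (norm2_le (z1 - z2)).
move: h1 h2; rewrite ler_norml ltr_norml => /andP[h1 _] /andP[h2 _].
have -> : (- a + penalty_grad lam th kap z2).2 = - a.2 + th * (lam * gauge lam z2.2) by [].
move: h1 h2 h3 hdel; clear; move: (h P _ _ _) (h P _ _ _) (h P' _ _ _) => A1 A2 A3.
by move: (Lam * _) (Lam * _) (th * _) => B1 B2 B3; lra.
Qed.

Lemma pick_small (l : seq R) : all (fun x => 0 < x) l ->
  exists2 m : R, 0 < m & all (fun x => m < x) l.
Proof.
elim: l => [_|x l IH /= /andP[x0 /IH[m m0 hm]]]; first by exists 1.
exists (Num.min m (x / 2)); first by rewrite lt_min m0 divr_gt0.
rewrite gt_min; apply/andP; split; first by apply/orP; right; clear -x0; lra.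
by apply: sub_all hm => y my; rewrite gt_min my.
Qed.

(** Otherwise the supremum th0 of (u - v) / gauge exceeds c. With th between c and th0,
    and small eps and kap, the doubled function with weight th is maximal at points at
    which the hypotheses of doubled_contradiction hold: the Hamiltonians differ by at
    most Lam * th0 * gauge plus small errors, and lam * th > Lam * th0 when th >= th0 /
    2. *)
Lemma comparison_lip T tau c Lu Lam M B H u v : (0 < K)%N ->
  0 <= tau -> 0 <= Lam -> 0 <= c -> 0 <= Lu ->
  (forall i, coercive_ham T (H i)) -> (forall i, unif_continuous_ham T (H i)) ->
  (forall i, lipschitz_bound T Lam (H i)) ->
  (forall i, continuous (u i)) -> (forall i, continuous (v i)) ->
  (forall i w, cylinder T w -> `|u i w| <= M) -> (forall i w, cylinder T w -> `|v i w| <= M) ->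
  glued T u -> glued T v ->
  (forall i w w', cyt tau T w -> cyt tau T w' -> `|u i w - u i w'| <= Lu * `|w - w'|) ->
  (forall i, unif_continuous_on (cylinder T) (v i)) ->
  jet_sub T tau B H u -> jet_sub T tau (- B) (dual_ham H) (fun i w => - v i w) ->
  let lam := 2 * Lam + 1 in
  (forall i w, cyt tau T w -> w.2 = tau -> u i w <= v i w + c * gauge lam tau) ->
  forall i w, cyt tau T w -> u i w <= v i w + c * gauge lam w.2.
Proof.
move=> K0 tau0 Lam0 c0 Lu0 Hc Hu Hl cu cv Mu Mv gu gv hL uv su sv lam init i1 w1 cw1.
rewrite leNgt; apply/negP => hlt.
have lam0 : 0 <= lam by rewrite /lam; clear -Lam0; lra.
have E1 w : cyt tau T w -> 1 <= gauge lam w.2.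
  move=> [_ /andP[h _]]; apply: gauge_ge1 => //; exact: le_trans h.
have E0 w : 0 < gauge lam w.2 by exact: gauge_gt0.
have M0 : 0 <= M := le_trans (normr_ge0 _) (Mu i1 w1 (cyt_cylinder tau0 cw1)).
pose S := [set x : R | exists i w, cyt tau T w /\ x = (u i w - v i w) / gauge lam w.2].
have ubS x : S x -> x <= 2 * M.
  move=> [i [w [cw ->]]]; rewrite ler_pdivrMr //.
  have := Mu i w (cyt_cylinder tau0 cw); have := Mv i w (cyt_cylinder tau0 cw).
  rewrite !ler_norml => /andP[a1 _] /andP[_ a2].
  have h1 : 2 * M <= 2 * M * gauge lam w.2 by rewrite ler_peMr ?E1 // mulr_ge0.
  by move: h1 a1 a2; clear; lra.
have hS : has_sup S by split; [exists ((u i1 w1 - v i1 w1) / gauge lam w1.2), i1, w1|exists (2 * M)].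
pose th0 := sup S.
have cth0 : c < th0.
  apply: (@lt_le_trans _ _ ((u i1 w1 - v i1 w1) / gauge lam w1.2)).
    by rewrite ltr_pdivlMr // ltrBrDl.
  by apply: sup_upper_bound => //; exists i1, w1.
have below i w : cyt tau T w -> u i w - v i w <= th0 * gauge lam w.2.
  move=> cw; rewrite -ler_pdivrMr //; apply: sup_upper_bound => //; by exists i, w.
pose th := (c + th0) / 2.
have [thc thth0] : c < th /\ th < th0 by rewrite /th; clear -cth0; split; lra.
have th_ge0 : 0 <= th by exact: le_trans (ltW thc).
have thp0 : 0 < th0 by exact: le_lt_trans cth0.
have th2 : th0 / 2 <= th by rewrite /th; clear -c0; lra.
have [i0 [w0 [cw0 gap]]] : exists i w, cyt tau T w /\ th * gauge lam w.2 < u i w - v i w.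
  have [x [i [w [cw ->]]] hx] := @sup_adherent _ S (th0 - th) (ltac:(by rewrite subr_gt0)) hS.
  exists i, w; split=> //; rewrite -ltr_pdivlMr //.
  by move: hx; rewrite -/th0 opprB addrC subrK.
clearbody th th0.
have /choice[rc hrc] := fun i => Hc i M (2 * Lu + 1).
(* for normal slopes of size Rb coercivity makes the equation of u fail whatever
   the other slopes, which are at most 2 * Lu *)
pose Rb := Lu + 1 + \sum_i `|rc i|.
have Rrc i : rc i <= Rb.
  apply: le_trans (ler_norm _) _; rewrite /Rb (bigD1 i) //=.
  have : 0 <= \sum_(k < K | k != i) `|rc k| by apply: sumr_ge0.
  by clear -Lu0; lra.
have LRb : Lu + 1 <= Rb by rewrite /Rb lerDl sumr_ge0.
clearbody Rb.
have Rb0 : 0 <= Rb by clear -Lu0 LRb; lra.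
pose Mb := 2 * Lu + 2 * Rb + 1 + M.
have om0 : 0 < th0 / 8 by rewrite divr_gt0.
have [rho rho0 hrho] : exists2 rho : R, 0 < rho & forall i (s : R), 0 < s -> s < rho ->
    forall q q', ham_domain T Mb q -> ham_domain T Mb q' -> `|q - q'| < s ->
     `|uncurry_ham (H i) q - uncurry_ham (H i) q'| < th0 / 8.
  apply: common_radius => i; have [r r0 hr] := Hu i Mb _ om0.
  by exists r => // s _ sr q q' h1 h2 h3; apply: hr => //; exact: lt_trans sr.
have rho2 : rho / 2 < rho by clear -rho0; lra.
have rho20 : 0 < rho / 2 by rewrite divr_gt0.
pose om := (th - c) / 3.
have omp : 0 < om by rewrite divr_gt0 // subr_gt0.
have [rv rv0 hrv] : exists2 rv : R, 0 < rv & forall i (s : R), 0 < s -> s < rv ->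
    forall w w', cylinder T w -> cylinder T w' -> `|w - w'| < s -> `|v i w - v i w'| < om.
  apply: common_radius => i; have [r r0 hr] := uv i _ omp.
  by exists r => // s _ sr q q' h1 h2 h3; apply: hr => //; exact: lt_trans sr.
have L1 : 0 < Lam * (Lu + 1) + 1 by rewrite ltr_wpDl // mulr_ge0 // addr_ge0.
have Lu1 : 0 < Lu + 1 by rewrite ltr_wpDl.
have all0 : all (fun x => 0 < x)
    [:: rho / 2; rv / 2; th0 / 8 / (Lam * (Lu + 1) + 1); om / (Lu + 1)].
  by apply/and5P; split=> //; apply: divr_gt0.
have [eta eta0] := pick_small all0.
move=> /and5P[eta1 eta2 eta3 eta4 _].
rewrite ltr_pdivlMr // in eta3; rewrite ltr_pdivlMr // in eta4.
(* the doubled points are then closer than eta, which depends on the moduli of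
   continuity of H and v *)
pose eps := eta / (2 * (Lu + 1)).
have eps0 : 0 < eps by rewrite divr_gt0 // mulr_gt0.
have epsL : 2 * eps * Lu < eta.
  have : eps * (2 * (Lu + 1)) = eta by rewrite /eps divfK // gt_eqF // mulr_gt0.
  by move: eps0; clear; lra.
pose gp := u i0 w0 - v i0 w0 - th * gauge lam w0.2.
have gp0 : 0 < gp by rewrite subr_gt0.
have q0 : 0 < sqn (spart w0) + 1 by rewrite ltr_wpDl // sqn_ge0.
pose m := Num.min (rho / 2) 1.
have m0 : 0 < m by rewrite lt_min rho20 ltr01.
have [m1 m2] : m <= rho / 2 /\ m <= 1 by rewrite !ge_min !lexx orbT.
clearbody m.
have M8 : 0 < 8 * M + 8 by clear -M0; lra.
have all1 : all (fun x => 0 < x) [:: gp / (sqn (spart w0) + 1); m ^+ 2 / (8 * M + 8)].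
  by apply/and3P; split=> //; apply: divr_gt0 => //; exact: exprn_gt0.
(* kap preserves the positivity of the doubled function at w0, and 2 * kap * |z2.1|
   = O(sqrt kap) is a negligible perturbation of the gradient *)
have [kap kap0] := pick_small all1.
move=> /and3P[]; rewrite !ltr_pdivlMr // => kap1 kap2 _.
have [j [z1 [z2 hmax]]] := doubling_max lam i0 kap0 eps0 th_ge0 tau0 cu cv Mu Mv cw0.
have [[cz1 cz2 z12] hm] := hmax.
have ccz1 := cyt_cylinder tau0 cz1; have ccz2 := cyt_cylinder tau0 cz2.
have pos : 0 < doubled lam th kap eps (u j) (v j) z1 z2.
  apply: lt_le_trans (hm i0 w0 w0 (And3 cw0 cw0 erefl)).
  rewrite /doubled subrr sqn0 mul0r subr0 /penalty.
  have : kap * sqn (spart w0) < gp.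
    by apply: le_lt_trans kap1; rewrite ler_wpM2l ?(ltW kap0) // lerDl.
  by rewrite /gp; clear; lra.
have [z12e ale] := doubled_gap_bound eps0 Lu0 hmax (hL j).
have z12eta := le_lt_trans z12e epsL.
have hq : 0 <= sqn (z1 - z2) / (2 * eps) by rewrite divr_ge0 ?sqn_ge0 // mulr_ge0 // ltW.
have hk0 : 0 <= kap * sqn (spart z2) by rewrite mulr_ge0 ?sqn_ge0 // ltW.
have E2 := E1 _ cz2.
have uvpos : th * gauge lam z2.2 < u j z1 - v j z2.
  by move: pos; rewrite /doubled /penalty; move: hq hk0; clear; lra.
have thE0 : 0 <= th * gauge lam z2.2 by rewrite mulr_ge0 // ltW.
have Luz : u j z1 - u j z2 <= Lu * `|z1 - z2|.
  by apply: le_trans (ler_norm _) _; exact: hL.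
have Lueta : Lu * `|z1 - z2| <= om.
  apply: (@le_trans _ _ (eta * (Lu + 1))); last exact: ltW.
  by rewrite mulrC; apply: ler_pM => //; [exact: ltW|rewrite lerDl].
have om3 : om = (th - c) / 3 by [].
have Et : 1 <= gauge lam tau by exact: gauge_ge1.
have thcE : th - c <= (th - c) * gauge lam tau by rewrite ler_peMr // subr_ge0 ltW.
have tauz2 : tau <= z2.2 by case: cz2 => _ /andP[].
have thEle : th * gauge lam tau <= th * gauge lam z2.2 by rewrite ler_wpM2l // gauge_le.
have t2 : tau < z2.2.
  rewrite lt_neqAle tauz2 andbT; apply/negP => /eqP zt.
  have := init j z2 cz2 (esym zt); rewrite -zt in uvpos.
  by move: uvpos Luz Lueta om3 thcE omp; clear; lra.
have t1 : tau < z1.2.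
  rewrite lt_neqAle; case: (cz1) => _ /andP[-> _]; rewrite andbT; apply/negP => /eqP zt.
  have h1 := init j z1 cz1 (esym zt).
  have rv20 : 0 < rv / 2 by rewrite divr_gt0.
  have rv2 : rv / 2 < rv by move: rv0; clear; lra.
  have := hrv j (rv / 2) rv20 rv2 z1 z2 ccz1 ccz2 (lt_trans z12eta eta2).
  rewrite ltr_norml => /andP[_ h2].
  by move: uvpos h1 h2 om3 thcE omp thEle; clear; lra.
pose del := Num.min (th0 / 4) 1.
have [del0 del1 del2] : [/\ 0 < del, del <= th0 / 4 & del <= 1].
  by rewrite lt_min ltr01 divr_gt0 // !ge_min !lexx orbT.
clearbody del.
have kz : 2 * kap * `|z2.1| < m.
  have h1 : kap * sqn (spart z2) <= 2 * M.
    have := Mu j z1 ccz1; have := Mv j z2 ccz2; rewrite !ler_norml => /andP[b1 _] /andP[_ b2].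
    by move: pos; rewrite /doubled /penalty; move: hq thE0 b1 b2; clear; lra.
  have h2 : (2 * kap * `|z2.1|) ^+ 2 < m ^+ 2.
    apply: le_lt_trans kap2; have -> : (2 * kap * `|z2.1|) ^+ 2 = 4 * kap * (kap * `|z2.1| ^+ 2) by ring.
    have h3 : kap * `|z2.1| ^+ 2 <= 2 * M.
      apply: le_trans h1; rewrite ler_wpM2l ?(ltW kap0) //.
      apply: le_trans (sqr_norm_le_sqn (spart z2)).
      by rewrite ler_sqr ?nnegrE //; exact: (norm1_le (spart z2)).
    apply: (@le_trans _ _ (4 * kap * (2 * M))).
      by rewrite ler_wpM2l // mulr_ge0 // ltW.
    by move: kap0; clear; lra.
  by rewrite -ltr_sqr ?nnegrE ?(ltW m0) // !mulr_ge0 // ltW.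
apply: (doubled_contradiction eps0 (ltW kap0) th_ge0 tau0 Lu0 LRb del0 Hu cu cv gu gv hL su sv hmax t1 t2).
move=> i ui vi Fu Fv.
have coer s : `|s| = Rb -> del <= Fu s.
  move=> sR; rewrite /Fu /slope_ham !addr0.
  have h1 : 2 * Lu + 1 <= H i ((eps^-1 *: (z1 - z2)) + ed s).1 (u i z1) z1.1 z1.2.
    apply: hrc; [by case: (z1) ccz1|exact: Mu|].
    apply: le_trans (Rrc i) _; rewrite -sR.
    have e : ((eps^-1 *: (z1 - z2)) + ed s).1.2 = s.
      by rewrite /= z12 subrr scaler0 add0r.
    by rewrite -{1}e; exact: sp_norm2_le.
  have := le_trans (norm2_le _) ale; rewrite ler_norml => /andP[h2 _].
  by move: h1 h2 del2; clear; move: (H i _ _ _ _) => A; move: (_.2) => b; lra.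
split; [|by apply: coer; rewrite ger0_norm|by apply: coer; rewrite normrN ger0_norm].
move=> r rR.
apply: (ham_gap (Lam := Lam) (om := th0 / 8) (rho := rho / 2) (Mb := Mb)) => //.
- exact: ccz1.
- exact: ccz2.
- exact: (hrho i _ rho20 rho2).
- by rewrite /Mb; move: rR ale M0; clear; lra.
- by apply: le_trans (Mv i z2 ccz2) _; rewrite /Mb; move: Lu0 Rb0; clear; lra.
- exact: ltW.
- exact: lt_le_trans m1.
- exact/ltW/(lt_le_trans kz).
- exact: lt_trans eta1.
- rewrite ui vi ger0_norm; last by move: uvpos thE0; clear; lra.
  have h1 : u j z1 - v j z2 <= th0 * gauge lam z2.2 + Lu * `|z1 - z2|.
    by have := below j z2 cz2; move: Luz; clear; lra.
  have h2 : Lam * (u j z1 - v j z2 + `|z1 - z2|) <=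
      Lam * th0 * gauge lam z2.2 + Lam * (Lu + 1) * `|z1 - z2|.
    apply: (@le_trans _ _ (Lam * (th0 * gauge lam z2.2 + Lu * `|z1 - z2| + `|z1 - z2|))).
      by rewrite ler_wpM2l // lerD2r.
    by rewrite le_eqVlt; apply/orP; left; apply/eqP; ring.
  have h3 : Lam * (Lu + 1) * `|z1 - z2| <= th0 / 8.
    apply: le_trans (ltW eta3); rewrite mulrC; apply: ler_pM => //.
    + by rewrite mulr_ge0 // addr_ge0.
    + exact: ltW.
    + by rewrite lerDl.
  have h4 : th0 / 2 * (lam * gauge lam z2.2) <= th * (lam * gauge lam z2.2).
    by rewrite ler_wpM2r // mulr_ge0 // ltW.
  have h5 : th0 / 2 * (lam * gauge lam z2.2) = Lam * th0 * gauge lam z2.2 + th0 / 2 * gauge lam z2.2.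
    by rewrite /lam; field.
  have h6 : th0 / 2 <= th0 / 2 * gauge lam z2.2.
    by rewrite ler_peMr // divr_ge0 // ltW.
  move: h2 h3 h4 h5 h6 del1; clear.
  by clearbody lam; lra.
Qed.

End ComparisonLip.

(** * Lipschitz bounds from coercivity *)

Section CoerciveLipschitz.
Context {R : realType} {d : nat}.
Implicit Types (g w y z : stpoint R d) (W : stpoint R d -> R).

(** Concavity of the square root. *)
Lemma sqrt_tangent (s s0 : R) : 0 <= s -> 0 < s0 ->
  Num.sqrt s <= Num.sqrt s0 + (s - s0) / (2 * Num.sqrt s0).
Proof.
move=> s_ge0 s00; have q0 : 0 < Num.sqrt s0 by rewrite sqrtr_gt0.
have h1 := sqr_sqrtr s_ge0; have h2 := sqr_sqrtr (ltW s00).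
have h3 : 0 <= (Num.sqrt s - Num.sqrt s0) ^+ 2 := sqr_ge0 _.
rewrite -lerBlDl ler_pdivlMr ?mulr_gt0 //.
have -> : (Num.sqrt s - Num.sqrt s0) * (2 * Num.sqrt s0) =
  Num.sqrt s ^+ 2 - Num.sqrt s0 ^+ 2 - (Num.sqrt s - Num.sqrt s0) ^+ 2 by ring.
by rewrite h1 h2 gerBl.
Qed.

Record time_lip_sub T tau Kt M (h : spoint R d -> R -> spoint R d -> R -> R) W : Prop := TimeLipSub {
  tls_bound : forall w, cylinder T w -> `|W w| <= M;
  tls_uc : unif_continuous_on (cylinder T) W;
  tls_time : forall x (s t : R), cylinder T (x, s) -> cylinder T (x, t) ->
    `|W (x, s) - W (x, t)| <= Kt * `|s - t|;
  tls_sub : forall z g, z.1.2 < 0 -> tau < z.2 <= T -> jet T W z g ->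
    g.2 + h g.1 (W z) z.1 z.2 <= 0 }.

Lemma sqrt_sqn_le w : Num.sqrt (sqn w) <= dimn R d * `|w|.
Proof.
have D1 := dimn_ge1 (R := R) (d := d).
rewrite -[leRHS]ger0_norm; last by rewrite mulr_ge0 // ltW // dimn_gt0.
rewrite -sqrtr_sqr ler_sqrt ?sqr_ge0 //; apply: le_trans (sqn_le _) _.
rewrite exprMn ler_wpM2r ?sqr_ge0 // expr2 ler_peMr //; exact: le_trans D1.
Qed.

(** The right-hand side exceeds the oscillation 2 * M of W at distance rho from y, so if
    the inequality fails, W minus the right-hand side has a maximum point z other than
    y. There W has a jet with time slope - Kt and a spatial gradient so large that the
    Hamiltonian exceeds Kt, which is absurd. *)
Lemma local_cone T tau Kt M h W (r Rl rho : R) y : 0 <= tau -> 0 <= Kt -> 0 <= M ->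
  time_lip_sub T tau Kt M h W ->
  (forall p c x t, cylinder T (x, t) -> `|c| <= M -> r <= `|p| -> Kt + 1 <= h p c x t) ->
  Rl = dimn R d * (`|r| + 1) -> 0 < rho -> tau < y.2 <= T -> y.1.2 < - rho ->
  forall w, w.2 = y.2 -> `|w - y| <= rho ->
   W w - W y <= Rl * Num.sqrt (sqn (w - y)) + (2 * M + 1) / rho ^+ 2 * sqn (w - y).
Proof.
move=> tau0 Kt0 M0 [hM uc ht hs] hc RlE rho0 /andP[ty yT] yx.
(* k * rho ^+ 2 exceeds the oscillation of W *)
set k := (2 * M + 1) / rho ^+ 2.
have r20 : 0 < rho ^+ 2 by rewrite exprn_gt0.
have kr : k * rho ^+ 2 = 2 * M + 1 by rewrite /k divfK // gt_eqF.
have k0 : 0 < k by rewrite divr_gt0 // ltr_wpDl // mulr_ge0.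
clearbody k.
have T0 : 0 <= T by clear -tau0 ty yT; lra.
have D0 := dimn_gt0 (R := R) (d := d).
have Rl0 : 0 < Rl by rewrite RlE mulr_gt0 // ltr_wpDl.
pose F w := (W \o clamp T) w - (Rl * Num.sqrt (sqn (w - y)) + k * sqn (w - y)).
have cy : continuous (fun w => sqn (w - y)).
  move=> w; apply: (@continuous_comp _ _ _ (fun w => w - y) (@sqn R d)).
    by apply: cvgB; [exact: cvg_id|exact: cvg_cst].
  exact: continuous_sqn.
have cF : continuous F.
  move=> w; apply: cvgB; first exact: continuous_clamp.
  apply: cvgD; apply: cvgMr; last exact: cy.
  by apply: (@continuous_comp _ _ _ (fun w => sqn (w - y)) Num.sqrt); [exact: cy|exact: sqrt_continuous].
pose D := [set w : stpoint R d | w.1.2 <= 0 /\ y.2 <= w.2 <= y.2] `&` [set w | `|w - y| - rho <= 0].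
have cD : closed D.
  apply: closedI; first exact: closed_cyl.
  apply: closed_le0 => w; apply: cvgB; last exact: cvg_cst.
  by apply: cvg_norm; apply: cvgB; [exact: cvg_id|exact: cvg_cst].
have DP w : w.2 = y.2 -> `|w - y| <= rho -> [/\ D w, cylinder T w & w.1.2 < 0].
  move=> wt wr; have wx : w.1.2 < 0.
    have := le_trans (norm12_le (w - y)) wr; rewrite ler_norml => /andP[_].
    by rewrite -[(w - y).1.2]/(w.1.2 - y.1.2); move: yx; clear; lra.
  split=> //; first by split; [split; [exact: ltW|rewrite wt lexx]|rewrite /= subr_le0].
  by split; [exact: ltW|rewrite wt yT andbT; move: tau0 ty; clear; lra].
have yy : `|y - y| <= rho by rewrite subrr normr0 ltW.
have [Dy cyy _] := DP y erefl yy.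
have [|z [[zx zt] zr] hz] := EVT_closed (w0 := y) (r := `|y| + rho) (@proper_st R d) cF cD Dy.
  move=> w [_ /= hw]; rewrite -{1}(subrK y w) => hh.
  have := lt_le_trans hh (ler_normD _ _); move: hw; clear; lra.
have {}zr : `|z - y| <= rho by rewrite -subr_le0.
have {}zt : z.2 = y.2 by apply/eqP; rewrite eq_le andbC.
have [Dz cz zx0] := DP z zt zr.
have FE w : cylinder T w -> F w = W w - (Rl * Num.sqrt (sqn (w - y)) + k * sqn (w - y)).
  by move=> cw; rewrite /F /= clamp_id.
have Fy : F y = W y by rewrite FE // subrr sqn0 sqrtr0 !mulr0 addr0 subr0.
have [zy|zy] := eqVneq z y.
  move=> w wt wr; have [Dw cw _] := DP w wt wr.
  by have := hz w Dw; rewrite zy Fy FE //; clear; lra.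
exfalso.
have n0 : 0 < `|z - y| by rewrite normr_gt0 subr_eq0.
have S0 : 0 < sqn (z - y).
  by apply: lt_le_trans (sqr_norm_le_sqn _); rewrite exprn_gt0.
have q0 : 0 < Num.sqrt (sqn (z - y)) by rewrite sqrtr_gt0.
have zlt : `|z - y| < rho.
  rewrite lt_neqAle zr andbT; apply/negP => /eqP zE.
  have := hz y Dy; rewrite Fy FE // => h1.
  have h2 : k * rho ^+ 2 <= k * sqn (z - y).
    by rewrite ler_wpM2l ?(ltW k0) // -zE sqr_norm_le_sqn.
  have h3 : 0 <= Rl * Num.sqrt (sqn (z - y)) by rewrite mulr_ge0 ?sqrtr_ge0 // ltW.
  have := hM z cz; have := hM y cyy; rewrite !ler_norml => /andP[h4 _] /andP[_ h5].
  by move: h1 h2 h3 h4 h5; rewrite kr; clear; lra.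
pose c := Rl / (2 * Num.sqrt (sqn (z - y))) + k.
have c0 : 0 < c by rewrite addr_gt0 // divr_gt0 // mulr_gt0.
pose g : stpoint R d := (2 * c) *: (z - y) + (0, - Kt).
have jg : jet T W z g.
  apply: qjet_one_sided; exists c, (rho - `|z - y|); first by rewrite subr_gt0.
  move=> w cw wz wr.
  pose w' : stpoint R d := (w.1, y.2).
  have w'z : w' - z = spart (w - z).
    by rewrite /w' /spart; congr (_, _); rewrite /= zt subrr.
  have w'r : `|w' - y| <= rho.
    have -> : w' - y = (w' - z) + (z - y) by rewrite addrA subrK.
    apply: le_trans (ler_normD _ _) _; rewrite w'z.
    have : `|spart (w - z)| <= `|w - z|.
      by rewrite -[leLHS]/(Num.max `|(w - z).1| `|(0 : R)|) normr0 ge_max norm1_le normr_ge0.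
    by move: wr; clear; lra.
  have [Dw' cw' _] := DP w' erefl w'r.
  have h1 : W w <= W w' + Kt * (z.2 - w.2).
    have ww : w = (w.1, w.2) by case: (w).
    have := ht w.1 w.2 y.2; rewrite -ww => /(_ cw cw').
    have wy : w.2 - y.2 <= 0 by rewrite subr_le0 -zt.
    rewrite (ler0_norm wy) opprB ler_norml => /andP[_ hh].
    by move: hh; rewrite /w' zt; clear; lra.
  have := hz w' Dw'; rewrite !FE // => h2.
  have h3 : Rl * Num.sqrt (sqn (w' - y)) <= Rl * (Num.sqrt (sqn (z - y)) +
      (sqn (w' - y) - sqn (z - y)) / (2 * Num.sqrt (sqn (z - y)))).
    by rewrite ler_wpM2l ?(ltW Rl0) // sqrt_tangent // sqn_ge0.
  have h4 : sqn (w' - y) - sqn (z - y) = ip (2 *: (z - y)) (w - z) + sqn (spart (w - z)).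
    have -> : w' - y = (z - y) + spart (w - z) by rewrite -w'z [RHS]addrC subrKA.
    rewrite sqnD ipZl.
    have -> : ip (z - y) (spart (w - z)) = ip (z - y) (w - z).
      by rewrite /ip /= zt subrr !mul0r.
    by clear; lra.
  have h5 : ip g (w - z) = c * ip (2 *: (z - y)) (w - z) + Kt * (z.2 - w.2).
    by rewrite /g ipDl !ipZl ip_time /=; ring.
  have h6 : c * sqn (spart (w - z)) <= c * sqn (w - z).
    by rewrite ler_wpM2l ?(ltW c0) // [leRHS]sqn_spart lerDl sqr_ge0.
  have h7 : c * (sqn (w' - y) - sqn (z - y)) =
    Rl * ((sqn (w' - y) - sqn (z - y)) / (2 * Num.sqrt (sqn (z - y)))) +
    (k * sqn (w' - y) - k * sqn (z - y)) by rewrite /c; field; rewrite gt_eqF.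
  have h8 : c * (sqn (w' - y) - sqn (z - y)) =
    c * ip (2 *: (z - y)) (w - z) + c * sqn (spart (w - z)) by rewrite h4 mulrDr.
  rewrite mulrDr in h3; rewrite h5; move: h1 h2 h3 h6 h7 h8; clear.
  by move: (c * (_ - _)) (Rl * (_ / _)) => *; lra.
have tz : tau < z.2 <= T by rewrite zt ty yT.
have := hs z g zx0 tz jg.
have : Kt + 1 <= h g.1 (W z) z.1 z.2.
  apply: hc; [by case: (z) cz|exact: hM|].
  have gE : g.1 = ((2 * c) *: (z - y)).1 by rewrite /g /= addr0.
  have zyn : `|z - y| = `|(z - y).1|.
    by rewrite -[LHS]/(Num.max `|(z - y).1| `|z.2 - y.2|) zt subrr normr0 max_l.
  have -> : `|g.1| = 2 * c * `|z - y|.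
    by rewrite gE zyn normrZ gtr0_norm // mulr_gt0.
  apply: (@le_trans _ _ (`|r| + 1)); first by have := ler_norm r; clear; lra.
  have h1 : Rl / Num.sqrt (sqn (z - y)) <= 2 * c.
    rewrite /c mulrDr; have -> : 2 * (Rl / (2 * Num.sqrt (sqn (z - y)))) = Rl / Num.sqrt (sqn (z - y)).
      by field; rewrite gt_eqF.
    by rewrite lerDl mulr_ge0 // ltW.
  apply: (@le_trans _ _ (Rl / Num.sqrt (sqn (z - y)) * `|z - y|)); last by rewrite ler_wpM2r.
  rewrite mulrAC ler_pdivlMr // RlE; have := sqrt_sqn_le (z - y).
  move=> h2; have : (`|r| + 1) * Num.sqrt (sqn (z - y)) <= (`|r| + 1) * (dimn R d * `|z - y|).
    by rewrite ler_wpM2l // addr_ge0.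
  by move=> /le_trans; apply; rewrite le_eqVlt; apply/orP; left; apply/eqP; ring.
have -> : g.2 = - Kt by rewrite /g /= zt subrr scaler0 add0r.
by clear; move: (h _ _ _ _) => A; lra.
Qed.

(** Divide the segment from w' to w into n parts and apply local_cone to each: the
    quadratic terms sum up to O(1/n). *)
Lemma open_lipschitz T tau Kt M h W (r Rl : R) : 0 <= tau -> 0 <= Kt -> 0 <= M ->
  time_lip_sub T tau Kt M h W ->
  (forall p c x t, cylinder T (x, t) -> `|c| <= M -> r <= `|p| -> Kt + 1 <= h p c x t) ->
  Rl = dimn R d * (`|r| + 1) ->
  forall w w', w.2 = w'.2 -> tau < w'.2 <= T -> w.1.2 < 0 -> w'.1.2 < 0 ->
  W w - W w' <= Rl * Num.sqrt (sqn (w - w')).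
Proof.
move=> tau0 Kt0 M0 tls hc RlE w w' ww' tw' wx w'x.
have [c0 [c00 c01 c02]] : exists c0 : R, [/\ 0 < c0, w.1.2 <= - c0 & w'.1.2 <= - c0].
  exists (Num.min (- w.1.2) (- w'.1.2)); split; first by rewrite lt_min !oppr_gt0 wx w'x.
    by rewrite lerNr ge_min lexx.
  by rewrite lerNr ge_min lexx orbT.
have [rho rho0 rhoc] : exists2 rho : R, 0 < rho & rho < c0.
  by exists (c0 / 2); [exact: divr_gt0|move: c00; clear; lra].
set S := Num.sqrt (sqn (w - w')).
set k := (2 * M + 1) / rho ^+ 2.
have k0 : 0 <= k by rewrite divr_ge0 ?sqr_ge0 // addr_ge0 // mulr_ge0.
rewrite leNgt; apply/negP => hlt.
set gap := W w - W w' - Rl * S.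
have gap0 : 0 < gap by rewrite subr_gt0.
have [n n1 n2] : exists2 n : nat, `|w - w'| / rho <= n.+1%:R & k * S ^+ 2 / gap < n.+1%:R.
  pose A := `|w - w'| / rho + k * S ^+ 2 / gap.
  have A1 : 0 <= `|w - w'| / rho by rewrite divr_ge0 // ltW.
  have A2 : 0 <= k * S ^+ 2 / gap by rewrite divr_ge0 ?(ltW gap0) // mulr_ge0 // sqr_ge0.
  have hb := archi_boundP (addr_ge0 A1 A2).
  have hn : (Num.bound A)%:R <= ((Num.bound A).+1)%:R :> R by rewrite ler_nat.
  by exists (Num.bound A); move: hb hn A1 A2; rewrite -/A /A; clear; lra.
have n0 : 0 < n.+1%:R :> R by rewrite ltr0n.
pose p (i : nat) : stpoint R d := w' + (i%:R / n.+1%:R) *: (w - w').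
have pt i : (p i).2 = w'.2.
  by rewrite /p /= ww' subrr -[_ *: (0 : R)]/(i%:R / n.+1%:R * 0) mulr0 addr0.
have px i : (i <= n.+1)%N -> (p i).1.2 < - rho.
  move=> iN; have t0 : 0 <= i%:R / n.+1%:R :> R by rewrite divr_ge0 ?ler0n.
  have t1 : i%:R / n.+1%:R <= 1 :> R by rewrite ler_pdivrMr // mul1r ler_nat.
  rewrite /p /= -[_ *: (_ - _ : R)]/(i%:R / n.+1%:R * (w.1.2 - w'.1.2)).
  move: t0 t1; move: (_ / _) => t t0 t1.
  have h1 : t * w.1.2 <= t * - c0 by rewrite ler_wpM2l.
  have h2 : (1 - t) * w'.1.2 <= (1 - t) * - c0 by rewrite ler_wpM2l // subr_ge0.
  by move: h1 h2 rhoc; clear; nra.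
have step i : (i <= n)%N -> W (p i.+1) - W (p i) <= (Rl * S + k * S ^+ 2 / n.+1%:R) / n.+1%:R.
  move=> iN; have dp : p i.+1 - p i = n.+1%:R^-1 *: (w - w').
    rewrite /p opprD addrACA subrr add0r -scalerBl; congr (_ *: _).
    by rewrite -mulrBl -natrB // subSnn mul1r.
  have := local_cone tau0 Kt0 M0 tls hc RlE rho0 (y := p i) _ (px i (leqW iN)) (w := p i.+1).
  rewrite !pt dp sqnZ => /(_ tw' erefl)/(_ _)/wrap[].
    by rewrite normrZ ger0_norm ?invr_ge0 // mulrC ler_pdivrMr // mulrC -ler_pdivrMr.
  rewrite -/k sqrtrM ?sqr_ge0 // sqrtr_sqr ger0_norm ?invr_ge0 // -/S.
  have SS : sqn (w - w') = S ^+ 2 by rewrite sqr_sqrtr // sqn_ge0.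
  move=> /le_trans; apply; rewrite SS le_eqVlt; apply/orP; left; apply/eqP.
  by field; rewrite gt_eqF.
have tot i : (i <= n.+1)%N ->
    W (p i) - W w' <= i%:R * ((Rl * S + k * S ^+ 2 / n.+1%:R) / n.+1%:R).
  move: (_ / n.+1%:R) step => X step.
  elim: i => [_|i IH iN]; first by rewrite /p !mul0r scale0r addr0 subrr.
  have h1 := IH (ltnW iN); have h2 := step i iN.
  by rewrite -natr1 mulrDl mul1r; move: h1 h2; clear; lra.
have pn : p n.+1 = w by rewrite /p divff ?gt_eqF // scale1r addrC subrK.
have := tot n.+1 (leqnn _); rewrite pn mulrCA divff ?gt_eqF // mulr1 => h1.
move: n2; rewrite ltr_pdivrMr // => n2.
have : k * S ^+ 2 / n.+1%:R < gap by rewrite ltr_pdivrMr // [gap * _]mulrC.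
move: h1; rewrite /gap; clear; move: (_ / n.+1%:R) (Rl * S) => X Y; lra.
Qed.

(** The constant only depends on the bounds M and Kt, which makes it common to whole
    families of subsolutions. Points of the junction are limits of interior points. *)
Lemma coercive_lipschitz T tau Kt M h : 0 <= tau -> 0 <= Kt -> 0 <= M ->
  coercive_ham T h -> exists2 Rl : R, 0 <= Rl & forall W, time_lip_sub T tau Kt M h W ->
  forall w w', w.2 = w'.2 -> tau < w'.2 <= T -> w.1.2 <= 0 -> w'.1.2 <= 0 ->
  `|W w - W w'| <= Rl * `|w - w'|.
Proof.
move=> tau0 Kt0 M0 hc; have [r hr] := hc M (Kt + 1).
pose Rl := dimn R d * (`|r| + 1).
have D0 := dimn_gt0 (R := R) (d := d).
have Rl0 : 0 <= Rl by rewrite mulr_ge0 ?(ltW D0) // addr_ge0.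
exists (Rl * dimn R d); first by rewrite mulr_ge0 // ltW.
move=> W tls.
have one w w' : w.2 = w'.2 -> tau < w'.2 <= T -> w.1.2 <= 0 -> w'.1.2 <= 0 ->
    W w - W w' <= Rl * dimn R d * `|w - w'|.
  move=> ww' tw' wx w'x; apply/ler_addgt0Pr => e e0.
  have e2 : 0 < e / 2 by rewrite divr_gt0.
  have [rr rr0 hrr] := tls_uc tls e2.
  pose s := - (rr / 2); have s0 : s < 0 by rewrite oppr_lt0 divr_gt0.
  have sr : `|ed s : stpoint R d| < rr.
    apply: le_lt_trans (norm_ed_le s) _; rewrite normrN ger0_norm ?divr_ge0 ?(ltW rr0) //.
    by move: rr0; clear; lra.
  have cyl v : v.2 = w'.2 -> v.1.2 <= 0 -> cylinder T v.
    move=> vt vx; split=> //; rewrite vt; case/andP: tw' => h1 ->; rewrite andbT.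
    by move: tau0 h1; clear; lra.
  have shift v : v.2 = w'.2 -> v.1.2 <= 0 ->
      [/\ (v + ed s).2 = w'.2, (v + ed s).1.2 < 0 & `|W (v + ed s) - W v| < e / 2].
    move=> vt vx; have h1 : (v + ed s).2 = w'.2 by rewrite /= addr0.
    have h2 : (v + ed s).1.2 < 0 by rewrite /=; move: vx s0; clear; lra.
    split=> //; apply: hrr; [exact: cyl _ (ltW h2)|exact: cyl|].
    by rewrite addrAC subrr add0r.
  have [a1 a2 a3] := shift w ww' wx; have [b1 b2 b3] := shift w' erefl w'x.
  have h1 : W (w + ed s) - W (w' + ed s) <= Rl * Num.sqrt (sqn (w - w')).
    have -> : w - w' = (w + ed s) - (w' + ed s) by rewrite opprD addrACA subrr addr0.
    apply: (open_lipschitz tau0 Kt0 M0 tls hr) => //; first by rewrite a1 b1.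
    by rewrite b1.
  have h2 : Rl * Num.sqrt (sqn (w - w')) <= Rl * dimn R d * `|w - w'|.
    by rewrite -mulrA ler_wpM2l // sqrt_sqn_le.
  move: a3 b3; rewrite !ltr_norml => /andP[a3 _] /andP[_ b3].
  by move: h1 h2 a3 b3; clear; lra.
move=> w w' ww' tw' wx w'x; rewrite ler_norml; apply/andP; split; last exact: one.
have := one w' w (esym ww'); rewrite ww' -normrN opprB => /(_ tw' w'x wx).
by clear; lra.
Qed.

End CoerciveLipschitz.

(** * Regularization in time *)

Section TimeRegularization.
Context {R : realType} {d K : nat}.
Implicit Types (g w y z : stpoint R d) (f : stpoint R d -> R).

(** Sup-convolution in time. The weight gauge compensates for the dependence of the
    Hamiltonian on u and on t. *)
Definition treg (A lam T : R) f w : R :=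
  sup [set x : R | exists2 s : R, 0 <= s <= T & x = f (w.1, s) - A * `|w.2 - s| * gauge lam w.2].

(** The supremum is attained, since f is continuous in time. *)
Lemma tregP (A lam T : R) f w : 0 <= T -> unif_continuous_on (cylinder T) f -> w.1.2 <= 0 ->
  (exists2 s : R, 0 <= s <= T & treg A lam T f w = f (w.1, s) - A * `|w.2 - s| * gauge lam w.2) /\
  (forall s, 0 <= s <= T -> f (w.1, s) - A * `|w.2 - s| * gauge lam w.2 <= treg A lam T f w).
Proof.
move=> T0 uf wx.
pose F (s : R) := (f \o clamp T) (w.1, s) - A * `|w.2 - s| * gauge lam w.2.
have cs : continuous (fun s : R => (f \o clamp T) (w.1, s)).
  apply: continuous_of_eps => s e e0; have [r r0 hr] := uf e e0.
  exists r => // s' ss; apply: hr; [exact: clamp_cylinder|exact: clamp_cylinder|].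
  apply: le_lt_trans (clamp_lip _ _ _) _; apply: le_lt_trans ss.
  rewrite -[leLHS]/(Num.max `|w.1 - w.1| `|s' - s|) subrr normr0.
  by rewrite ge_max lexx normr_ge0.
have cF : continuous F.
  move=> s; apply: cvgB; first exact: cs.
  have cn : continuous (fun s : R => A * `|w.2 - s|).
    move=> s'; apply: cvgM; [exact: cvg_cst|apply: cvg_norm].
    by apply: cvgB; [exact: cvg_cst|exact: cvg_id].
  by apply: cvgMl; exact: cn.
have FE s : 0 <= s <= T -> F s = f (w.1, s) - A * `|w.2 - s| * gauge lam w.2.
  by move=> hs; rewrite /F /= clamp_id.
pose D := [set s : R | - s <= 0] `&` [set s : R | s - T <= 0].
have DE s : D s <-> 0 <= s <= T.
  by rewrite /D /= oppr_le0 subr_le0; split=> [[-> ->]|/andP[]].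
have cD : closed D.
  apply: closedI; apply: closed_le0 => s; first by apply: cvgN; exact: cvg_id.
  by apply: cvgB; [exact: cvg_id|exact: cvg_cst].
have D0 : D 0 by apply/DE; rewrite lexx.
have [|s /DE hs smax] := EVT_closed (w0 := 0) (r := T) (@proper_real R) cF cD D0.
  move=> s /DE /andP[s0 sT]; rewrite ger0_norm // ltNge sT //.
pose S := [set x : R | exists2 s : R, 0 <= s <= T & x = f (w.1, s) - A * `|w.2 - s| * gauge lam w.2].
have ub : ubound S (F s).
  by move=> x [s' hs' ->]; rewrite -FE //; apply: smax; apply/DE.
have Ss : S (F s) by exists s => //; rewrite FE.
have e : treg A lam T f w = F s.
  apply/eqP; rewrite eq_le; apply/andP; split.
    by apply: (@ge_sup R S) => //; exists (F s).
  by apply: (@ub_le_sup R S) => //; exists (F s).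
split; first by exists s => //; rewrite e FE.
by move=> s' hs'; rewrite e -FE //; apply: smax; apply/DE.
Qed.

Lemma gauge_lip (lam T s t : R) : 0 <= lam -> s <= t -> t <= T ->
  gauge lam t - gauge lam s <= lam * gauge lam T * (t - s).
Proof.
move=> l0 st tT.
have e : gauge lam s = gauge lam t * expR (- (lam * (t - s))).
  by rewrite /gauge -expRD; congr expR; ring.
have h1 := expR_ge1Dx (- (lam * (t - s))).
have h2 : gauge lam t * (1 + - (lam * (t - s))) <= gauge lam s.
  by rewrite e ler_wpM2l // ltW // gauge_gt0.
have h3 : gauge lam t * (lam * (t - s)) <= gauge lam T * (lam * (t - s)).
  by rewrite ler_wpM2r ?gauge_le // mulr_ge0 // subr_ge0.
by move: h2 h3; clear; lra.
Qed.

Lemma dist_le_range (a b T : R) : 0 <= a <= T -> 0 <= b <= T -> `|a - b| <= T.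
Proof.
move=> /andP[? ?] /andP[? ?]; rewrite ler_norml; apply/andP; split; lra.
Qed.

Section Properties.
Variables (A lam T M : R) (f : stpoint R d -> R).
Hypotheses (T0 : 0 <= T) (A0 : 0 < A) (lam0 : 0 <= lam)
  (uf : unif_continuous_on (cylinder T) f) (Mf : forall w, cylinder T w -> `|f w| <= M).

Lemma treg_ge w : cylinder T w -> f w <= treg A lam T f w.
Proof.
move=> [wx wt]; have [_ h] := tregP A lam T0 uf wx.
have := h w.2 wt; rewrite subrr normr0 mulr0 mul0r subr0.
by rewrite (_ : (w.1, w.2) = w) //; case: (w).
Qed.

Lemma treg_bound w : cylinder T w -> `|treg A lam T f w| <= M.
Proof.
move=> cw; have [wx wt] := cw.
have := Mf cw; rewrite !ler_norml => /andP[h1 _]; apply/andP; split.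
  exact: le_trans h1 (treg_ge cw).
have [[s hs ->] _] := tregP A lam T0 uf wx.
have := @Mf (w.1, s) (conj wx hs); rewrite ler_norml => /andP[_ h2].
apply: le_trans h2; rewrite gerBl.
by rewrite !mulr_ge0 ?(ltW A0) // ltW // gauge_gt0.
Qed.

Definition treg_time_lip := A * (gauge lam T * (1 + T * lam)).

Lemma treg_time_lip_ge0 : 0 <= treg_time_lip.
Proof.
by rewrite mulr_ge0 ?(ltW A0) // mulr_ge0 ?(ltW (gauge_gt0 _ _)) // addr_ge0 // mulr_ge0.
Qed.

(** The supremum is taken over the same times s for all t, so treg inherits the
    Lipschitz constant of its kernel. *)
Lemma treg_time x (s t : R) : cylinder T (x, s) -> cylinder T (x, t) ->
  `|treg A lam T f (x, s) - treg A lam T f (x, t)| <= treg_time_lip * `|s - t|.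
Proof.
have one a b : cylinder T (x, a) -> cylinder T (x, b) ->
    treg A lam T f (x, a) - treg A lam T f (x, b) <= treg_time_lip * `|a - b|.
  move=> [xx /= ha] [_ /= hb]; have [[s0 hs0 ->] _] := tregP A lam T0 uf (w := (x, a)) xx.
  have [_ /(_ s0 hs0)] := tregP A lam T0 uf (w := (x, b)) xx; rewrite /=.
  have /andP[a0 aT] := ha; have /andP[b0 bT] := hb; have /andP[s00 s0T] := hs0.
  have g0 := gauge_gt0 lam b; have gT : gauge lam b <= gauge lam T by exact: gauge_le.
  have h1 : `|b - s0| * (gauge lam b - gauge lam a) <= T * (lam * gauge lam T * `|a - b|).
    have h2 : gauge lam b - gauge lam a <= lam * gauge lam T * `|a - b|.
      have [ab|ab] := leP a b.
        rewrite ler0_norm ?subr_le0 // opprB; exact: gauge_lip.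
      apply: (@le_trans _ _ 0); first by rewrite subr_le0 gauge_le // ltW.
      by rewrite !mulr_ge0 // ltW // gauge_gt0.
    apply: (@le_trans _ _ (`|b - s0| * (lam * gauge lam T * `|a - b|))).
      by rewrite ler_wpM2l.
    by rewrite ler_wpM2r ?mulr_ge0 ?(ltW (gauge_gt0 _ _)) // dist_le_range.
  have h3 : (`|b - s0| - `|a - s0|) * gauge lam a <= `|a - b| * gauge lam T.
    apply: (@le_trans _ _ (`|a - b| * gauge lam a)).
      rewrite ler_wpM2r ?(ltW (gauge_gt0 _ _)) // lerBlDr.
      have -> : b - s0 = (b - a) + (a - s0) by ring.
      by rewrite (distrC a b) ler_normD.
    by rewrite ler_wpM2l // gauge_le.
  have h4 : A * (`|b - s0| * (gauge lam b - gauge lam a)) <= A * (T * (lam * gauge lam T * `|a - b|)).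
    by rewrite ler_wpM2l // ltW.
  have h5 : A * ((`|b - s0| - `|a - s0|) * gauge lam a) <= A * (`|a - b| * gauge lam T).
    by rewrite ler_wpM2l // ltW.
  have -> : treg_time_lip * `|a - b| =
    A * (T * (lam * gauge lam T * `|a - b|)) + A * (`|a - b| * gauge lam T).
    by rewrite /treg_time_lip; ring.
  have h6 : A * `|b - s0| * gauge lam b - A * `|a - s0| * gauge lam a =
     A * (`|b - s0| * (gauge lam b - gauge lam a)) + A * ((`|b - s0| - `|a - s0|) * gauge lam a).
    by ring.
  move: h4 h5 h6; move: (A * `|b - s0| * _) (A * `|a - s0| * _) => X1 X2.
  move: (A * (T * _)) (A * (`|a - b| * _)) => X3 X4.
  move: (A * (_ * _)) => X5; move: (A * (_ * _)) => X6.
  by move=> *; lra.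
move=> cs ct; rewrite ler_norml; apply/andP; split; last exact: one.
by have := one t s ct cs; rewrite distrC; lra.
Qed.

Lemma treg_uc : unif_continuous_on (cylinder T) (treg A lam T f).
Proof.
move=> e e0; have e2 : 0 < e / 2 by rewrite divr_gt0.
have [r r0 hr] := uf e2.
have k0 : 0 < treg_time_lip + 1 by rewrite ltr_wpDl // treg_time_lip_ge0.
exists (Num.min r (e / 2 / (treg_time_lip + 1))); first by rewrite lt_min r0 divr_gt0.
have one w w' : cylinder T w -> cylinder T w' -> `|w - w'| < Num.min r (e / 2 / (treg_time_lip + 1)) ->
    treg A lam T f w - treg A lam T f w' < e.
  move=> cw cw'; rewrite lt_min ltr_pdivlMr // => /andP[h1 h2].
  case: (w) cw h1 h2 => x t [xx xt] h1 h2; case: (w') cw' h1 h2 => x' t' [xx' xt'] h1 h2.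
  have h3 : treg A lam T f (x, t) - treg A lam T f (x', t) < e / 2.
    have [[s hs ->] _] := tregP A lam T0 uf (w := (x, t)) xx.
    have [_ /(_ s hs) /=] := tregP A lam T0 uf (w := (x', t)) xx'.
    have := hr (x, s) (x', s) (conj xx hs) (conj xx' hs).
    have : `|(x, s) - (x', s) : stpoint R d| < r.
      apply: le_lt_trans h1; rewrite -[leLHS]/(Num.max `|x - x'| `|s - s|) subrr normr0.
      rewrite ge_max normr_ge0 andbT; exact: (norm1_le ((x, t) - (x', t'))).
    move=> h /(_ h); rewrite ltr_norml => /andP[_].
    by move: (f _) (f _) => a b; lra.
  have h4 := treg_time (s := t) (t := t') (conj xx' xt) (conj xx' xt').
  have h5 : treg_time_lip * `|t - t'| < e / 2.
    apply: le_lt_trans h2; apply: (@le_trans _ _ (treg_time_lip * `|(x, t) - (x', t')|)).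
      by rewrite ler_wpM2l ?treg_time_lip_ge0 //; exact: (norm2_le ((x, t) - (x', t'))).
    by rewrite mulrC ler_wpM2l // lerDl.
  move: h4; rewrite ler_norml => /andP[_ h4]; move: h3 h4 h5.
  by move: (treg _ _ _ _ _) (treg _ _ _ _ _) (treg _ _ _ _ _) => *; lra.
move=> w w' cw cw' ww'; rewrite ltr_norml; apply/andP; split; last exact: one.
by have := one w' w cw' cw; rewrite distrC => /(_ ww'); lra.
Qed.

(** Comparing with the choice s = w.2 bounds the lag. *)
Lemma treg_close w : cylinder T w -> exists2 s : R, 0 <= s <= T &
  treg A lam T f w = f (w.1, s) - A * `|w.2 - s| * gauge lam w.2 /\ A * `|w.2 - s| <= 2 * M.
Proof.
move=> cw; have [wx wt] := cw; have [[s hs e] _] := tregP A lam T0 uf wx.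
exists s => //; split=> //.
have h1 := treg_ge cw; have := Mf cw; have := @Mf (w.1, s) (conj wx hs).
rewrite !ler_norml => /andP[_ h2] /andP[h3 _].
have g1 : 1 <= gauge lam w.2 by apply: gauge_ge1 => //; case/andP: wt.
have h4 : A * `|w.2 - s| <= A * `|w.2 - s| * gauge lam w.2.
  by rewrite ler_peMr // mulr_ge0 // ltW.
by rewrite e in h1; move: h1 h2 h3 h4; lra.
Qed.

End Properties.

(** Let w vary together with s, at constant lag w.2 - s: this bounds treg from below by
    f up to the variation of the weight, with equality at z. *)
Lemma treg_jet (A lam T : R) f z g (s0 : R) : 0 <= T -> 0 < A -> 0 <= lam ->
  unif_continuous_on (cylinder T) f -> cylinder T z -> 0 < z.2 -> 0 <= s0 <= T ->
  treg A lam T f z = f (z.1, s0) - A * `|z.2 - s0| * gauge lam z.2 ->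
  jet T (treg A lam T f) z g ->
  jet T f (z.1, s0) (g + (0, A * `|z.2 - s0| * (lam * gauge lam z.2))).
Proof.
move=> T0 A0 lam0 uf cz z0 hs0 e hj e' e'0.
have e2 : 0 < e' / 2 by rewrite divr_gt0.
have [r r0 hr] := hj _ e2.
have [r1 r10 hr1] := gauge_quad lam z.2.
pose B := A * `|z.2 - s0|; have B0 : 0 <= B by rewrite mulr_ge0 // ltW.
pose C := B * (2 * gauge lam z.2 * lam ^+ 2) + 1.
have C0 : 0 < C.
  by rewrite ltr_wpDl // mulr_ge0 // mulr_ge0 ?sqr_ge0 // mulr_ge0 // ltW // gauge_gt0.
pose m := \big[Num.min/1]_(i <- [:: r; r1; z.2; e' / 2 / C]) i.
exists m; first by rewrite /m !big_cons big_nil !lt_min r0 r10 z0 ltr01 divr_gt0.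
move=> y [yx yt] ys; rewrite /m !big_cons big_nil !lt_min => /and5P[y1 y2 y3 y4 _].
(* the point with the same lag as z *)
pose h := s0 - z.2; pose w : stpoint R d := (y.1, y.2 - h).
have wz : w - z = y - (z.1, s0).
  by rewrite /w /h; congr (_, _); rewrite /=; ring.
have wt : w.2 <= z.2 by rewrite /w /h /=; move: ys; rewrite /=; clear; lra.
have yn : `|y.2 - s0| <= `|y - (z.1, s0)| by exact: (norm2_le (y - (z.1, s0))).
have zT : z.2 <= T by case: cz => _ /andP[].
have cw : cylinder T w.
  split=> //=; apply/andP; split; last exact: le_trans zT.
  have := le_lt_trans yn y3; rewrite ltr_norml => /andP[hh _].
  by rewrite /h; move: hh; clear; lra.
have wr : `|w - z| < r by rewrite wz.
have h1 := hr w cw wt wr.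
have [_ /(_ y.2 yt)] := tregP A lam T0 uf (w := w) yx.
have -> : (w.1, y.2) = y by rewrite /w /=; case: (y).
have -> : `|w.2 - y.2| = `|z.2 - s0| by congr (Num.norm _); rewrite /w /h /=; ring.
rewrite -/B => h2.
have wz2 : w.2 - z.2 = y.2 - s0 by rewrite /w /h /=; ring.
have wr1 : `|w.2 - z.2| < r1 by rewrite wz2; exact: le_lt_trans yn _.
have := hr1 _ wr1; rewrite ler_norml => /andP[_ h3].
have h4 : B * (gauge lam w.2 - gauge lam z.2 - lam * gauge lam z.2 * (w.2 - z.2)) <=
    B * (2 * gauge lam z.2 * lam ^+ 2 * (w.2 - z.2) ^+ 2) by rewrite ler_wpM2l.
have h5 : B * (2 * gauge lam z.2 * lam ^+ 2 * (w.2 - z.2) ^+ 2) <=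
    e' / 2 * `|y - (z.1, s0)|.
  have h6 : (w.2 - z.2) ^+ 2 <= `|y - (z.1, s0)| ^+ 2.
    by rewrite wz2 -real_normK ?num_real // ler_sqr ?nnegrE.
  apply: (@le_trans _ _ (C * `|y - (z.1, s0)| ^+ 2)).
    rewrite mulrA; apply: ler_pM => //; rewrite ?sqr_ge0 //.
      by rewrite mulr_ge0 // mulr_ge0 ?sqr_ge0 // mulr_ge0 // ltW // gauge_gt0.
    by rewrite /C lerDl.
  rewrite expr2 mulrA ler_wpM2r // mulrC; move: y4; rewrite ltr_pdivlMr // => /ltW.
  by apply: le_trans.
rewrite ipDl ip_time -wz in h1 *; rewrite -/B; move: h1 h2 h4 h5; rewrite e -/B.
have -> : e' * `|w - z| = e' / 2 * `|w - z| + e' / 2 * `|w - z| by field.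
rewrite wz -[(y - _).2]/(y.2 - s0) -wz2.
have -> : B * (gauge lam w.2 - gauge lam z.2 - lam * gauge lam z.2 * (w.2 - z.2)) =
  B * gauge lam w.2 - B * gauge lam z.2 - B * (lam * gauge lam z.2) * (w.2 - z.2) by ring.
clear; move: (B * (2 * _ * _ * _)) (B * gauge lam w.2) (B * gauge lam z.2) (B * _ * _) (e' / 2 * _) (ip _ _).
by move=> *; lra.
Qed.

(** Passing from the point (z.1, s0) to z changes the time by the lag and the value of u
    by A * lag * gauge, hence the Hamiltonian by at most 2 * Lam * A * lag * gauge. The
    extra time slope lam * A * lag * gauge of treg_jet pays for it. The last hypothesis
    prevents the supremum from being attained at time 0, where nothing is known of u. *)
Lemma treg_jet_sub (A lam T tau B Lam : R) H (u : 'I_K -> stpoint R d -> R) :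
  (0 < K)%N -> 0 <= T -> 1 <= A -> 0 <= Lam -> lam = 2 * Lam + 1 -> 0 <= tau ->
  (forall i, lipschitz_bound T Lam (H i)) -> glued T u ->
  (forall i, unif_continuous_on (cylinder T) (u i)) ->
  jet_sub T 0 B H u ->
  (forall i x (t : R), cylinder T (x, t) -> tau < t ->
    u i (x, 0) - A * t * gauge lam t < treg A lam T (u i) (x, t)) ->
  jet_sub T tau B H (fun i => treg A lam T (u i)).
Proof.
move=> K0 T0 A1 Lam0 lamE tau0 hl gu uu [su1 su2] hpos.
have A0 : 0 < A by apply: lt_le_trans A1.
have lam0 : 0 <= lam by rewrite lamE; clear -Lam0; lra.
have pos i z s : cylinder T z -> tau < z.2 -> 0 <= s ->
    treg A lam T (u i) z = u i (z.1, s) - A * `|z.2 - s| * gauge lam z.2 -> 0 < s.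
  case: z => x t cz tz s0 e; rewrite lt_neqAle s0 andbT; apply/negP => /eqP s00.
  have := hpos i x t cz tz; rewrite e -s00 /= subr0 ger0_norm ?ltxx //.
  exact: le_trans (ltW tz).
have ineq i z s g : cylinder T z -> 0 <= s <= T ->
    treg A lam T (u i) z = u i (z.1, s) - A * `|z.2 - s| * gauge lam z.2 ->
    ham_at H i (z.1, s) (g + (0, A * `|z.2 - s| * (lam * gauge lam z.2))) (u i (z.1, s)) <= 0 ->
    ham_at H i z g (treg A lam T (u i) z) <= 0.
  move=> cz hs e; rewrite /ham_at /= addr0 e.
  set hh := `|z.2 - s|; have h0 : 0 <= hh by exact: normr_ge0.
  have g1 : 1 <= gauge lam z.2 by apply: gauge_ge1 => //; case: cz => _ /andP[].
  set Ah := A * hh * gauge lam z.2.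
  have Ahh : hh <= Ah.
    rewrite /Ah mulrAC ler_peMl // -[1]mulr1; apply: ler_pM => //.
  have := hl i g.1 (u i (z.1, s) - Ah) (u i (z.1, s)) z.1 z.2 s.
  have czs : cylinder T (z.1, s) by case: cz.
  have cz' : cylinder T (z.1, z.2) by case: (z) cz.
  move=> /(_ cz' czs).
  have -> : u i (z.1, s) - Ah - u i (z.1, s) = - Ah by ring.
  have Ah0 : 0 <= Ah by exact: le_trans h0 Ahh.
  rewrite normrN (ger0_norm Ah0) -/hh => h1 h2.
  have h3 : Lam * (Ah + hh) <= Lam * (2 * Ah).
    by rewrite ler_wpM2l //; move: Ahh; clear; lra.
  have h4 : A * hh * (lam * gauge lam z.2) = Lam * (2 * Ah) + Ah.
    by rewrite /Ah lamE; ring.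
  move: h2; rewrite h4; move: h1; rewrite ler_norml => /andP[_ h1] h2.
  move: h1 h2 h3 Ah0; clear; move: (H i _ _ _ _) (H i _ _ _ _) (Lam * _) (Lam * _).
  by move=> *; lra.
split=> [i z g zx /andP[tz zT] hj|z p' ra a zx /andP[tz zT] hj].
  have cz : cylinder T z.
    by split; [exact: ltW|apply/andP; split=> //; exact: le_trans tau0 (ltW tz)].
  have [[s hs e] _] := tregP A lam T0 (uu i) (ltW zx).
  apply: (ineq i z s) => //; apply: su1 => //.
    by case/andP: hs => s0 ->; rewrite andbT; exact: (pos i z).
  apply: treg_jet => //; exact: le_lt_trans tz.
have zx0 : z.1.2 <= 0 by rewrite zx.
have cz : cylinder T z.
  by split=> //; apply/andP; split=> //; exact: le_trans tau0 (ltW tz).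
pose i0 := Ordinal K0.
have [[s hs e] _] := tregP A lam T0 (uu i0) zx0.
have ei i : treg A lam T (u i) z = u i (z.1, s) - A * `|z.2 - s| * gauge lam z.2.
  rewrite (glued_eq i i0 gu (z := (z.1, s))) // -e /treg; congr sup.
  apply/seteqP; split=> x [s' hs' ->]; exists s' => //.
    by rewrite (glued_eq i i0 gu (z := (z.1, s'))).
  by rewrite (glued_eq i i0 gu (z := (z.1, s'))).
pose c := A * `|z.2 - s| * (lam * gauge lam z.2).
have tgE r : tgrad p' r a + (0, c) = tgrad p' r (a + c).
  by rewrite /tgrad; congr (_, _); rewrite /= addr0.
have [|i|hB|[i hi]] := su2 (z.1, s) p' ra (a + c) zx.
- by case/andP: hs => s0 ->; rewrite andbT; exact: (pos i0 z).
- rewrite -tgE; apply: treg_jet => //; exact: le_lt_trans tz.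
- by left.
- by right; exists i; apply: (ineq i z s) => //; rewrite tgE.
Qed.

End TimeRegularization.

(** * Comparison of bounded uniformly continuous functions *)

Section Comparison.
Context {R : realType} {d K : nat}.
Implicit Types (g w y z : stpoint R d) (u v : 'I_K -> stpoint R d -> R).
Implicit Types (H : 'I_K -> spoint R d -> R -> spoint R d -> R -> R).
Implicit Types (T : R) (f : stpoint R d -> R).

Lemma common_bound (P : 'I_K -> R -> Prop) :
  (forall i, exists C : R, P i C) -> (forall i (C C' : R), C <= C' -> P i C -> P i C') ->
  exists2 C : R, 0 <= C & forall i, P i C.
Proof.
move=> /boolp.choice[C hC] mono; exists (\big[Num.max/0]_i C i); first exact: bigmax_ge_id.
by move=> i; apply: mono (hC i); exact: le_bigmax.
Qed.

Lemma jet_sub_ext (T tau B : R) H u u' : 0 <= tau ->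
  (forall i w, cylinder T w -> u i w = u' i w) ->
  jet_sub T tau B H u -> jet_sub T tau B H u'.
Proof.
move=> tau0 e [h1 h2].
have cyl z : z.1.2 <= 0 -> tau < z.2 <= T -> cylinder T z.
  by move=> zx /andP[tz zT]; split=> //; rewrite zT (le_trans tau0 (ltW tz)).
have je i z g : cylinder T z -> jet T (u' i) z g -> jet T (u i) z g.
  by move=> cz hj e' /hj[r r0 hr]; exists r => // w cw wz wr; rewrite !e //; exact: hr.
split=> [i z g zx zt hj|z p' r a zx zt hj].
  have cz := cyl z (ltW zx) zt.
  by rewrite -e //; apply: h1 => //; exact: je.
have cz : cylinder T z by apply: cyl; rewrite ?zx.
have [i|hB|[i hi]] := h2 z p' r a zx zt; first exact: je.
  by left.
by right; exists i; rewrite -e.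
Qed.

Record admissible (T Lam : R) H : Prop := Admissible {
  adm_K : (0 < K)%N;
  adm_T : 0 <= T;
  adm_Lam : 0 <= Lam;
  adm_coercive : forall i, coercive_ham T (H i);
  adm_unif : forall i, unif_continuous_ham T (H i);
  adm_lip : forall i, lipschitz_bound T Lam (H i) }.

Lemma treg_glued (A lam T : R) u : glued T u -> glued T (fun i => treg A lam T (u i)).
Proof.
move=> gu i j x' t _; rewrite /treg; congr sup.
by apply/seteqP; split=> x [s hs ->]; exists s => //=; rewrite (gu i j).
Qed.

Lemma common_modulus T u (e : R) : (forall i, unif_continuous_on (cylinder T) (u i)) -> 0 < e ->
  exists2 r : R, 0 < r & forall i w w', cylinder T w -> cylinder T w' -> `|w - w'| < r ->
    `|u i w - u i w'| < e.
Proof.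
move=> uu e0; have [|r r0 hr] := common_radius (K := K) (P := fun i r =>
    forall w w', cylinder T w -> cylinder T w' -> `|w - w'| < r -> `|u i w - u i w'| < e).
  move=> i; have [r r0 hr] := uu i e e0; exists r => // s s0 sr w w' cw cw' ww.
  by apply: hr => //; exact: lt_trans sr.
exists (r / 2); first by rewrite divr_gt0.
move=> i; apply: hr; first by rewrite divr_gt0.
by rewrite ltr_pdivrMr // ltr_pMr // ltr1n.
Qed.

Lemma common_sup_bound T u : (forall i, bounded_on (cylinder T) (u i)) ->
  exists2 M : R, 0 <= M & forall i w, cylinder T w -> `|u i w| <= M.
Proof.
move=> hb; apply: (common_bound (P := fun i M => forall w, cylinder T w -> `|u i w| <= M)) => //.
by move=> i C C' CC' h w cw; exact: le_trans (h w cw) CC'.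
Qed.

Lemma st_same_space (x : spoint R d) (s t : R) : `|((x, s) : stpoint R d) - (x, t)| = `|s - t|.
Proof. by rewrite -[LHS]/(Num.max `|x - x| `|s - t|) subrr normr0 max_r. Qed.

Lemma clamp_uc T f : 0 <= T -> unif_continuous_on (cylinder T) f ->
  unif_continuous_on (cylinder T) ((f : stpoint R d -> R) \o clamp T).
Proof.
move=> T0 uf e /uf[r r0 hr]; exists r => // w w' cw cw' ww /=.
by rewrite !clamp_id //; exact: hr.
Qed.

(** The constants of the finitely many branches have a common bound. *)
Lemma common_lipschitz T (tau Kt M : R) H : 0 <= tau -> 0 <= Kt -> 0 <= M ->
  (forall i, coercive_ham T (H i)) ->
  exists2 Rl : R, 0 <= Rl & forall i f, time_lip_sub T tau Kt M (H i) f ->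
  forall w w', w.2 = w'.2 -> tau < w'.2 <= T -> w.1.2 <= 0 -> w'.1.2 <= 0 ->
  `|f w - f w'| <= Rl * `|w - w'|.
Proof.
move=> tau0 Kt0 M0 hco.
apply: (common_bound (P := fun i Rl => forall f, time_lip_sub T tau Kt M (H i) f ->
  forall w w', w.2 = w'.2 -> tau < w'.2 <= T -> w.1.2 <= 0 -> w'.1.2 <= 0 ->
  `|f w - f w'| <= Rl * `|w - w'|)).
  by move=> i; have [r _ hr] := coercive_lipschitz tau0 Kt0 M0 (hco i); exists r.
move=> i C C' CC' h f tf w w' e1 e2 e3 e4; apply: le_trans (h f tf w w' e1 e2 e3 e4) _.
exact: ler_wpM2r.
Qed.

(** Lipschitz in time by construction, the regularization is Lipschitz in space as well
    by coercivity; for A * tau > 2 * M the supremum is not attained at time 0 after time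
    tau. *)
Lemma treg_lipschitz T Lam (B : R) H (A tau M : R) : admissible T Lam H -> 1 <= A ->
  0 < tau -> 2 * M < A * tau -> 0 <= M ->
  exists2 Lu : R, 0 <= Lu & forall u, glued T u ->
    (forall i, unif_continuous_on (cylinder T) (u i)) ->
    (forall i w, cylinder T w -> `|u i w| <= M) -> jet_sub T 0 B H u ->
    let W i := treg A (2 * Lam + 1) T (u i) in
    jet_sub T tau B H W /\
    forall i w w', cylinder T w -> cylinder T w' -> tau < w.2 -> tau < w'.2 ->
      `|W i w - W i w'| <= Lu * `|w - w'|.
Proof.
move=> [K0 T0 Lam0 hco hun hli] A1 tau0 AM M0.
have A0 : 0 < A by apply: lt_le_trans A1.
set lam := 2 * Lam + 1; have lam0 : 0 <= lam by rewrite addr_ge0 // mulr_ge0.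
pose Kt := treg_time_lip A lam T.
have Kt0 : 0 <= Kt by exact: treg_time_lip_ge0.
have [Rl Rl0 hR] := common_lipschitz (ltW tau0) Kt0 M0 hco.
exists (Rl + Kt); first by rewrite addr_ge0.
move=> u gu uu Mu su W.
have sW : jet_sub T tau B H W.
  apply: (@treg_jet_sub _ _ _ A lam T tau B Lam) => //; first exact: ltW.
  move=> i x t cxt taut; have cx0 : cylinder T (x, 0) by case: cxt => xx _; split=> //=; rewrite lexx.
  have := treg_bound lam T0 A0 (uu i) (Mu i) cxt; have := Mu i _ cx0.
  rewrite !ler_norml => /andP[_ h1] /andP[h2 _].
  have h3 : 2 * M < A * t * gauge lam t.
    apply: lt_le_trans AM _; rewrite -[leLHS]mulr1; apply: ler_pM => //.
      by rewrite mulr_ge0 // ltW.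
      by rewrite ler_wpM2l ?(ltW A0) ?(ltW taut).
    by apply: gauge_ge1 => //; exact: le_trans (ltW tau0) (ltW taut).
  by move: h1 h2 h3; clear; lra.
split=> // i [x s] [x' t] cw cw' /= ts tt.
have tls : time_lip_sub T tau Kt M (H i) (W i).
  split; [exact: (treg_bound lam T0 A0 (uu i) (Mu i))|exact: (treg_uc T0 A0 lam0 (uu i))|by move=> *; exact: (treg_time T0 A0 lam0 (uu i))|].
  by move=> z g zx zt hj; exact: (sW.1 i z g zx zt hj).
have [[xx st] [xx' tt']] := (cw, cw').
have h1 := hR i _ tls (x, t) (x', t) erefl.
have h2 := treg_time T0 A0 lam0 (uu i) cw (conj xx tt' : cylinder T (x, t)).
have h3 : `|((x, t) : stpoint R d) - (x', t)| <= `|((x, s) : stpoint R d) - (x', t)|.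
  rewrite -[leLHS]/(Num.max `|x - x'| `|t - t|) subrr normr0 ge_max normr_ge0 andbT.
  exact: (norm1_le ((x, s) - (x', t))).
have h4 : `|s - t| <= `|((x, s) : stpoint R d) - (x', t)| := norm2_le ((x, s) - (x', t)).
rewrite -(subrKA (W i (x, t))); apply: le_trans (ler_normD _ _) _.
rewrite [leRHS]mulrDl [leRHS]addrC; apply: lerD.
  by apply: le_trans h2 _; rewrite ler_wpM2l.
apply: (@le_trans _ _ (Rl * `|((x, t) : stpoint R d) - (x', t)|)); last by rewrite ler_wpM2l.
by apply: h1 => //=; rewrite tt; case/andP: tt'.
Qed.

(** For small r, up to time r / 2 the inequality follows from the uniform continuity of
    u and v. From then on it is comparison_lip for the regularization of u, which is
    above u and, for A of order 1 / r, still below v + c + e at time r / 2. *)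
Lemma comparison T Lam (c B : R) H u v : admissible T Lam H -> 0 <= c ->
  junction_BUC T u -> junction_BUC T v ->
  jet_sub T 0 B H u -> jet_sub T 0 (- B) (dual_ham H) (fun i w => - v i w) ->
  (forall i x, half_space x -> u i (x, 0) <= v i (x, 0) + c) ->
  forall i w, cylinder T w -> u i w <= v i w + c * gauge (2 * Lam + 1) w.2.
Proof.
move=> adm c0 [gu bu] [gv bv] su sv uv0 i w cw.
have [K0 T0 Lam0 hco hun hli] := adm.
set lam := 2 * Lam + 1; have lam0 : 0 <= lam by rewrite addr_ge0 // mulr_ge0.
suff main e : 0 < e -> u i w <= v i w + (c + e) * gauge lam w.2.
  apply/ler_addgt0Pr => e e0; have := main (e / gauge lam w.2).
  rewrite divr_gt0 ?gauge_gt0 // => /(_ isT).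
  by rewrite mulrDl divfK ?addrA // gt_eqF // gauge_gt0.
move=> e0.
have [M1 M10 hM1] := common_sup_bound (fun i => (bu i).1).
have [M2 M20 hM2] := common_sup_bound (fun i => (bv i).1).
pose M := M1 + M2; have M0 : 0 <= M by rewrite addr_ge0.
have Mu j y : cylinder T y -> `|u j y| <= M.
  by move=> cy; apply: le_trans (hM1 j y cy) _; rewrite lerDl.
have Mv j y : cylinder T y -> `|v j y| <= M.
  by move=> cy; apply: le_trans (hM2 j y cy) _; rewrite lerDr.
have e4 : 0 < e / 4 by rewrite divr_gt0.
have [r1 r10 hr1] := common_modulus (fun i => (bu i).2) e4.
have [r2 r20 hr2] := common_modulus (fun i => (bv i).2) e4.
have [r [r0 rr1 rr2]] : exists r : R, [/\ 0 < r, r <= r1 & r <= r2].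
  by exists (Num.min r1 r2); rewrite lt_min r10 r20 !ge_min !lexx orbT.
have bottom j x t : cylinder T (x, t) -> 0 <= t -> t < r ->
    [/\ cylinder T (x, 0), u j (x, t) < u j (x, 0) + e / 4 & v j (x, 0) < v j (x, t) + e / 4].
  move=> cy t0 tr; have cx0 : cylinder T (x, 0) by case: cy => xx _; split=> //=; rewrite lexx.
  have n1 : `|((x, t) : stpoint R d) - (x, 0)| < r by rewrite st_same_space // subr0 ger0_norm.
  split=> //.
    have := hr1 j _ _ cy cx0 (lt_le_trans n1 rr1); rewrite ltr_norml => /andP[_]; clear; lra.
  have := hr2 j _ _ cy cx0 (lt_le_trans n1 rr2); rewrite ltr_norml => /andP[+ _]; clear; lra.
have gg t : 0 <= t -> c + e <= (c + e) * gauge lam t.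
  by move=> t0; rewrite ler_peMr ?addr_ge0 ?(ltW e0) // gauge_ge1.
have [wr|rw] := ltP w.2 (r / 2).
  case: w cw wr => x t cw wr; have [xx /= /andP[t0 tT]] := cw.
  have tr : t < r by move: wr r0; rewrite /=; clear; lra.
  have [cx0 h1 h2] := bottom i x t cw t0 tr.
  have := uv0 i x xx; have := gg t t0; move: h1 h2 e0; rewrite /=; clear; lra.
(* this gives 2 * M < A * (r / 4): lags are less than r / 4 *)
pose A := 8 * M / r + 1.
have A1 : 1 <= A by rewrite lerDr divr_ge0 ?(ltW r0) // mulr_ge0.
have A0 : 0 < A by apply: lt_le_trans A1.
have r40 : 0 < r / 4 by rewrite divr_gt0.
have Ar : 2 * M < A * (r / 4).
  have -> : A * (r / 4) = 2 * M + r / 4 by rewrite /A; field; rewrite gt_eqF.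
  by rewrite ltrDl.
clearbody A.
have [Lu Lu0 /(_ u gu (fun i => (bu i).2) Mu su)[sW lW]] := treg_lipschitz B adm A1 r40 Ar M0.
rewrite -/lam in sW lW.
pose W j := treg A lam T (u j).
have uW j y : cylinder T y -> u j y <= W j y.
  by move=> cy; apply: treg_ge => //; exact: (bu j).2.
apply: le_trans (uW i w cw) _.
have cyl y : cyt (r / 2) T y -> cylinder T y.
  by apply: cyt_cylinder; rewrite divr_ge0 // ltW.
have r24 t : r / 2 <= t -> r / 4 < t by move: r0; clear; lra.
have T1 j := treg_uc T0 A0 lam0 (bu j).2.
have := comparison_lip (tau := r / 2) (c := c + e) (Lu := Lu) (M := M) (B := B)
  (u := fun j => W j \o clamp T) (v := fun j => v j \o clamp T) K0 _ Lam0 _ Lu0 hco hun hli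
  (fun j => continuous_clamp T0 (T1 j)) (fun j => continuous_clamp T0 (bv j).2).
rewrite addr_ge0 ?(ltW e0) // divr_ge0 ?(ltW r0) // => /(_ isT isT)/(_ _)/wrap[].
  by move=> j y cy /=; rewrite clamp_id //; apply: treg_bound => //; [exact: (bu j).2|exact: Mu].
move=> /(_ _)/wrap[]; first by move=> j y cy /=; rewrite clamp_id //; exact: Mv.
have cL j k x' t : 0 <= t <= T -> cylinder T ((x', 0), t) by split=> //; rewrite /half_space /=.
move=> /(_ _)/wrap[].
  move=> j k x' t tT /=; rewrite !clamp_id; [|exact: cL..].
  exact: treg_glued.
move=> /(_ _)/wrap[].
  move=> j k x' t tT /=; rewrite !clamp_id; [|exact: cL..].
  exact: gv.
move=> /(_ _)/wrap[].
  move=> j y y' cy cy' /=; rewrite !clamp_id; [|exact: cyl..].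
  apply: lW; [exact: cyl|exact: cyl| |]; apply: r24.
    by case: cy => _ /andP[].
  by case: cy' => _ /andP[].
move=> /(_ (fun j => clamp_uc T0 (bv j).2))/(_ _)/wrap[].
  apply: (jet_sub_ext _ (u := W)).
  - by rewrite divr_ge0 // ltW.
  - by move=> j y cy /=; rewrite clamp_id.
  - split=> [j z g zx /andP[tz zT]|z p' rr a zx /andP[tz zT]].
      by apply: sW.1; rewrite // zT andbT r24 // ltW.
    by apply: sW.2; rewrite // zT andbT r24 // ltW.
move=> /(_ _)/wrap[].
  apply: (jet_sub_ext _ (u := fun j y => - v j y)).
  - by rewrite divr_ge0 // ltW.
  - by move=> j y cy /=; rewrite clamp_id.
  - have r20' : 0 < r / 2 by rewrite divr_gt0.
    split=> [j z g zx /andP[tz zT]|z p' rr a zx /andP[tz zT]].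
      by apply: sv.1; rewrite // zT andbT (lt_trans r20').
    by apply: sv.2; rewrite // zT andbT (lt_trans r20').
rewrite /= => /(_ _)/wrap[]; last first.
  move=> /(_ i w); rewrite clamp_id //; apply; split; first by case: cw.
  by rewrite rw; case: cw => _ /andP[].
move=> j y cy yr; have cyy := cyl y cy; rewrite (clamp_id cyy) -yr.
have [s /andP[s0 sT] []] := treg_close T0 A0 lam0 (bu j).2 (Mu j) cyy; rewrite -/lam -/(W j y) => -> hA.
case: y yr cy cyy s0 sT hA => x t /= yr cy cyy s0 sT hA.
have xx : half_space x by case: cyy.
have hs : `|t - s| < r / 4.
  by rewrite -(ltr_pM2l A0); exact: le_lt_trans Ar.
have sr : s < r by move: hs r0; rewrite ltr_norml yr => /andP[h _]; move: h; clear; lra.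
have tr : t < r by rewrite yr; move: r0; clear; lra.
have t0 : 0 <= t by rewrite yr divr_ge0 // ltW.
have csx : cylinder T (x, s) by split=> //=; rewrite s0.
have [cx0 h1 _] := bottom j x s csx s0 sr.
have [_ _ h2] := bottom j x t cyy t0 tr.
have h3 : 0 <= A * `|t - s| * gauge lam t.
  by rewrite !mulr_ge0 ?(ltW A0) // ltW // gauge_gt0.
have := uv0 j x xx; have := gg t t0; move: h1 h2 h3 e0; clear.
by move: (A * _ * _) ((c + e) * _) => *; lra.
Qed.

End Comparison.

(** * Solutions, directional derivatives and barriers *)

Section Solutions.
Context {R : realType} {d K : nat}.
Implicit Types (g w y z : stpoint R d) (u v : 'I_K -> stpoint R d -> R).
Implicit Types (H : 'I_K -> spoint R d -> R -> spoint R d -> R -> R).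
Implicit Types (T : R) (f : stpoint R d -> R).

(** Replace f by f \o clamp T. *)
Lemma unif_continuous_within T f : 0 <= T -> unif_continuous_on (cylinder T) f ->
  {within cylinder T, continuous f}.
Proof.
move=> T0 uf; apply: (@subspace_eq_continuous _ _ _ (f \o clamp T)).
  by move=> w; rewrite inE => cw /=; rewrite clamp_id.
exact: continuous_subspaceT (continuous_clamp T0 uf).
Qed.

Lemma junction_BUCN T u : junction_BUC T u -> junction_BUC T (fun i w => - u i w).
Proof.
move=> [gu bu]; split=> [i j x' t tT|i]; first by rewrite (gu i j).
have [[M hM] uu] := bu i; split; first by exists M => w cw; rewrite normrN; exact: hM.
by move=> e /uu[r r0 hr]; exists r => // w w' cw cw' ww; rewrite -opprD normrN; exact: hr.
Qed.

Lemma qjet_sub_jet_sub T B H u : (0 < K)%N -> (forall i, unif_continuous_ham T (H i)) ->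
  junction_BUC T u -> qjet_sub T 0 B H u -> jet_sub T 0 B H u.
Proof.
move=> K0 hun [gu bu] qu; apply: jet_sub_stability => // i0 z delta cz d0.
exists u; split=> //; last by rewrite gerBl ltW.
- by move=> i; exact: (bu i).2.
- by move=> i y cy; rewrite lerDl ltW.
Qed.

Lemma jet_sub_subsolution T B H u : 0 <= T -> junction_BUC T u -> jet_sub T 0 B H u ->
  sub_solution T B H u.
Proof.
move=> T0 [gu bu]; apply: jet_sub_solution => // i.
by apply: unif_continuous_within => //; exact: (bu i).2.
Qed.

Definition dual_jet_sub T B H v := jet_sub T 0 (- B) (dual_ham H) (fun i w => - v i w).

Lemma sub_solutionP T B H u : (0 < K)%N -> 0 <= T -> (forall i, unif_continuous_ham T (H i)) ->
  junction_BUC T u -> sub_solution T B H u <-> jet_sub T 0 B H u.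
Proof.
move=> K0 T0 hun bu; split; last exact: jet_sub_subsolution.
by move=> /sub_solution_qjet; exact: qjet_sub_jet_sub.
Qed.

Lemma super_solutionP T B H v : (0 < K)%N -> 0 <= T -> (forall i, unif_continuous_ham T (H i)) ->
  junction_BUC T v -> super_solution T B H v <-> dual_jet_sub T B H v.
Proof.
move=> K0 T0 hun bv; rewrite super_sub_dual; apply: sub_solutionP => //.
  by move=> i; exact: dual_ham_unif.
exact: junction_BUCN.
Qed.

(** Comparison without initial excess. *)
Lemma comparison_solutions T (Lam B : R) H u v : admissible T Lam H ->
  junction_BUC T u -> junction_BUC T v -> sub_solution T B H u -> super_solution T B H v ->
  (forall i x, half_space x -> u i (x, 0) <= v i (x, 0)) ->
  forall i w, cylinder T w -> u i w <= v i w.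
Proof.
move=> adm bu bv; have [K0 T0 _ _ hun _] := adm.
move=> /(sub_solutionP B K0 T0 hun bu) su /(super_solutionP B K0 T0 hun bv) sv uv0 i w cw.
have := comparison adm (lexx 0) bu bv su sv _ i cw.
by rewrite mul0r addr0; apply=> j x hx; rewrite addr0; exact: uv0.
Qed.

(** One-sided derivatives along a direction that stays in the cylinder and does not go
    forward in time. *)
Lemma jet_direction T f z g (v : stpoint R d) (m C s0 : R) : jet T f z g -> v.2 <= 0 -> 0 <= C -> 0 < s0 ->
  (forall s : R, 0 < s -> s < s0 -> cylinder T (z + s *: v) /\
     f z + s * m - C * s ^+ 2 <= f (z + s *: v)) ->
  m <= ip g v.
Proof.
move=> hj v2 C0 s00 h; rewrite leNgt; apply/negP => lt.
have [gap gapE] : exists gap, gap = m - ip g v by exists (m - ip g v).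
 have gap0 : 0 < gap by rewrite gapE subr_gt0.
have v1 : 0 < `|v| + 1 by rewrite ltr_wpDl.
have e0 : 0 < gap / 2 / (`|v| + 1) by rewrite !divr_gt0.
have [r r0 hr] := hj _ e0.
have C1 : 0 < 2 * C + 1 by rewrite ltr_wpDl // mulr_ge0.
have [|s sp] := @pick_small R [:: s0; r / (`|v| + 1); gap / (2 * C + 1)].
  by rewrite /= s00 !divr_gt0.
rewrite /= andbT !ltr_pdivlMr // => /and3P[h1 h2 h3].
have [cs hs] := h s sp h1.
have zs : z + s *: v - z = s *: v by rewrite addrAC subrr add0r.
have nv : `|s *: v| = s * `|v| by rewrite normrZ gtr0_norm.
have := hr _ cs; rewrite zs nv ipZr => /(_ _)/wrap[].
  rewrite /= -[s *: v.2]/(s * v.2) gerDl; exact: mulr_ge0_le0 (ltW sp) v2.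
move=> /(_ _)/wrap[].
  by apply: le_lt_trans h2; rewrite ler_wpM2l ?(ltW sp) // lerDl.
move=> h4.
have h5 : gap / 2 / (`|v| + 1) * `|v| <= gap / 2.
  by rewrite mulrAC ler_pdivrMr // ler_wpM2l ?divr_ge0 ?(ltW gap0) // lerDl.
have h6 : s * (gap / 2 / (`|v| + 1) * `|v|) <= s * (gap / 2) by rewrite ler_wpM2l // ltW.
have h7 : s * (s * (2 * C + 1)) < s * gap by rewrite ltr_pM2l.
have h8 : s * m <= C * s ^+ 2 + s * ip g v + s * (gap / 2 / (`|v| + 1) * `|v|).
  rewrite [s * (_ * _)]mulrCA; move: hs h4; clear; move: (f _) (f _) (_ * (s * _)) => *; lra.
have h9 : s * gap = s * m - s * ip g v by rewrite gapE mulrBr.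
have h10 : s * (s * (2 * C + 1)) = 2 * (C * s ^+ 2) + s ^+ 2 by ring.
have h11 : 0 <= s ^+ 2 by exact: sqr_ge0.
have h12 : s * (gap / 2) = s * gap / 2 by rewrite mulrA.
move: h6 h7 h8 h9 h10 h11 h12; clear.
lra.
Qed.

Section Barrier.
Variables (T Lam L C B : R).
(** For lam = 2 * Lam + 1 the derivative of this function is at least C plus Lam times
    the function itself: it dominates the Hamiltonian at the initial data, and the
    increase of the Hamiltonian due to the change of u. *)
Definition barrier_growth (t : R) := C * (gauge (2 * Lam + 1) t - 1).
Definition lower_barrier (u0 : 'I_K -> spoint R d -> R) i w := u0 i w.1 - barrier_growth w.2.
Definition upper_barrier (u0 : 'I_K -> spoint R d -> R) i w := u0 i w.1 + barrier_growth w.2.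
End Barrier.

(** On each branch; continuity through the junction is glued0. *)
Definition lipschitz_datum (L : R) (u0 : 'I_K -> spoint R d -> R) :=
  forall i (x y : spoint R d), half_space x -> half_space y -> `|u0 i x - u0 i y| <= L * `|x - y|.

Lemma barrier_time_slope T Lam C (u0 : 'I_K -> spoint R d -> R) i z g : 0 <= Lam -> 0 <= C ->
  cylinder T z -> 0 < z.2 -> jet T (lower_barrier Lam C u0 i) z g ->
  g.2 <= - (C * ((2 * Lam + 1) * gauge (2 * Lam + 1) z.2)).
Proof.
move=> Lam0 C0 cz z0 hj; set lam := 2 * Lam + 1.
have [r r0 hr] := gauge_quad lam z.2.
have gp := gauge_gt0 lam z.2.
rewrite lerNr.
have -> : - g.2 = ip g (0, -1) by rewrite ipC ip_time mulN1r.
apply: (@jet_direction T _ z g (0, -1) _ (C * (2 * gauge lam z.2 * lam ^+ 2)) (Num.min r z.2)) => //=.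
- exact: hj.
- by rewrite mulr_ge0 // mulr_ge0 ?sqr_ge0 // mulr_ge0 // (ltW gp).
- by rewrite lt_min r0.
move=> s s0; rewrite lt_min => /andP[sr sz].
have zE : z + s *: ((0, -1) : stpoint R d) = (z.1, z.2 - s).
  congr (_, _); rewrite /= ?scaler0 ?addr0 //.
  by rewrite -[s *: (-1)]/(s * -1) mulrN1.
rewrite zE; split.
  case: cz => zx /andP[_ zT]; split=> //=; rewrite subr_ge0 (ltW sz) /=.
  by apply: le_trans zT; rewrite gerBl ltW.
have := hr (z.2 - s); have -> : z.2 - s - z.2 = - s by ring.
rewrite normrN gtr0_norm // sqrrN => /(_ sr); rewrite ler_norml => /andP[_ h].
rewrite /lower_barrier /barrier_growth -/lam /=.
have := ler_wpM2l C0 h; rewrite !mulrBr; clear.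
by move: (u0 i _) => U; lra.
Qed.

Lemma barrier_space_slope T Lam L C (u0 : 'I_K -> spoint R d -> R) i z g (v : stpoint R d) (s0 : R) : 0 <= L ->
  lipschitz_datum L u0 -> cylinder T z -> v.2 = 0 -> 0 < s0 ->
  (forall s : R, 0 < s -> s < s0 -> z.1.2 + s * v.1.2 <= 0) ->
  jet T (lower_barrier Lam C u0 i) z g -> - (L * `|v|) <= ip g v.
Proof.
move=> L0 hL cz v2 s00 hs hj; have [zx zt] := cz.
apply: (@jet_direction T _ z g v _ 0 s0) => //; [exact: hj|by rewrite v2|].
move=> s sp ss; have tE : (z + s *: v).2 = z.2.
  by rewrite /= v2 -[s *: (0 : R)]/(s * 0) mulr0 addr0.
have hx : half_space (z + s *: v).1 by exact: hs.
split; first by split=> //; rewrite tE.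
rewrite /lower_barrier tE mul0r subr0.
have := hL i (z + s *: v).1 z.1 hx zx.
have -> : (z + s *: v).1 - z.1 = s *: v.1 by rewrite /= addrAC subrr add0r.
have : L * `|s *: v.1| <= L * (s * `|v|).
  by rewrite ler_wpM2l // normrZ gtr0_norm // ler_wpM2l ?(ltW sp) // norm1_le.
rewrite ler_norml => h1 /andP[h2 _]; move: h1 h2; rewrite [L * (s * _)]mulrCA mulrN.
by clear; move: (u0 i _) (u0 i _) => *; lra.
Qed.

(** A jet has time slope at most the opposite of the derivative of barrier_growth, and a
    spatial gradient of size at most L at interior points, so the equation holds by the
    choice of C. On the junction normal slopes are only bounded above: either they are
    all below - |B|, and the Kirchhoff condition holds, or one of them is bounded and
    the equation holds on its branch. *)
Lemma barrier_jet_sub T (Lam L C B : R) H (u0 : 'I_K -> spoint R d -> R) : (0 < K)%N -> 0 <= Lam -> 0 <= L -> 0 <= C ->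
  (forall i, lipschitz_bound T Lam (H i)) -> lipschitz_datum L u0 ->
  (forall i p x t, cylinder T (x, t) -> `|p| <= L + `|B| -> H i p (u0 i x) x t <= C) ->
  jet_sub T 0 B H (lower_barrier Lam C u0).
Proof.
move=> K0 Lam0 L0 C0 hli hL hC.
have cyl z : z.1.2 <= 0 -> 0 < z.2 <= T -> cylinder T z.
  by move=> zx /andP[z0 zT]; split=> //; rewrite (ltW z0).
have ham i z g : cylinder T z -> 0 < z.2 -> `|g.1| <= L + `|B| ->
    jet T (lower_barrier Lam C u0 i) z g -> ham_at H i z g (lower_barrier Lam C u0 i z) <= 0.
  move=> cz z0 hg hj; have h1 := barrier_time_slope Lam0 C0 cz z0 hj.
  have cz' : cylinder T (z.1, z.2) by case: (z) cz.
  have h2 := hC i g.1 z.1 z.2 cz' hg.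
  have := hli i g.1 (lower_barrier Lam C u0 i z) (u0 i z.1) z.1 z.2 z.2 cz' cz'.
  rewrite subrr normr0 addr0 /ham_at {1 3}/lower_barrier.
  have -> : u0 i z.1 - barrier_growth Lam C z.2 - u0 i z.1 = - barrier_growth Lam C z.2 by ring.
  have g1 : 1 <= gauge (2 * Lam + 1) z.2.
    by apply: gauge_ge1 => //; [rewrite addr_ge0 // mulr_ge0|exact: ltW].
  have b0 : 0 <= barrier_growth Lam C z.2 by rewrite mulr_ge0 // subr_ge0.
  rewrite normrN (ger0_norm b0).
  rewrite ler_norml => /andP[_ h3]; move: h1 h2 h3; rewrite /barrier_growth.
  have h4 : 0 <= Lam * C by rewrite mulr_ge0.
  have h5 : 0 <= (Lam * C + C) * (gauge (2 * Lam + 1) z.2 - 1).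
    by rewrite mulr_ge0 ?subr_ge0 // addr_ge0.
  move: h4 h5; move: (gauge _ _) (H i _ _ _ _) (H i _ _ _ _) => *; lra.
split=> [i z g zx zt hj|z p' r a zx zt hj].
  have cz := cyl z (ltW zx) zt; have /andP[z0 _] := zt.
  apply: ham => //; apply: (@le_trans _ _ L); last by rewrite lerDl.
  have n1 : 0 < `|g.1| + 1 by rewrite ltr_wpDl.
  have := @barrier_space_slope T Lam L C u0 i z g (- spart g) (- z.1.2 / (`|g.1| + 1)) L0 hL cz.
  rewrite /= oppr0 divr_gt0 ?oppr_gt0 // => /(_ erefl isT)/(_ _ hj)/wrap[].
    move=> s s0; rewrite ltr_pdivlMr // => hs.
    have : s * - g.1.2 <= s * (`|g.1| + 1).
      rewrite ler_wpM2l ?(ltW s0) //; apply: le_trans (ler_norm _) _.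
      by rewrite normrN; apply: le_trans (sp_norm2_le g.1) _; rewrite lerDl.
    by move: hs; clear; lra.
  rewrite ipNr ipC -ip_spart -/(sqn _) normrN.
  have := sqr_norm_le_sqn (spart g); have -> : `|spart g| = `|g.1|.
    by rewrite -[LHS]/(Num.max `|g.1| `|0 : R|) normr0 max_l.
  move=> h1 h2; have [->|gn] := eqVneq `|g.1| 0; first exact: L0.
  have gp : 0 < `|g.1| by rewrite lt_neqAle eq_sym gn normr_ge0.
  by rewrite -(ler_pM2r gp) -expr2; move: h1 h2; clear; lra.
have cz : cylinder T z by apply: cyl => //; rewrite zx.
have /andP[z0 _] := zt.
have [[i hi]|hN] := pselect (exists i, - `|B| <= r i); last first.
  left; have h i : r i <= - `|B|.
    by have [//|/ltW hi] := leP (r i) (- `|B|); case: hN; exists i.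
  apply: (@le_trans _ _ (\sum_(i < K) - `|B|)); first exact: ler_sum.
  rewrite sumr_const card_ord mulNrn lerNl.
  apply: (@le_trans _ _ `|B|); first by rewrite -normrN ler_norm.
  by rewrite -[leRHS]mulr_natr ler_peMr // ler1n.
right; exists i; apply: ham => //.
rewrite -[leLHS]/(Num.max `|p'| `|r i|) ge_max; apply/andP; split.
  apply: (@le_trans _ _ L); last by rewrite lerDl.
  pose V : stpoint R d := ((p', 0), 0).
  have := @barrier_space_slope T Lam L C u0 i z (tgrad p' (r i) a) (- V) 1 L0 hL cz.
  rewrite /= !oppr0 ltr01 => /(_ erefl isT)/(_ _ (hj i))/wrap[].
    by move=> s s0 _; rewrite zx mulr0 addr0.
  have -> : ip (tgrad p' (r i) a) (- V) = - sqn V.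
    by rewrite ipNr /sqn /ip /dotp /= !mulr0.
  have nV : `|V| = `|p'|.
    by rewrite stnormE /= normr0 (max_l (normr_ge0 _)) (max_l (normr_ge0 _)).
  have := sqr_norm_le_sqn V; rewrite normrN nV.
  move=> h1 h2; have [->|gn] := eqVneq `|p'| 0; first exact: L0.
  have gp : 0 < `|p'| by rewrite lt_neqAle eq_sym gn normr_ge0.
  by rewrite -(ler_pM2r gp) -expr2; move: h1 h2; clear; lra.
have := @barrier_space_slope T Lam L C u0 i z (tgrad p' (r i) a) (ed (-1)) 1 L0 hL cz.
rewrite /= ltr01 => /(_ erefl isT)/(_ _ (hj i))/wrap[].
  by move=> s s0 _; rewrite zx add0r mulrN1 oppr_le0 ltW.
have -> : ip (tgrad p' (r i) a) (ed (-1)) = - r i.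
  by rewrite ipC ip_ed mulN1r.
have n1 : L * `|ed (-1) : stpoint R d| <= L.
  by rewrite -[leRHS]mulr1 ler_wpM2l //; apply: le_trans (norm_ed_le _) _; rewrite normrN normr1.
move: hi n1 L0; have := normr_ge0 B; clear; move: (L * _) => X B0 h1 h2 h3 h4.
rewrite ler_norml; apply/andP; split; lra.
Qed.

End Solutions.

(** * The maximal candidate *)

Section Perron.
Context {R : realType} {d K : nat}.
Implicit Types (g y z : stpoint R d) (W U V : 'I_K -> stpoint R d -> R).
Implicit Types (H : 'I_K -> spoint R d -> R -> spoint R d -> R -> R).
Implicit Types (T Lam B C : R).

Record perron_setting T Lam B H (u0 : 'I_K -> spoint R d -> R) C : Prop := PerronSetting {
  ps_T : 0 < T;
  ps_C : 0 <= C;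
  ps_adm : admissible T Lam H;
  ps_lower : junction_BUC T (lower_barrier Lam C u0);
  ps_upper : junction_BUC T (upper_barrier Lam C u0);
  ps_lower_sub : jet_sub T 0 B H (lower_barrier Lam C u0);
  ps_upper_super : dual_jet_sub T B H (upper_barrier Lam C u0) }.

(** The subsolutions among which the solution is the greatest one. *)
Record perron_candidate T Lam B H (u0 : 'I_K -> spoint R d -> R) C W : Prop := PerronCandidate {
  pc_BUC : junction_BUC T W;
  pc_sub : jet_sub T 0 B H W;
  pc_lower : forall i y, cylinder T y -> lower_barrier Lam C u0 i y <= W i y;
  pc_initial : forall i x, half_space x -> W i (x, 0) <= u0 i x }.

(** A bound for the growth rate of the barriers, increased by 1. *)
Definition perron_rate T Lam C : R := C * ((2 * Lam + 1) * gauge (2 * Lam + 1) T) + 1.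
Definition perron_time_lip T Lam C : R := treg_time_lip (perron_rate T Lam C) (2 * Lam + 1) T.

(** The candidates whose modulus of continuity is controlled: their supremum is
    continuous. *)
Definition perron_class T Lam B H (u0 : 'I_K -> spoint R d -> R) C W := perron_candidate T Lam B H u0 C W /\
  forall i (x : spoint R d) (s t : R), cylinder T (x, s) -> cylinder T (x, t) ->
    `|W i (x, s) - W i (x, t)| <= perron_time_lip T Lam C * `|s - t|.

Lemma barrier_growth0 Lam C : barrier_growth Lam C 0 = 0.
Proof. by rewrite /barrier_growth /gauge mulr0 expR0 subrr mulr0. Qed.

Lemma barrier_growth_le T Lam C (t : R) : 0 <= Lam -> 0 <= C -> 0 <= t <= T ->
  barrier_growth Lam C t <= (perron_rate T Lam C - 1) * t.
Proof.
move=> Lam0 C0 /andP[t0 tT]; rewrite /barrier_growth /perron_rate addrK -mulrA ler_wpM2l //.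
have l0 : 0 <= 2 * Lam + 1 by rewrite addr_ge0 // mulr_ge0.
have := gauge_lip l0 t0 tT; rewrite subr0; apply: le_trans.
by rewrite lerD2l lerN2 /gauge mulr0 expR0.
Qed.

Lemma perron_rate_ge1 T Lam C : 0 <= Lam -> 0 <= C -> 1 <= perron_rate T Lam C.
Proof.
move=> Lam0 C0; rewrite lerDr mulr_ge0 // mulr_ge0 ?(ltW (gauge_gt0 _ _)) //.
by rewrite addr_ge0 // mulr_ge0.
Qed.

(** Comparison with the upper barrier. *)
Lemma candidate_upper T Lam B H u0 C W : perron_setting T Lam B H u0 C ->
  perron_candidate T Lam B H u0 C W ->
  forall i y, cylinder T y -> W i y <= upper_barrier Lam C u0 i y.
Proof.
move=> [T0 C0 adm bl bu sl su] [bW sW lW iW] i y cy.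
have := comparison adm (lexx 0) bW bu sW su _ i cy; rewrite mul0r addr0; apply=> j x hx.
by rewrite /upper_barrier barrier_growth0 !addr0; exact: iW.
Qed.

(** The rate of the regularization exceeds the growth rate of the barriers, between
    which the candidate lies. So the supremum that defines V is not attained at time 0,
    and V still has initial values at most u0. *)
Lemma candidate_regularization T Lam B H u0 C W : perron_setting T Lam B H u0 C ->
  perron_candidate T Lam B H u0 C W ->
  let V i := treg (perron_rate T Lam C) (2 * Lam + 1) T (W i) in
  perron_class T Lam B H u0 C V /\ forall i y, cylinder T y -> W i y <= V i y.
Proof.
move=> ps pc V; have uW := candidate_upper ps pc; move: ps pc.
move=> [T0 C0 [K0 _ Lam0 hco hun hli] bl bu sl su] [[gW bW] sW lW iW].
have T0' := ltW T0; have l0 : 0 <= 2 * Lam + 1 by rewrite addr_ge0 // mulr_ge0.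
have A1 := perron_rate_ge1 T Lam0 C0.
have A0 : 0 < perron_rate T Lam C by apply: lt_le_trans A1.
have uc i := (bW i).2.
have WV i y : cylinder T y -> W i y <= V i y by exact: treg_ge.
split=> //; split; last first.
  by move=> i x s t cs ct; exact: (treg_time T0' A0 l0 (uc i)).
split.
- split; first exact: treg_glued.
  move=> i; split; last exact: treg_uc T0' A0 l0 (uc i).
  have [M hM] := (bW i).1; exists M => y; exact: (treg_bound _ T0' A0 (uc i) hM).
- apply: (@treg_jet_sub _ _ _ _ _ T 0 B Lam) => // i x t cxt t0.
  have [xx /andP[_ tT]] := cxt.
  apply: lt_le_trans (WV i _ cxt); apply: lt_le_trans (lW i _ cxt).
  have h1 := iW i x xx; have h2 := @barrier_growth_le T Lam C t Lam0 C0.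
  have {h2} := h2 (ltac:(by rewrite (ltW t0))).
  have g1 : 1 <= gauge (2 * Lam + 1) t by apply: gauge_ge1 => //; exact: ltW.
  have h3 : perron_rate T Lam C * t <= perron_rate T Lam C * t * gauge (2 * Lam + 1) t.
    by rewrite ler_peMr // mulr_ge0 ?(ltW A0) ?(ltW t0).
  move: h1 h3 t0; rewrite /lower_barrier /=; clear.
  move: (gauge _ _) (perron_rate _ _ _) => G P; move: (P * t * G) => X.
  rewrite mulrBl mul1r; move: (P * t) => Y; lra.
- by move=> i y cy; apply: le_trans (WV i y cy); exact: lW.
- move=> i x hx; have cx0 : cylinder T (x, 0) by split=> //=; rewrite lexx.
  have [[s hs e] _] := tregP (perron_rate T Lam C) (2 * Lam + 1) T0' (uc i) (w := (x, 0)) hx.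
  have cxs : cylinder T (x, s) by [].
  have /andP[s0 _] := hs.
  have := uW i _ cxs; rewrite /upper_barrier /V e /= sub0r normrN ger0_norm //.
  have := barrier_growth_le Lam0 C0 hs; rewrite /gauge mulr0 expR0 mulr1 mulrBl mul1r.
  by move: s0; clear; move: (perron_rate _ _ _ * s) => X; lra.
Qed.

Lemma lower_candidate T Lam B H u0 C : perron_setting T Lam B H u0 C ->
  perron_candidate T Lam B H u0 C (lower_barrier Lam C u0).
Proof.
move=> [T0 C0 adm bl bu sl su]; split=> // i x hx.
by rewrite /lower_barrier barrier_growth0 subr0.
Qed.

Lemma perron_class_bound T Lam B H u0 C : perron_setting T Lam B H u0 C ->
  exists2 M : R, 0 <= M & forall W, perron_candidate T Lam B H u0 C W ->
    forall i y, cylinder T y -> `|W i y| <= M.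
Proof.
move=> ps; have [T0 C0 adm bl bu sl su] := ps.
have [M1 M10 hM1] := common_sup_bound (fun i => (bl.2 i).1).
have [M2 M20 hM2] := common_sup_bound (fun i => (bu.2 i).1).
exists (M1 + M2); first by rewrite addr_ge0.
move=> W pc i y cy; have := pc_lower pc i cy; have := candidate_upper ps pc i cy.
have := hM1 i y cy; have := hM2 i y cy; rewrite !ler_norml => /andP[_ h1] /andP[h2 _] h3 h4.
by apply/andP; split; move: M10 M20 h1 h2 h3 h4; clear; lra.
Qed.

(** Coercivity gives the bound at positive times, and continuity in time extends it to
    time 0. *)
Lemma perron_class_lipschitz T Lam B H u0 C : perron_setting T Lam B H u0 C ->
  exists2 Lu : R, 0 <= Lu & forall W, perron_class T Lam B H u0 C W ->
    forall i y y', cylinder T y -> cylinder T y' -> `|W i y - W i y'| <= Lu * `|y - y'|.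
Proof.
move=> ps; have [M M0 hM] := perron_class_bound ps.
have [T0 C0 [K0 _ Lam0 hco hun hli] bl bu sl su] := ps.
pose Kt := perron_time_lip T Lam C.
have l0 : 0 <= 2 * Lam + 1 by rewrite addr_ge0 // mulr_ge0.
have A0 : 0 < perron_rate T Lam C by apply: lt_le_trans (perron_rate_ge1 T Lam0 C0).
have Kt0 : 0 <= Kt by apply: treg_time_lip_ge0 => //; exact: ltW.
have [Rl Rl0 hRl] := common_lipschitz (lexx 0) Kt0 M0 hco.
exists (Rl + Kt); first by rewrite addr_ge0.
move=> W [pc tW] i [x s] [x' s'] cy cy'.
have tls : time_lip_sub T 0 Kt M (H i) (W i).
  split; [by move=> y; exact: hM|exact: ((pc_BUC pc).2 i).2|exact: tW|].
  by move=> z g zx zt hj; exact: ((pc_sub pc).1 i z g zx zt hj).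
have [[xx st] [xx' st']] := (cy, cy').
have [nx nt] : `|x - x'| <= `|((x, s) : stpoint R d) - (x', s')| /\
    `|s - s'| <= `|((x, s) : stpoint R d) - (x', s')|.
  by split; [exact: (norm1_le ((x, s) - (x', s')))|exact: (norm2_le ((x, s) - (x', s')))].
have step t : 0 < t <= T ->
    `|W i (x, s) - W i (x', s')| <= Kt * `|s - t| + Rl * `|x - x'| + Kt * `|t - s'|.
  move=> /andP[t0 tT]; have tt : 0 <= t <= T by rewrite (ltW t0).
  have h1 := hRl i _ tls (x, t) (x', t) erefl.
  have h2 := tW i x s t cy (conj xx tt); have h3 := tW i x' t s' (conj xx' tt) cy'.
  have := h1; rewrite /= t0 tT => /(_ isT xx xx').
  have -> : `|((x, t) : stpoint R d) - (x', t)| = `|x - x'|.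
    by rewrite -[LHS]/(Num.max `|x - x'| `|t - t|) subrr normr0 max_l.
  move=> h4; rewrite -(subrKA (W i (x, t))) -[W i (x, t) - _](subrKA (W i (x', t))) addrA.
  apply: le_trans (ler_normD _ _) _; apply: lerD; last exact: h3.
  by apply: le_trans (ler_normD _ _) _; apply: lerD.
suff : `|W i (x, s) - W i (x', s')| <= Rl * `|x - x'| + Kt * `|s - s'|.
  move=> /le_trans; apply; rewrite mulrDl; apply: lerD; exact: ler_wpM2l.
have [s0|s0] := ltP 0 s.
  by have := step s; rewrite s0 => /(_ (andP st).2); rewrite subrr normr0 mulr0 add0r.
have {}s0 : s = 0 by apply/eqP; rewrite eq_le s0; case/andP: st.
apply/ler_addgt0Pr => e e0; have k1 : 0 < 2 * Kt + 1 by rewrite ltr_wpDl // mulr_ge0.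
have [t [t0 tT te]] : exists t : R, [/\ 0 < t, t <= T & t * (2 * Kt + 1) <= e].
  exists (Num.min T (e / (2 * Kt + 1))); split; first by rewrite lt_min T0 divr_gt0.
    by rewrite ge_min lexx.
  by rewrite -ler_pdivlMr // ge_min lexx orbT.
have := step t; rewrite t0 tT s0 => /(_ isT) /le_trans; apply.
rewrite !sub0r !normrN (gtr0_norm t0).
have /andP[s'0 _] := st'; have h1 : Kt * `|t - s'| <= Kt * (t + s').
  rewrite ler_wpM2l // ler_norml; apply/andP; split; move: t0 s'0; rewrite /=; clear; lra.
rewrite (ger0_norm s'0); move: h1 te t0; rewrite !mulrDr mulr1 [t * (2 * _)]mulrCA [t * Kt]mulrC.
by clear; move: (Kt * t) (Kt * s') (Rl * _) (Kt * _) => *; lra.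
Qed.

Definition perron_sup T Lam B H (u0 : 'I_K -> spoint R d -> R) C : 'I_K -> stpoint R d -> R := fun i y =>
  sup [set x : R | exists2 W, perron_class T Lam B H u0 C W & x = W i y].

Lemma perron_supP T Lam B H u0 C i y : perron_setting T Lam B H u0 C -> cylinder T y ->
  [/\ forall W, perron_class T Lam B H u0 C W -> W i y <= perron_sup T Lam B H u0 C i y,
      forall b : R, (forall W, perron_class T Lam B H u0 C W -> W i y <= b) ->
        perron_sup T Lam B H u0 C i y <= b &
      forall e : R, 0 < e -> exists2 W, perron_class T Lam B H u0 C W &
        perron_sup T Lam B H u0 C i y - e < W i y].
Proof.
move=> ps cy; rewrite /perron_sup; set S := [set x : R | _].
have [W0 _] := candidate_regularization ps (lower_candidate ps).
have S0 : S !=set0 by eexists; exists (fun i => treg (perron_rate T Lam C) (2 * Lam + 1) T (lower_barrier Lam C u0 i)).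
have [M _ hM] := perron_class_bound ps.
have ubS : has_ubound S.
  exists M => _ [W [pc _] ->]; exact: le_trans (ler_norm _) (hM W pc i y cy).
split=> [W cW|b hb|e e0].
- by apply: ub_le_sup => //; exists W.
- by apply: ge_sup => // _ [W cW ->]; exact: hb.
- by have [_ [W cW ->] h] := sup_adherent e0 (conj S0 ubS); exists W.
Qed.

(** The supremum of the equi-Lipschitz class is a candidate by stability; it is above
    every candidate, because a candidate is below its regularization, which is in the
    class. *)
Lemma perron_max T Lam B H u0 C : perron_setting T Lam B H u0 C ->
  exists2 U, perron_candidate T Lam B H u0 C U &
    forall W, perron_candidate T Lam B H u0 C W ->
      forall i y, cylinder T y -> W i y <= U i y.
Proof.
move=> ps; pose U := perron_sup T Lam B H u0 C; exists U; last first.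
  move=> W pc i y cy; have [cV WV] := candidate_regularization ps pc.
  have [hU _ _] := perron_supP i ps cy.
  exact: le_trans (WV i y cy) (hU _ cV).
have [T0 C0 [K0 _ Lam0 hco hun hli] bl bu sl su] := ps.
have [M M0 hM] := perron_class_bound ps.
have [Lu Lu0 hLu] := perron_class_lipschitz ps.
have UL i y y' : cylinder T y -> cylinder T y' -> `|U i y - U i y'| <= Lu * `|y - y'|.
  have one z z' : cylinder T z -> cylinder T z' -> U i z - U i z' <= Lu * `|z - z'|.
    move=> cz cz'; have [_ h1 _] := perron_supP i ps cz.
    have [h2 _ _] := perron_supP i ps cz'; rewrite lerBlDl; apply: h1 => W cW.
    have := hLu W cW i z z' cz cz'; rewrite ler_norml => /andP[_ h3].
    by have := h2 W cW; move: h3; rewrite -/(U i z'); clear; lra.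
  move=> cy cy'; rewrite ler_norml; apply/andP; split; last exact: one.
  by have := one y' y cy' cy; rewrite distrC; clear; lra.
have [V [pV tV]] : exists V, perron_class T Lam B H u0 C V.
  have [cV _] := candidate_regularization ps (lower_candidate ps); by eexists; exact: cV.
have gU : glued T U.
  move=> i j x' t tT; rewrite /U /perron_sup; congr sup.
  by apply/seteqP; split=> x [W cW ->]; exists W => //; exact: (pc_BUC cW.1).1.
have bU : junction_BUC T U.
  split=> // i; split.
    exists M => y cy; have [h1 h2 _] := perron_supP i ps cy.
    rewrite ler_norml; apply/andP; split.
      apply: le_trans (h1 V (conj pV tV)); have := hM V pV i y cy.
      by rewrite ler_norml => /andP[].
    by apply: h2 => W [pW _]; apply: le_trans (ler_norm _) _; exact: hM.
  move=> e e0; have L1 : 0 < Lu + 1 by rewrite ltr_wpDl.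
  exists (e / (Lu + 1)); first by rewrite divr_gt0.
  move=> y y' cy cy'; rewrite ltr_pdivlMr // => h; apply: le_lt_trans (UL i y y' cy cy') _.
  by apply: le_lt_trans h; rewrite mulrC ler_wpM2l // lerDl.
split=> //.
- apply: jet_sub_stability => // i0 z delta cz d0.
  have [_ _ /(_ delta d0)[W cW hW]] := perron_supP i0 ps cz.
  exists W; split.
  + exact: (pc_BUC cW.1).1.
  + by move=> i; exact: ((pc_BUC cW.1).2 i).2.
  + exact/jet_sub_qjet_sub/(pc_sub cW.1).
  + move=> i y cy; have [h _ _] := perron_supP i ps cy.
    by apply: le_trans (h W cW) _; rewrite lerDl ltW.
  + exact: ltW.
- move=> i y cy; have [h _ _] := perron_supP i ps cy.
  by apply: le_trans (h V (conj pV tV)); exact: (pc_lower pV).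
- move=> i x hx; have cx0 : cylinder T (x, 0) by split=> //=; rewrite lexx ltW.
  have [_ h _] := perron_supP i ps cx0; apply: h => W [pW _]; exact: (pc_initial pW).
Qed.

End Perron.

(** * Paraboloids *)

Section Bump.
Context {R : realType} {d K : nat}.
Implicit Types (g y z : stpoint R d) (W U V : 'I_K -> stpoint R d -> R).
Implicit Types (H : 'I_K -> spoint R d -> R -> spoint R d -> R -> R).
Implicit Types (T Lam B C : R) (f : stpoint R d -> R).

(** If c + ip G (y - z0) - k * sqn (y - z0) is a lower bound of a function touching it
    at z0, this one exceeds the function by rho ^+ 2 / 2 at z0, thanks to the constant,
    but not at distance rho, thanks to k + 1. *)
Definition paraboloid (G z0 : stpoint R d) (c k rho : R) y : R :=
  c + rho ^+ 2 / 2 + quad G z0 (- (k + 1)) y.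

Lemma quad_grad_dist (G z0 : stpoint R d) (k : R) y : 0 <= k ->
  `|quad_grad G z0 (- (k + 1)) y - G| = 2 * (k + 1) * `|y - z0|.
Proof.
move=> k0; rewrite /quad_grad addrAC subrr add0r normrZ mulrN normrN ger0_norm //.
by rewrite mulr_ge0 // addr_ge0.
Qed.

Lemma paraboloid_value (G z0 : stpoint R d) (c k rho : R) y : 0 <= k -> rho <= 1 -> `|y - z0| <= rho ->
  `|paraboloid G z0 c k rho y - c| <= (dimn R d * `|G| + (k + 1) * dimn R d + 1) * rho.
Proof.
move=> k0 r1 yr; have r0 : 0 <= rho by apply: le_trans yr.
have D0 := dimn_gt0 (R := R) (d := d).
have h1 : `|ip G (y - z0)| <= dimn R d * `|G| * rho.
  by apply: le_trans (ip_le _ _) _; rewrite ler_wpM2l // mulr_ge0 // ltW.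
have rr : rho ^+ 2 <= rho by rewrite expr2 ler_piMr.
have h2 : (k + 1) * sqn (y - z0) <= (k + 1) * (dimn R d * rho).
  rewrite ler_wpM2l ?addr_ge0 //; apply: le_trans (sqn_le _) _.
  rewrite ler_wpM2l ?(ltW D0) //; apply: le_trans rr.
  by rewrite ler_sqr ?nnegrE.
have h3 : 0 <= (k + 1) * sqn (y - z0) by rewrite mulr_ge0 ?sqn_ge0 // addr_ge0.
have h4 : 0 <= rho ^+ 2 := sqr_ge0 _.
have -> : paraboloid G z0 c k rho y - c = rho ^+ 2 / 2 + ip G (y - z0) - (k + 1) * sqn (y - z0).
  by rewrite /paraboloid /quad; ring.
have -> : (dimn R d * `|G| + (k + 1) * dimn R d + 1) * rho =
  dimn R d * `|G| * rho + (k + 1) * (dimn R d * rho) + rho by ring.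
move: h1 h2 h3 h4 rr r0; move: (dimn R d * `|G| * rho) ((k + 1) * (dimn R d * rho)) => X Y.
move: (ip _ _) ((k + 1) * sqn _) (rho ^+ 2) => Z S Q; rewrite !ler_norml => /andP[h0 h1]; clear -h0 h1.
by move=> *; apply/andP; split; lra.
Qed.

(** Near z0 the gradient and the value of the paraboloid are close to G and c. *)
Lemma paraboloid_ham T (h : spoint R d -> R -> spoint R d -> R -> R) (G z0 : stpoint R d) (c k : R) :
  unif_continuous_ham T h -> cylinder T z0 -> 0 <= k -> G.2 + h G.1 c z0.1 z0.2 < 0 ->
  exists2 r : R, 0 < r & forall rho, 0 < rho -> rho < r ->
    forall y, cylinder T y -> `|y - z0| < rho ->
    (quad_grad G z0 (- (k + 1)) y).2 +
      h (quad_grad G z0 (- (k + 1)) y).1 (paraboloid G z0 c k rho y) y.1 y.2 < 0.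
Proof.
move=> hu cz k0 hneg; pose e := - (G.2 + h G.1 c z0.1 z0.2) / 2.
have e0 : 0 < e by rewrite divr_gt0 // oppr_gt0.
have [r r0 hr] := ham_continuous G c hu cz e0.
pose q1 := 2 * (k + 1); have q10 : 0 < q1 by rewrite mulr_gt0 // ltr_wpDl.
pose q2 := dimn R d * `|G| + (k + 1) * dimn R d + 1.
have D0 := dimn_gt0 (R := R) (d := d).
have q20 : 0 < q2.
  by rewrite ltr_wpDl // addr_ge0 // mulr_ge0 ?(ltW D0) ?addr_ge0.
have [|m m0 hm] := @pick_small R [:: 1; r; r / q1; r / q2; e / q1].
  by rewrite /= ltr01 r0 (divr_gt0 r0 q10) (divr_gt0 r0 q20) (divr_gt0 e0 q10).
have /and5P[m1 m2 m3 m4 m5] : [&& m < 1, m < r, m < r / q1, m < r / q2 & m < e / q1].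
  by move: hm; rewrite /= andbT.
exists m => // rho rho0 rm y cy yr.
set D := quad_grad G z0 (- (k + 1)) y.
have Dd : `|D - G| < q1 * rho by rewrite quad_grad_dist // ltr_pM2l.
have Dr : `|D - G| < r.
  apply: lt_trans Dd _; rewrite mulrC -ltr_pdivlMr //; exact: lt_trans m3.
have De : `|D - G| < e.
  apply: lt_trans Dd _; rewrite mulrC -ltr_pdivlMr //; exact: lt_trans m5.
have := hr D y (paraboloid G z0 c k rho y) cy.
move=> /(_ (le_lt_trans (norm1_le (D - G)) Dr))/(_ _)/wrap[].
  apply: le_lt_trans (paraboloid_value G c k0 (ltW (lt_trans rm m1)) (ltW yr)) _.
  by rewrite mulrC -ltr_pdivlMr //; exact: lt_trans m4.
move=> /(_ _)/wrap[]; first by apply: lt_trans yr _; exact: lt_trans m2.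
have := le_lt_trans (norm2_le (D - G)) De; rewrite !ltr_norml /= => /andP[_ h1] /andP[_ h2].
move: h1 h2; rewrite /e; clear.
by move: (h _ _ _ _) (h _ _ _ _) => *; lra.
Qed.

Lemma max_dist (a b a' b' e : R) : `|a - a'| < e -> `|b - b'| < e ->
  `|Num.max a b - Num.max a' b'| < e.
Proof.
rewrite !ltr_norml => /andP[h1 h2] /andP[h3 h4].
by case: (leP a b) => ?; case: (leP a' b') => ?; apply/andP; split; lra.
Qed.

Lemma paraboloid_lipschitz (G z0 : stpoint R d) (c k rho : R) : 0 <= k -> 0 < rho ->
  exists2 Lb : R, 0 <= Lb & forall y y', `|y - z0| < 2 * rho -> `|y' - z0| < 2 * rho ->
    `|paraboloid G z0 c k rho y - paraboloid G z0 c k rho y'| <= Lb * `|y - y'|.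
Proof.
move=> k0 rho0; have D0 := dimn_gt0 (R := R) (d := d).
have k1 : 0 <= k + 1 by rewrite addr_ge0.
exists (dimn R d * (`|G| + 2 * (k + 1) * (2 * rho)) + (k + 1) * (dimn R d * (4 * rho))).
  have h := mulr_ge0 k1 (ltW rho0).
  rewrite addr_ge0 // mulr_ge0 ?(ltW D0) //; last by rewrite !mulr_ge0 ?(ltW D0) // ltW.
  by rewrite addr_ge0 // !mulr_ge0 // ltW.
move=> y y' hy hy'.
have -> : paraboloid G z0 c k rho y - paraboloid G z0 c k rho y' =
  ip (quad_grad G z0 (- (k + 1)) y') (y - y') + - (k + 1) * sqn (y - y').
  by have := quad_expand G z0 (- (k + 1)) y' y; rewrite /paraboloid => h; rewrite -h; ring.
apply: le_trans (ler_normD _ _) _; rewrite [leRHS]mulrDl; apply: lerD.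
  apply: le_trans (ip_le _ _) _; rewrite ler_wpM2r // ler_wpM2l ?(ltW D0) //.
  rewrite -[quad_grad _ _ _ _](subrK G) addrC; apply: le_trans (ler_normD _ _) _.
  by rewrite lerD2l quad_grad_dist // ler_wpM2l ?(ltW hy') // mulr_ge0.
rewrite mulNr normrN ger0_norm ?mulr_ge0 ?sqn_ge0 // -mulrA ler_wpM2l //.
apply: le_trans (sqn_le _) _; rewrite -mulrA ler_wpM2l ?(ltW D0) // expr2 ler_wpM2r //.
have -> : y - y' = (y - z0) - (y' - z0) by rewrite opprB addrA subrK.
by apply: le_trans (ler_normB _ _) _; move: hy hy'; clear; lra.
Qed.

(** At an interior point, all spatial directions are admissible and the gradients agree;
    in time, and at the junction in the normal direction, one can only move backwards,
    respectively inwards. *)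
Lemma jet_above_quad T f z g (D : stpoint R d) (C r : R) : cylinder T z -> 0 < z.2 -> 0 <= C -> 0 < r ->
  (forall y, cylinder T y -> `|y - z| < r -> f z + ip D (y - z) - C * sqn (y - z) <= f y) ->
  jet T f z g -> [/\ g.2 <= D.2, g.1.2 <= D.1.2 & z.1.2 < 0 -> g.1 = D.1].
Proof.
move=> cz z0 C0 r0 hf hj; have [zx /andP[_ zT]] := cz.
have key (v : stpoint R d) (s0 : R) : v.2 <= 0 -> 0 < s0 ->
    (forall s : R, 0 < s -> s < s0 -> cylinder T (z + s *: v)) -> ip D v <= ip g v.
  move=> v2 s00 hs; have v1 : 0 < `|v| + 1 by rewrite ltr_wpDl.
  apply: (@jet_direction _ _ T f z g v _ (C * sqn v) (Num.min s0 (r / (`|v| + 1)))) => //.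
  - by rewrite mulr_ge0 // sqn_ge0.
  - by rewrite lt_min s00 divr_gt0.
  move=> s sp; rewrite lt_min ltr_pdivlMr // => /andP[ss sr].
  have cs := hs s sp ss; split=> //.
  have zs : z + s *: v - z = s *: v by rewrite addrAC subrr add0r.
  have := hf _ cs; rewrite zs ipZr sqnZ normrZ gtr0_norm // => /(_ _)/wrap[].
    by apply: le_lt_trans sr; rewrite ler_wpM2l ?(ltW sp) // lerDl.
  by rewrite [C * (s ^+ 2 * _)]mulrCA [s ^+ 2 * _]mulrC.
have cylE (v : stpoint R d) (s : R) : z.1.2 + s * v.1.2 <= 0 ->
    0 <= z.2 + s * v.2 <= T -> cylinder T (z + s *: v) by split.
split.
- have := key (0, -1) z.2; rewrite oppr_le0 ler01 => /(_ isT z0)/(_ _)/wrap[].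
    move=> s s0 sz; apply: cylE; first by rewrite mulr0 addr0.
    rewrite mulrN1 subr_ge0 (ltW sz) /=.
    by apply: le_trans zT; rewrite gerBl ltW.
  by rewrite !(ipC _ (0, -1)) !ip_time !mulN1r lerN2.
- have := key (ed (-1)) 1; rewrite lexx ltr01 => /(_ isT isT)/(_ _)/wrap[].
    move=> s s0 _; apply: cylE; last by rewrite mulr0 addr0 (ltW z0).
    by rewrite mulrN1 subr_le0; apply: le_trans zx _; exact: ltW.
  by rewrite !(ipC _ (ed _)) !ip_ed !mulN1r lerN2.
- move=> zx0; pose v := spart (D - g).
  have n1 : 0 < `|v.1.2| + 1 by rewrite ltr_wpDl.
  have := key v (- z.1.2 / (`|v.1.2| + 1)); rewrite lexx divr_gt0 ?oppr_gt0 // => /(_ isT isT).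
  move=> /(_ _)/wrap[].
    move=> s s0; rewrite ltr_pdivlMr // => hs; apply: cylE; last by rewrite mulr0 addr0 (ltW z0).
    have : s * v.1.2 <= s * (`|v.1.2| + 1).
      by rewrite ler_wpM2l ?(ltW s0) //; apply: le_trans (ler_norm _) _; rewrite lerDl.
    by move: hs; clear; lra.
  rewrite -subr_le0 -ipBl ipC -ip_spart => h1.
  have := le_trans (sqr_norm_le_sqn (spart (D - g))) h1.
  rewrite real_exprn_even_le0 ?num_real //= normr_eq0 => /eqP h2.
  by apply/esym/eqP; rewrite -subr_eq0; apply/eqP; have := congr1 fst h2; rewrite /spart.
Qed.

End Bump.

(** * Increasing a candidate that is not a supersolution *)

Section BumpCandidate.
Context {R : realType} {d K : nat}.
Implicit Types (g y z : stpoint R d) (W U V : 'I_K -> stpoint R d -> R).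
Implicit Types (H : 'I_K -> spoint R d -> R -> spoint R d -> R -> R).
Implicit Types (T Lam B C : R) (f : stpoint R d -> R).

(** A paraboloid below U near z0, touching it at z0 and violating the supersolution
    property there. The branches concerned, act, are one branch if z0 is an interior
    point and all of them if z0 is on the junction. *)
Record failing_paraboloid T B H U z0 (act : pred 'I_K) (G : 'I_K -> stpoint R d) (c k r : R) : Prop :=
  FailingParaboloid {
  fb_cyl : cylinder T z0;
  fb_time : 0 < z0.2;
  fb_k : 0 <= k;
  fb_r : 0 < r;
  fb_act : exists i, act i;
  fb_value : forall i, act i -> U i z0 = c;
  fb_below : forall i, act i -> forall y, cylinder T y -> `|y - z0| < r ->
    c + ip (G i) (y - z0) - k * sqn (y - z0) <= U i y;
  fb_ham : forall i, act i -> (G i).2 + H i (G i).1 c z0.1 z0.2 < 0;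
  fb_junction : (forall y, `|y - z0| < r -> y.1.2 != 0) \/
    [/\ forall i, act i, z0.1.2 = 0 & exists p' (s : 'I_K -> R) a,
       (forall i, G i = tgrad p' (s i) a) /\ \sum_i s i < B] }.

Lemma jet_touching T f f' z g : cylinder T z -> (forall y, cylinder T y -> f y <= f' y) -> f z = f' z ->
  jet T f' z g -> jet T f z g.
Proof.
move=> cz h e hj e' /hj[r r0 hr]; exists r => // y cy yz yr; rewrite e.
exact: le_trans (h y cy) (hr y cy yz yr).
Qed.

Definition bumped (act : pred 'I_K) G z0 (c k rho : R) U : 'I_K -> stpoint R d -> R :=
  fun i y => if act i && (`|y - z0| < rho) then Num.max (U i y) (paraboloid (G i) z0 c k rho y) else U i y.

Lemma bumped_ge (act : pred 'I_K) G z0 (c k rho : R) U i y : U i y <= bumped act G z0 c k rho U i y.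
Proof. by rewrite /bumped; case: ifP => _ //; rewrite le_max lexx. Qed.

Section Bumped.
Variables (T B : R) (H : 'I_K -> spoint R d -> R -> spoint R d -> R -> R).
Variables (U : 'I_K -> stpoint R d -> R) (z0 : stpoint R d) (act : pred 'I_K).
Variables (G : 'I_K -> stpoint R d) (c k r rho : R).
Hypotheses (fb : failing_paraboloid T B H U z0 act G c k r) (rho0 : 0 < rho) (rhor : 2 * rho < r).

Lemma rho_lt_r y : `|y - z0| < rho -> `|y - z0| < r.
Proof. by move=> h; apply: lt_trans h _; apply: lt_trans rhor; rewrite ltr_pMl // ltr1n. Qed.

(** Between the radii rho and 2 * rho the paraboloid is below U. So the two cases of the
    definition agree there, which makes the function continuous. *)
Lemma bumpedE i y : cylinder T y -> act i -> `|y - z0| < 2 * rho ->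
  bumped act G z0 c k rho U i y = Num.max (U i y) (paraboloid (G i) z0 c k rho y).
Proof.
move=> cy ai yr; rewrite /bumped ai /=; case: ltP => // ry.
rewrite max_l //; apply: le_trans (fb_below fb ai cy (lt_trans yr rhor)).
have : rho ^+ 2 <= sqn (y - z0).
  by apply: le_trans (sqr_norm_le_sqn _); rewrite ler_sqr ?nnegrE // ltW.
have := sqr_ge0 rho; rewrite /paraboloid /quad.
move: (rho ^+ 2) (sqn _) (ip _ _) => a b e; rewrite mulNr mulrDl mul1r; move: (k * b) => *; lra.
Qed.

Lemma bumped_out i y : rho <= `|y - z0| -> bumped act G z0 c k rho U i y = U i y.
Proof. by move=> h; rewrite /bumped ltNge h andbF. Qed.

Lemma bumped_glued : glued T U -> glued T (bumped act G z0 c k rho U).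
Proof.
move=> gU i j x' t tT; rewrite /bumped (gU i j) //.
have [h|[aa zx [p' [s [a [hG _]]]]]] := fb_junction fb.
  have [hr|] := ltP `|(((x', 0), t) : stpoint R d) - z0| rho; last by rewrite !andbF.
  by have := h _ (rho_lt_r hr); rewrite /= eqxx.
rewrite !aa; case: ifP => // _; congr Num.max; rewrite /paraboloid; congr (_ + _).
rewrite /quad !hG; congr (_ + _).
by rewrite /ip /dotp /= zx subrr !mulr0.
Qed.

Lemma bumped_BUC : junction_BUC T U -> junction_BUC T (bumped act G z0 c k rho U).
Proof.
move=> [gU bU]; split; first exact: bumped_glued.
move=> i; have [[M hM] uc] := bU i.
have [Lb Lb0 hL] := paraboloid_lipschitz (G i) z0 c (fb_k fb) rho0.
have zz : `|z0 - z0| < 2 * rho by rewrite subrr normr0 mulr_gt0.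
split.
  exists (M + (`|paraboloid (G i) z0 c k rho z0| + Lb * (2 * rho))) => y cy.
  have h0 : 0 <= `|paraboloid (G i) z0 c k rho z0| + Lb * (2 * rho).
    by rewrite addr_ge0 // mulr_ge0 // mulr_ge0 // ltW.
  have [h|h] := ltP `|y - z0| rho; last first.
    by rewrite bumped_out //; apply: le_trans (hM y cy) _; rewrite lerDl.
  have h2 : `|y - z0| < 2 * rho by apply: lt_trans h _; rewrite ltr_pMl // ltr1n.
  rewrite /bumped; case: ifP => _; last by apply: le_trans (hM y cy) _; rewrite lerDl.
  have h3 : `|paraboloid (G i) z0 c k rho y| <= `|paraboloid (G i) z0 c k rho z0| + Lb * (2 * rho).
    rewrite -lerBlDl; apply: le_trans (lerB_dist _ _) _; apply: le_trans (hL _ _ h2 zz) _.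
    by rewrite ler_wpM2l // ltW.
  have M0 : 0 <= M := le_trans (normr_ge0 _) (hM y cy).
  by rewrite maxEle; case: ifP => _; [apply: le_trans h3 _; rewrite lerDr|apply: le_trans (hM y cy) _; rewrite lerDl].
move=> e e0; have [r1 r10 hr1] := uc e e0.
have L1 : 0 < Lb + 1 by rewrite ltr_wpDl.
exists (\big[Num.min/r1]_(x <- [:: rho; e / (Lb + 1)]) x).
  by rewrite !big_cons big_nil !lt_min r10 rho0 divr_gt0.
move=> y y' cy cy'; rewrite !big_cons big_nil !lt_min => /and3P[y1 y2 y3].
have both : act i -> `|y - z0| < 2 * rho -> `|y' - z0| < 2 * rho ->
    `|bumped act G z0 c k rho U i y - bumped act G z0 c k rho U i y'| < e.
  move=> ai hy hy'; rewrite !bumpedE //; apply: max_dist; first exact: hr1.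
  apply: le_lt_trans (hL _ _ hy hy') _; move: y2; rewrite ltr_pdivlMr //.
  by apply: le_lt_trans; rewrite mulrC ler_wpM2l // lerDl.
have [ai|nai] := boolP (act i); last first.
  by rewrite /bumped (negbTE nai) /=; exact: hr1.
have near (a b : stpoint R d) : `|a - b| < rho -> `|b - z0| < rho -> `|a - z0| < 2 * rho.
  move=> h1 h2; rewrite -(subrKA b); apply: le_lt_trans (ler_normD _ _) _.
  by move: h1 h2; move: `|_| `|_| rho => *; lra.
have self (a : stpoint R d) : `|a - z0| < rho -> `|a - z0| < 2 * rho.
  by move=> h; apply: lt_trans h _; rewrite ltr_pMl // ltr1n.
have [hy|hy] := ltP `|y - z0| rho.
  by apply: both => //; [exact: self|apply: (near _ y) => //; rewrite distrC].
have [hy'|hy'] := ltP `|y' - z0| rho.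
  by apply: both => //; [exact: (near _ y')|exact: self].
by rewrite !bumped_out //; exact: hr1.
Qed.

(** Where the bumped function is equal to U its jets are jets of U. Where it is equal to
    a paraboloid its jets are those of a smooth strict subsolution; on the junction,
    normal slopes are then at most those of the paraboloids, whose sum is less than B. *)
Lemma bumped_jet_sub : glued T U -> jet_sub T 0 B H U ->
  (forall i, act i -> forall y, cylinder T y -> `|y - z0| < rho ->
    (quad_grad (G i) z0 (- (k + 1)) y).2 + H i (quad_grad (G i) z0 (- (k + 1)) y).1
      (paraboloid (G i) z0 c k rho y) y.1 y.2 < 0) ->
  jet_sub T 0 B H (bumped act G z0 c k rho U).
Proof.
move=> gU [su1 su2] hham; set W := bumped act G z0 c k rho U.
have UW i y : U i y <= W i y := bumped_ge act G z0 c k rho U i y.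
have cyl z : z.1.2 <= 0 -> 0 < z.2 <= T -> cylinder T z.
  by move=> zx /andP[h1 h2]; split=> //; rewrite (ltW h1).
have k1 : 0 <= k + 1 by rewrite addr_ge0 // (fb_k fb).
have up i z g : cylinder T z -> 0 < z.2 -> W i z != U i z -> jet T (W i) z g ->
    [/\ act i, `|z - z0| < rho, W i z = paraboloid (G i) z0 c k rho z &
      let D := quad_grad (G i) z0 (- (k + 1)) z in
      [/\ g.2 <= D.2, g.1.2 <= D.1.2 & z.1.2 < 0 -> g.1 = D.1]].
  move=> cz zt; rewrite /W {1}/bumped; case: ifP => [/andP[ai zr]|_]; last by rewrite eqxx.
  move=> hne hj; have e : W i z = paraboloid (G i) z0 c k rho z.
    rewrite /W /bumped ai zr /=; case: leP hne => //; by rewrite eqxx.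
  split=> //; set D := quad_grad _ _ _ _.
  apply: (@jet_above_quad _ _ T (W i) z g D (k + 1) (rho - `|z - z0|)) => //.
    by rewrite subr_gt0.
  move=> y cy yr; have yr' : `|y - z0| < rho.
    rewrite -(subrKA z); apply: le_lt_trans (ler_normD _ _) _.
    by move: yr; move: `|_| `|_| rho => *; lra.
  rewrite e /W /bumped ai yr' /= le_max; apply/orP; right.
  have := quad_expand (G i) z0 (- (k + 1)) z y; rewrite /paraboloid -/D mulNr.
  by move: (quad _ _ _ _) (quad _ _ _ _) (ip _ _) (sqn _) (rho ^+ 2) => *; lra.
split=> [i z g zx zt hj|z p' s a zx zt hj].
  have cz := cyl z (ltW zx) zt; have [e|ne] := eqVneq (W i z) (U i z).
    rewrite e; apply: su1 => //; apply: jet_touching hj => //; by [].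
  have /andP[z00 _] := zt.
  have [ai zr eW [h1 _ h2]] := up i z g cz z00 ne hj.
  rewrite /ham_at eW h2 //; apply: le_trans (ltW (hham i ai z cz zr)).
  by rewrite lerD2r.
have cz : cylinder T z by apply: cyl => //; rewrite zx.
have /andP[z00 _] := zt.
have gW := bumped_glued gU.
have [allne|[i0 e0]] : (forall i, W i z != U i z) \/ exists i0, W i0 z = U i0 z.
  have [h|h] := pselect (exists i0, W i0 z = U i0 z); first by right.
  by left=> i; apply/eqP => e; apply: h; exists i.
- left; have [i0 ai0] := fb_act fb.
  have [_ zr0 _ _] := up i0 z _ cz z00 (allne i0) (hj i0).
  have [h|[aa z0x [q [s0 [b [hG hs]]]]]] := fb_junction fb.
    by have := h z (rho_lt_r zr0); rewrite zx eqxx.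
  apply: le_trans (ltW hs); apply: ler_sum => i _.
  have [_ _ _ [_ h _]] := up i z _ cz z00 (allne i) (hj i).
  move: h; rewrite hG /quad_grad /= zx z0x subrr -[_ *: (0 : R)]/(_ * 0) mulr0 addr0.
  by [].
- have e i : W i z = U i z by rewrite (glued_eq i i0 gW cz zx : W i z = W i0 z) e0; exact: (glued_eq i0 i gU cz zx).
  have [|hB|[i hi]] := su2 z p' s a zx zt; last by right; exists i; rewrite e.
    move=> i; apply: jet_touching (hj i) => //; by [].
  by left.
Qed.

End Bumped.

(** For small rho the ball stays away from time 0, so the initial values are unchanged. *)
Lemma bump_candidate T Lam B H u0 C U z0 (act : pred 'I_K) G (c k r : R) :
  perron_setting T Lam B H u0 C -> perron_candidate T Lam B H u0 C U ->
  failing_paraboloid T B H U z0 act G c k r ->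
  exists2 W, perron_candidate T Lam B H u0 C W & exists i, U i z0 < W i z0.
Proof.
move=> ps [bU sU lU iU] fb; have [T0 C0 [K0 _ Lam0 hco hun hli] _ _ _ _] := ps.
have [r1 r10 hr1] := @common_radius R K (fun i rho => act i ->
    forall y, cylinder T y -> `|y - z0| < rho ->
    (quad_grad (G i) z0 (- (k + 1)) y).2 + H i (quad_grad (G i) z0 (- (k + 1)) y).1
      (paraboloid (G i) z0 c k rho y) y.1 y.2 < 0) (fun i =>
  match boolP (act i) with
  | AltTrue ai => let: ex_intro2 r r0 hr := paraboloid_ham (hun i) (fb_cyl fb) (fb_k fb) (fb_ham fb ai) in
       ex_intro2 _ _ r r0 (fun s s0 sr _ => hr s s0 sr)
  | AltFalse nai => ex_intro2 _ _ 1 ltr01 (fun s _ _ ai => False_ind _ (negP nai ai))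
  end).
have [|rho rho0 /and4P[m1 m2 m3 _]] := @pick_small R [:: r1; r / 2; z0.2].
  by rewrite /= r10 (fb_time fb) divr_gt0 ?(fb_r fb).
have rhor : 2 * rho < r by rewrite mulrC -ltr_pdivlMr.
exists (bumped act G z0 c k rho U).
  split.
  - exact: (bumped_BUC fb).
  - apply: (bumped_jet_sub fb) => //; first exact: bU.1.
    by move=> i ai; exact: hr1.
  - by move=> i y cy; apply: le_trans (lU i y cy) (bumped_ge _ _ _ _ _ _ _ _ _).
  - move=> i x hx; rewrite bumped_out; first exact: iU.
    apply: le_trans (ltW m3) _; apply: le_trans (norm2_le ((x, 0) - z0)).
    by rewrite /= sub0r normrN ler_norm.
have [i ai] := fb_act fb; exists i.
rewrite /bumped ai subrr normr0 rho0 /= lt_max; apply/orP; right.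
rewrite (fb_value fb ai) /paraboloid /quad subrr ip0r sqn0 mulr0 !addr0 ltrDl.
by rewrite divr_gt0 // exprn_gt0.
Qed.

End BumpCandidate.

(** * Solutions with Lipschitz initial data *)

Section Existence.
Context {R : realType} {d K : nat}.
Implicit Types (g y z : stpoint R d) (W U V : 'I_K -> stpoint R d -> R).
Implicit Types (H : 'I_K -> spoint R d -> R -> spoint R d -> R -> R).
Implicit Types (T Lam B C : R) (f : stpoint R d -> R).

(** If U had a quadratic jet from below violating the supersolution property,
    bump_candidate would produce a candidate exceeding U. *)
Lemma perron_super T Lam B H u0 C U : perron_setting T Lam B H u0 C ->
  perron_candidate T Lam B H u0 C U ->
  (forall W, perron_candidate T Lam B H u0 C W -> forall i y, cylinder T y -> W i y <= U i y) ->
  dual_jet_sub T B H U.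
Proof.
move=> ps pc hmax; have [T0 C0 [K0 _ Lam0 hco hun hli] _ _ _ _] := ps.
have nofail z0 act G c k r : ~ failing_paraboloid T B H U z0 act G c k r.
  move=> fb; have [W pW [i]] := bump_candidate ps pc fb.
  by rewrite ltNge => /negP; apply; apply: hmax => //; exact: fb_cyl fb.
have cyl z : z.1.2 <= 0 -> 0 < z.2 <= T -> cylinder T z.
  by move=> zx /andP[h1 h2]; split=> //; rewrite (ltW h1).
have below (f : stpoint R d -> R) g z (c k : R) y : - f y <= - f z + ip g (y - z) + c * sqn (y - z) -> c <= k ->
    f z + ip (- g) (y - z) - k * sqn (y - z) <= f y.
  move=> h ck; have : c * sqn (y - z) <= k * sqn (y - z) by rewrite ler_wpM2r // sqn_ge0.
  by move: h; rewrite ipNl; clear; move: (f y) (f z) (ip _ _) (c * _) (k * _) => *; lra.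
apply: qjet_sub_jet_sub => //; [by move=> i; exact: dual_ham_unif|exact: junction_BUCN (pc_BUC pc)|].
split=> [i z g zx zt [Cq [r r0 hr]]|z p' s a zx zt hj].
  rewrite leNgt; apply/negP => hpos.
  apply: (nofail z (pred1 i) (fun=> - g) (U i z) `|Cq| (Num.min r (- z.1.2))); split=> //.
  - exact: cyl (ltW zx) zt.
  - by case/andP: zt.
  - by rewrite lt_min r0 oppr_gt0.
  - by exists i => /=.
  - by move=> j /eqP ->.
  - move=> j /eqP -> y cy; rewrite lt_min => /andP[yr _].
    by apply: below (ler_norm Cq); exact: hr.
  - move=> j /eqP ->; move: hpos; rewrite /ham_at /dual_ham opprK /=.
    by clear; move: (H i _ _ _ _) => *; lra.
  - left=> y; rewrite lt_min => /andP[_ yr]; rewrite lt_eqF //.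
    have := le_lt_trans (norm12_le (y - z)) yr; rewrite ltr_norml => /andP[_].
    by rewrite -[(y - z).1.2]/(y.1.2 - z.1.2); clear; lra.
have cz : cylinder T z by apply: cyl => //; rewrite zx.
apply: contrapT => /not_orP[/negP hB /forallNP hH]; rewrite -ltNge in hB.
pose g i := tgrad p' (s i) a.
have [k k0 hk] : exists2 k : R, 0 <= k & forall i, exists2 r : R, 0 < r &
    forall y, cylinder T y -> `|y - z| < r ->
      - U i y <= - U i z + ip (g i) (y - z) + k * sqn (y - z).
  apply: (common_bound (P := fun i (k : R) => exists2 r : R, 0 < r &
    forall y, cylinder T y -> `|y - z| < r ->
      - U i y <= - U i z + ip (g i) (y - z) + k * sqn (y - z))); first exact: hj.
  move=> i c c' cc' [r r0 hr]; exists r => // y cy yr; apply: le_trans (hr y cy yr) _.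
  by rewrite lerD2l ler_wpM2r // sqn_ge0.
have [r r0 hr] := @common_radius R K (fun i r => forall y, cylinder T y -> `|y - z| < r ->
      - U i y <= - U i z + ip (g i) (y - z) + k * sqn (y - z)) (fun i =>
  let: ex_intro2 r r0 hr := hk i in
  ex_intro2 _ _ r r0 (fun s s0 sr y cy yr => hr y cy (lt_trans yr sr))).
have r2 : r / 2 < r by rewrite ltr_pdivrMr // ltr_pMr // ltr1n.
have r20 : 0 < r / 2 by rewrite divr_gt0.
pose i0 := Ordinal K0.
have Uz i : U i z = U i0 z := glued_eq i i0 (pc_BUC pc).1 cz zx.
apply: (nofail z predT (fun i => - g i) (U i0 z) k (r / 2)); split=> //.
- by case/andP: zt.
- by exists i0.
- by move=> i _ y cy yr; rewrite -(Uz i); apply: below (lexx k); exact: (hr i (r / 2)).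
- move=> i _; have /negP := hH i; rewrite -ltNge /ham_at /dual_ham opprK /= Uz.
  by clear; move: (H i _ _ _ _) => *; lra.
- right; split=> //; exists (- p'), (fun i => - s i), (- a); split=> //.
  by rewrite sumrN ltrNl.
Qed.

Lemma lipschitz_unif_continuous (V : normedModType R) (D : set V) (f : V -> R) (L : R) :
  0 <= L -> (forall y y' : V, D y -> D y' -> `|f y - f y'| <= L * `|y - y'|) ->
  unif_continuous_on D f.
Proof.
move=> L0 h e e0; have L1 : 0 < L + 1 by rewrite ltr_wpDl.
exists (e / (L + 1)); first by rewrite divr_gt0.
move=> y y' cy cy'; rewrite ltr_pdivlMr // => yy; apply: le_lt_trans (h y y' cy cy') _.
by apply: le_lt_trans yy; rewrite mulrC ler_wpM2l // lerDl.
Qed.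

Lemma lower_upper_barrier Lam C (u0 : 'I_K -> spoint R d -> R) :
  lower_barrier Lam C u0 = upper_barrier Lam (- C) u0.
Proof.
apply/funext => i; apply/funext => w.
by rewrite /lower_barrier /upper_barrier /barrier_growth mulNr.
Qed.

(** The sign of C is arbitrary, which covers the two barriers. *)
Lemma barrier_BUC T Lam C (L M : R) (u0 : 'I_K -> spoint R d -> R) : 0 <= T -> 0 <= Lam -> 0 <= L ->
  glued0 u0 -> lipschitz_datum L u0 -> (forall i x, half_space x -> `|u0 i x| <= M) ->
  junction_BUC T (upper_barrier Lam C u0).
Proof.
move=> T0 Lam0 L0 gu hL hM; pose lam := 2 * Lam + 1.
have l0 : 0 <= lam by rewrite addr_ge0 // mulr_ge0.
(* a Lipschitz constant of barrier_growth on the time interval *)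
pose Q := `|C| * (lam * gauge lam T).
have Q0 : 0 <= Q by rewrite mulr_ge0 // mulr_ge0 // ltW // gauge_gt0.
have gr s t : 0 <= s <= T -> 0 <= t <= T ->
    `|barrier_growth Lam C s - barrier_growth Lam C t| <= Q * `|s - t|.
  have one a b : a <= b -> b <= T ->
      `|barrier_growth Lam C b - barrier_growth Lam C a| <= Q * `|b - a|.
    move=> ab bT; rewrite /barrier_growth -mulrBr opprB addrA subrK normrM /Q -mulrA.
    rewrite ler_wpM2l // !ger0_norm ?subr_ge0 ?gauge_le //; exact: gauge_lip.
  move=> /andP[_ sT] /andP[_ tT]; have [st|ts] := leP s t; last by apply: one; rewrite // ltW.
  by rewrite distrC [`|s - t|]distrC; exact: one.
have Lip i y y' : cylinder T y -> cylinder T y' ->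
    `|upper_barrier Lam C u0 i y - upper_barrier Lam C u0 i y'| <= (L + Q) * `|y - y'|.
  move=> [yx yt] [yx' yt']; rewrite /upper_barrier opprD addrACA.
  apply: le_trans (ler_normD _ _) _; rewrite mulrDl; apply: lerD.
    by apply: le_trans (hL i _ _ yx yx') _; rewrite ler_wpM2l // (norm1_le (y - y')).
  by apply: le_trans (gr _ _ yt yt') _; rewrite ler_wpM2l // (norm2_le (y - y')).
split=> [i j x' t _|i]; first by rewrite /upper_barrier /= (gu i j).
split; last by apply: lipschitz_unif_continuous (Lip i); rewrite addr_ge0.
exists (M + Q * T) => y [yx yt]; apply: le_trans (ler_normD _ _) _; apply: lerD; first exact: hM.
have := gr y.2 0 yt; rewrite lexx T0 barrier_growth0 !subr0 => /(_ isT) /le_trans; apply.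
by rewrite ler_wpM2l //; case/andP: yt => t0 tT; rewrite ger0_norm.
Qed.

Definition well_posed_datum T B H (u0 : 'I_K -> spoint R d -> R) U :=
  [/\ junction_BUC T U, jet_sub T 0 B H U, dual_jet_sub T B H U &
      forall i x, half_space x -> U i (x, 0) = u0 i x].

Lemma solve_lipschitz T Lam B H (L M : R) (u0 : 'I_K -> spoint R d -> R) : 0 < T ->
  admissible T Lam H -> (forall i, bounded_ham T (H i)) -> 0 <= L -> 0 <= M ->
  glued0 u0 -> lipschitz_datum L u0 -> (forall i x, half_space x -> `|u0 i x| <= M) ->
  exists U, well_posed_datum T B H u0 U.
Proof.
move=> T0 adm hb L0 M0 gu hL hM; have [K0 T0' Lam0 hco hun hli] := adm.
pose Mb := L + `|B| + M.
have [C C0 hC] := common_bound (P := fun i C => forall q, ham_domain T Mb q -> `|uncurry_ham (H i) q| <= C)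
  (fun i => hb i Mb) (fun i C C' CC' h q Dq => le_trans (h q Dq) CC').
have dom (p : spoint R d) (c : R) (x : spoint R d) (t : R) : `|p| <= L + `|B| -> `|c| <= M -> cylinder T (x, t) -> @ham_domain R d T Mb ((p, c), (x, t)).
  move=> hp hc cx; split=> //=; rewrite /Mb.
    by apply: le_trans hp _; rewrite lerDl.
  by apply: le_trans hc _; rewrite lerDr addr_ge0.
have bar D := @barrier_BUC T Lam D L M u0 T0' Lam0 L0 gu hL hM.
have ps : perron_setting T Lam B H u0 C.
  split=> //.
  - by rewrite lower_upper_barrier.
  - apply: (@barrier_jet_sub _ _ _ T Lam L C B H u0) => // i p x t cx hp.
    have := hC i _ (dom p (u0 i x) x t hp (hM i x cx.1) cx).
    by apply: le_trans; exact: ler_norm.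
  - have e : (fun i w => - upper_barrier Lam C u0 i w) = lower_barrier Lam C (fun i x => - u0 i x).
      by apply/funext => i; apply/funext => w; rewrite /upper_barrier /lower_barrier opprD.
    rewrite /dual_jet_sub e; apply: (@barrier_jet_sub _ _ _ T Lam L C (- B)) => //.
    + move=> i p b c x s t cs ct; rewrite /dual_ham opprK addrC.
      have := hli i (- p) (- b) (- c) x s t cs ct; rewrite distrC opprK.
      by rewrite addrC [- b + c]addrC distrC.
    + by move=> i x y hx hy; rewrite -opprD normrN; exact: hL.
    + move=> i p x t cx; rewrite normrN => hp; rewrite /dual_ham opprK.
      have hp' : `|- p| <= L + `|B| by rewrite normrN.
      have := hC i _ (dom (- p) (u0 i x) x t hp' (hM i x cx.1) cx).
      by apply: le_trans; rewrite -normrN; exact: ler_norm.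
have [U pU hmax] := perron_max ps; exists U; split.
- exact: pc_BUC pU.
- exact: pc_sub pU.
- exact: perron_super ps pU hmax.
- move=> i x hx; apply/eqP; rewrite eq_le (pc_initial pU i hx) /=.
  have cx0 : cylinder T (x, 0) by split=> //=; rewrite lexx.
  by have := pc_lower pU i cx0; rewrite /lower_barrier barrier_growth0 subr0.
Qed.

End Existence.

(** * Approximation of the initial data *)

Section Approximation.
Context {R : realType} {d K : nat}.
Implicit Types (x y z : spoint R d) (i j : 'I_K).

(** Paths between different branches go through the junction. *)
Definition junction_dist i x j y : R :=
  `|x.1 - y.1| + (if i == j then `|x.2 - y.2| else `|x.2| + `|y.2|).

Lemma junction_dist_ge0 i x j y : 0 <= junction_dist i x j y.
Proof. by rewrite /junction_dist; case: ifP => _; rewrite !addr_ge0. Qed.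

Lemma junction_dist_self i x : junction_dist i x i x = 0.
Proof. by rewrite /junction_dist eqxx !subrr !normr0 addr0. Qed.

Lemma junction_dist_lip i x x' j y : junction_dist i x j y <= junction_dist i x' j y + 2 * `|x - x'|.
Proof.
have [n1 n2] : `|x.1 - x'.1| <= `|x - x'| /\ `|x.2 - x'.2| <= `|x - x'|.
  by rewrite -[leRHS]/(Num.max `|x.1 - x'.1| `|x.2 - x'.2|) !le_max !lexx orbT.
have h1 : `|x.1 - y.1| <= `|x'.1 - y.1| + `|x - x'|.
  rewrite (_ : x.1 - y.1 = x'.1 - y.1 + (x.1 - x'.1)); last by rewrite [RHS]addrC subrKA.
  by apply: le_trans (ler_normD _ _) _; rewrite lerD2l.
have h2 : `|x.2 - y.2| <= `|x'.2 - y.2| + `|x - x'|.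
  rewrite (_ : x.2 - y.2 = x'.2 - y.2 + (x.2 - x'.2)); last by rewrite [RHS]addrC subrKA.
  by apply: le_trans (ler_normD _ _) _; rewrite lerD2l.
have h3 : `|x.2| <= `|x'.2| + `|x - x'|.
  rewrite (_ : x.2 = x'.2 + (x.2 - x'.2)); last by rewrite [RHS]addrC subrK.
  by apply: le_trans (ler_normD _ _) _; rewrite lerD2l.
rewrite /junction_dist; case: ifP => _; move: h1 h2 h3; clear.
  by move: `|_ - _| `|_ - _| `|_ - _| `|_ - _| `|_ - _| => *; lra.
by move: `|_ - _| `|_ - _| `|x.2| `|x'.2| `|y.2| => *; lra.
Qed.

(** Uniform continuity on each branch gives uniform continuity on the junction, through
    the projections on the junction of points of different branches. *)
Lemma datum_modulus (u0 : 'I_K -> spoint R d -> R) (e : R) : glued0 u0 ->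
  (forall i, unif_continuous_on half_space (u0 i)) -> 0 < e ->
  exists2 r : R, 0 < r & forall i x j y, half_space x -> half_space y ->
    junction_dist i x j y < r -> u0 j y <= u0 i x + e.
Proof.
move=> gu uu e0; have e2 : 0 < e / 2 by rewrite divr_gt0.
have [r r0 hr] := @common_radius R K (fun i r => forall x y, half_space x -> half_space y ->
   `|x - y| < r -> `|u0 i x - u0 i y| < e / 2) (fun i =>
  let: ex_intro2 r r0 hr := uu i _ e2 in
  ex_intro2 _ _ r r0 (fun s s0 sr x y hx hy xy => hr x y hx hy (lt_trans xy sr))).
have r2 : r / 2 < r by rewrite ltr_pdivrMr // ltr_pMr // ltr1n.
have r20 : 0 < r / 2 by rewrite divr_gt0.
have {}hr i := hr i _ r20 r2.
have spn (x y : spoint R d) (s : R) : `|x.1 - y.1| < s -> `|x.2 - y.2| < s -> `|x - y| < s.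
  by move=> h1 h2; rewrite -[ltLHS]/(Num.max `|x.1 - y.1| `|x.2 - y.2|) gt_max h1.
exists (r / 2) => // i x j y hx hy; rewrite /junction_dist.
have n1 := normr_ge0 (x.1 - y.1); case: ifP => [/eqP <- h|_ h].
  have n2 := normr_ge0 (x.2 - y.2).
  have := hr i x y hx hy; rewrite ltr_norml => /(_ _)/wrap[].
    by apply: spn; move: h n1 n2; clear; move: `|_| `|_| => *; lra.
  by move=> /andP[h1 _]; move: h1 e0; clear; lra.
have nx := normr_ge0 x.2; have ny := normr_ge0 y.2.
have h0 : half_space (y.1, 0 : R) by rewrite /half_space /=.
have := hr i x (y.1, 0) hx h0; rewrite ltr_norml => /(_ _)/wrap[].
  by apply: spn; rewrite /= ?subr0; move: h n1 nx ny; clear; move: `|_| `|_| `|_| => *; lra.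
move=> /andP[h1 _].
have := hr j y (y.1, 0) hy h0; rewrite ltr_norml => /(_ _)/wrap[].
  apply: spn; rewrite /= ?subr0 ?subrr ?normr0 //.
  by move: h n1 nx ny; clear; move: `|_| `|_| `|_| => *; lra.
move=> /andP[_ h2]; move: h1 h2; rewrite (gu i j) ; clear; lra.
Qed.

(** Sup-convolution with the distance junction_dist: it is Lipschitz since the distance
    is, it is glued since the distance from a point of the junction does not depend on
    the branch to which this point is attached, and it is close to u0 as N is large
    compared with the oscillation of u0. *)
Lemma approx_datum (u0 : 'I_K -> spoint R d -> R) (e : R) : junction_BUC0 u0 -> 0 < e ->
  exists (u1 : 'I_K -> spoint R d -> R) (L M : R), [/\ 0 <= L, 0 <= M, glued0 u1, lipschitz_datum L u1 &
    forall i x, half_space x -> [/\ `|u1 i x| <= M, u0 i x <= u1 i x & u1 i x <= u0 i x + e]].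
Proof.
move=> [gu bu] e0.
have [M M0 hM] := common_bound (P := fun i M => forall x, half_space x -> `|u0 i x| <= M)
  (fun i => (bu i).1) (fun i C C' CC' h x hx => le_trans (h x hx) CC').
have [r r0 hr] := datum_modulus gu (fun i => (bu i).2) e0.
have [N N0 NE] : exists2 N : R, 0 <= N & N * r = 2 * M.
  by exists (2 * M / r); [rewrite divr_ge0 ?(ltW r0) // mulr_ge0|rewrite divfK // gt_eqF].
pose S i x := [set a : R | exists j y, half_space y /\ a = u0 j y - N * junction_dist i x j y].
pose u1 i x := sup (S i x).
have le1 i x j y : half_space x -> half_space y -> u0 j y - N * junction_dist i x j y <= u0 i x + e.
  move=> hx hy; have J0 := junction_dist_ge0 i x j y; have [h|h] := ltP (junction_dist i x j y) r.
    by apply: le_trans (hr i x j y hx hy h); rewrite gerBl mulr_ge0.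
  have : 2 * M <= N * junction_dist i x j y.
    by apply: (@le_trans _ _ (N * r)); [rewrite NE|rewrite ler_wpM2l].
  have := hM i x hx; have := hM j y hy; rewrite !ler_norml => /andP[_ h1] /andP[h2 _].
  by move: h1 h2 e0; clear; move: (N * _) => X; lra.
have S0 i x : half_space x -> S i x (u0 i x).
  by move=> hx; exists i, x; split=> //; rewrite junction_dist_self mulr0 subr0.
have lb i x j y : half_space x -> half_space y -> u0 j y - N * junction_dist i x j y <= u1 i x.
  move=> hx hy; apply: ub_le_sup; last by exists j, y.
  by exists (u0 i x + e) => _ [j' [y' [hy' ->]]]; exact: le1.
have ub i x b : half_space x ->
    (forall j y, half_space y -> u0 j y - N * junction_dist i x j y <= b) -> u1 i x <= b.
  move=> hx h; apply: ge_sup; first by exists (u0 i x); exact: S0.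
  by move=> _ [j [y [hy ->]]]; exact: h.
have bnd i x : half_space x -> u0 i x <= u1 i x <= u0 i x + e.
  move=> hx; apply/andP; split; last by apply: ub => // j y hy; exact: le1.
  by apply: le_trans (lb i x i x hx hx); rewrite junction_dist_self mulr0 subr0.
exists u1, (N * 2), (M + e); split.
- by rewrite mulr_ge0.
- by rewrite addr_ge0 // ltW.
- move=> i j x'; rewrite /u1 /S; congr sup; apply/seteqP.
  have J i1 i2 k y : junction_dist i1 (x', 0) k y = junction_dist i2 (x', 0) k y.
    rewrite /junction_dist /= sub0r normrN normr0 add0r; by do 2 case: ifP.
  by split=> a [k [y [hy ->]]]; exists k, y; rewrite (J i j).
- move=> i x y hx hy.
  have one a b : half_space a -> half_space b -> u1 i a - u1 i b <= N * 2 * `|a - b|.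
    move=> ha hb; rewrite lerBlDl; apply: ub => // j y' hy'.
    have h := lb i b j y' hb hy'; have := junction_dist_lip i b a j y'.
    move=> /(ler_wpM2l N0); rewrite (mulrDr N (junction_dist i a j y')) [N * (2 * _)]mulrA (distrC b a); move: h; clear.
    by move: (N * junction_dist _ _ _ _) (N * junction_dist _ _ _ _) (N * 2 * _) => *; lra.
  rewrite ler_norml; apply/andP; split; last exact: one.
  by have := one y x hy hx; rewrite distrC; clear; lra.
- move=> i x hx; have /andP[h1 h2] := bnd i x hx; split=> //.
  have := hM i x hx; rewrite !ler_norml => /andP[h3 h4].
  by apply/andP; split; move: h1 h2 h3 h4 e0; clear; lra.
Qed.

End Approximation.

Section Limit.
Context {R : realType} {d K : nat}.
Implicit Types (y z : stpoint R d) (u U V : 'I_K -> stpoint R d -> R).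
Implicit Types (H : 'I_K -> spoint R d -> R -> spoint R d -> R -> R).

Lemma uniform_limit_BUC (T : R) u : glued T u ->
  (forall e : R, 0 < e -> exists2 V, junction_BUC T V &
    forall i y, cylinder T y -> `|u i y - V i y| <= e) ->
  junction_BUC T u.
Proof.
move=> gu h; split=> // i; split.
  have [V [_ bV] hV] := h 1 ltr01; have [M hM] := (bV i).1.
  exists (1 + M) => y cy; rewrite -[u i y](subrK (V i y)); apply: le_trans (ler_normD _ _) _.
  by apply: lerD; [exact: hV|exact: hM].
move=> e e0; have e3 : 0 < e / 3 by rewrite divr_gt0.
have [V [_ bV] hV] := h _ e3; have [r r0 hr] := (bV i).2 _ e3.
exists r => // y y' cy cy' yy; have h1 := hr y y' cy cy' yy.
have h2 := hV i y cy; have h3 := hV i y' cy'.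
move: h1 h2 h3; rewrite !ler_norml !ltr_norml => /andP[a1 a2] /andP[a3 a4] /andP[a5 a6].
by apply/andP; split; move: a1 a2 a3 a4 a5 a6; clear; lra.
Qed.

(** A special case of stability. *)
Lemma uniform_limit_jet_sub (T B : R) H u : (0 < K)%N -> (forall i, unif_continuous_ham T (H i)) ->
  glued T u ->
  (forall e : R, 0 < e -> exists2 V, junction_BUC T V /\ jet_sub T 0 B H V &
    forall i y, cylinder T y -> `|u i y - V i y| <= e) ->
  jet_sub T 0 B H u.
Proof.
move=> K0 hun gu h; apply: jet_sub_stability => // i0 z delta cz d0.
have [V [[gV bV] sV] hV] := h _ d0; exists V; split=> //.
- by move=> i; exact: (bV i).2.
- exact: jet_sub_qjet_sub.
- by move=> i y cy; have := hV i y cy; rewrite ler_norml => /andP[h1 _]; move: h1; clear; lra.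
- by have := hV i0 z cz; rewrite ler_norml => /andP[_ h1]; move: h1; clear; lra.
Qed.

(** The solutions V for approximate data within e of u0 differ by at most e * G by
    comparison. Hence u, the infimum of the functions V + e * G, is within e * G of each
    V. *)
Lemma existence (T Lam B : R) H (u0 : 'I_K -> spoint R d -> R) : 0 < T -> admissible T Lam H ->
  (forall i, bounded_ham T (H i)) -> junction_BUC0 u0 ->
  exists U, well_posed_datum T B H u0 U.
Proof.
move=> T0 adm hb bu; have [K0 T0' Lam0 hco hun hli] := adm.
have /boolp.choice[F hF] : forall e : R, exists V : 'I_K -> stpoint R d -> R, 0 < e ->
    [/\ junction_BUC T V, jet_sub T 0 B H V, dual_jet_sub T B H V &
     forall i x, half_space x -> u0 i x <= V i (x, 0) <= u0 i x + e].
  move=> e; have [e0|] := boolP (0 < e); last by exists (fun _ _ => 0).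
  have [u1 [L [M [L0 M0 gu1 hL h1]]]] := approx_datum bu e0.
  have [|V [bV sV dV iV]] := solve_lipschitz B T0 adm hb L0 M0 gu1 hL.
    by move=> i x hx; have [] := h1 i x hx.
  exists V => _; split=> // i x hx; rewrite iV //; have [_ -> ->] := h1 i x hx; by [].
pose G := gauge (2 * Lam + 1) T; have G0 : 0 < G := gauge_gt0 _ _.
have cmp e e' i y : 0 < e -> 0 < e' -> cylinder T y -> F e i y <= F e' i y + e * G.
  move=> e0 e'0 cy; have [bU sU _ iU] := hF e e0; have [bV _ dV iV] := hF e' e'0.
  apply: le_trans (comparison adm (ltW e0) bU bV sU dV _ i cy) _.
    move=> j x hx; have /andP[_ h1] := iU j x hx; have /andP[h2 _] := iV j x hx.
    by apply: le_trans h1 _; rewrite lerD2r.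
  rewrite lerD2l ler_wpM2l ?(ltW e0) // gauge_le //; first by rewrite addr_ge0 // mulr_ge0.
  by case: cy => _ /andP[].
pose S i y := [set a : R | exists2 e : R, 0 < e & a = F e i y + e * G].
pose u i y := inf (S i y).
have close e i y : 0 < e -> cylinder T y -> `|u i y - F e i y| <= e * G.
  move=> e0 cy; have lbS : lbound (S i y) (F e i y - e * G).
    move=> _ [e' e'0 ->]; have := cmp e e' i y e0 e'0 cy.
    have : 0 <= e' * G by rewrite mulr_ge0 // ltW.
    by clear; move: (e * G) (e' * G) => *; lra.
  have h1 : u i y <= F e i y + e * G by apply: ge_inf; [exists (F e i y - e * G)|exists e].
  have h2 : F e i y - e * G <= u i y.
    by apply: lb_le_inf => //; exists (F e i y + e * G), e.
  by rewrite ler_norml; apply/andP; split; move: h1 h2; clear; lra.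
have approx (e : R) : 0 < e -> exists2 e' : R, 0 < e' & forall i y, cylinder T y -> `|u i y - F e' i y| <= e.
  move=> e0; exists (e / G); first by rewrite divr_gt0.
  move=> i y cy; have := @close (e / G) i y; rewrite divfK ?gt_eqF // divr_gt0 // => h; exact: h.
have gu : glued T u.
  move=> i j x' t tT; rewrite /u /S; congr inf.
  by apply/seteqP; split=> a [e e0 ->]; exists e => //; have [[g _] _ _ _] := hF e e0; rewrite (g i j).
have bU : junction_BUC T u.
  apply: uniform_limit_BUC => // e /approx[e' e'0 h]; exists (F e') => //.
  by have [] := hF e' e'0.
exists u; split=> //.
- apply: uniform_limit_jet_sub => // e /approx[e' e'0 h]; exists (F e') => //.
  by have [] := hF e' e'0.
- apply: uniform_limit_jet_sub => //; first by move=> i; exact: dual_ham_unif.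
    exact: (junction_BUCN bU).1.
  move=> e /approx[e' e'0 h]; have [b _ s _] := hF e' e'0.
  exists (fun i y => - F e' i y); first by split; [exact: junction_BUCN|].
  by move=> i y cy; rewrite -opprD normrN; exact: h.
- move=> i x hx; have cx0 : cylinder T (x, 0) by split=> //=; rewrite lexx.
  apply/eqP; rewrite -subr_eq0 -normr_le0; apply/ler_addgt0Pr => e e0; rewrite add0r.
  have G1 : 0 < G + 1 by rewrite ltr_wpDl // ltW.
  have e1 : 0 < e / (G + 1) by rewrite divr_gt0.
  have [_ _ _ iF] := hF _ e1; have /andP[h1 h2] := iF i x hx.
  have h3 := close _ i _ e1 cx0.
  have : e / (G + 1) * G + e / (G + 1) = e by rewrite -{2}[e / (G + 1)]mulr1 -mulrDr divfK // gt_eqF.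
  move: h3 h1 h2; rewrite !ler_norml => /andP[h3 h4].
  by move: h3 h4; move: (e / (G + 1) * G) (e / (G + 1)) => *; apply/andP; split; lra.
Qed.

End Limit.

(** * Well-posedness *)

Lemma lipschitz_bound_exists (R : realType) (d K : nat) (T : R)
    (H : 'I_K -> spoint R d -> R -> spoint R d -> R -> R) :
  (forall i, lipschitz_ham T (H i)) ->
  exists2 Lam : R, 0 <= Lam & forall i, lipschitz_bound T Lam (H i).
Proof.
move=> hl; apply: (common_bound (P := fun i Lam => lipschitz_bound T Lam (H i))) => //.
move=> i C C' CC' h p b c x s t cs ct; apply: le_trans (h p b c x s t cs ct) _.
by rewrite ler_wpM2r // addr_ge0.
Qed.

Theorem theorem2p1 (R : realType) (d K : nat) (hd : (1 <= d)%N)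
    (hK : (1 <= K)%N) (T B : R) (hT : 0 < T)
    (H : 'I_K -> spoint R d -> R -> spoint R d -> R -> R)
    (Hcoer : forall i : 'I_K, coercive_ham T (H i))
    (Hlip : forall i : 'I_K, lipschitz_ham T (H i))
    (Hunif : forall i : 'I_K, unif_continuous_ham T (H i)) :
  (forall u v : 'I_K -> stpoint R d -> R,
      junction_BUC T u -> junction_BUC T v ->
      sub_solution T B H u -> super_solution T B H v ->
      (forall (i : 'I_K) (x : spoint R d), half_space x ->
         u i (x, 0) <= v i (x, 0)) ->
      forall (i : 'I_K) (z : stpoint R d), cylinder T z -> u i z <= v i z)
  /\
  ((forall i : 'I_K, bounded_ham T (H i)) ->
   forall u0 : 'I_K -> spoint R d -> R, junction_BUC0 u0 ->
   exists u : 'I_K -> stpoint R d -> R,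
     [/\ junction_BUC T u, solution T B H u,
         (forall (i : 'I_K) (x : spoint R d), half_space x ->
            u i (x, 0) = u0 i x) &
         forall v : 'I_K -> stpoint R d -> R,
           junction_BUC T v -> solution T B H v ->
           (forall (i : 'I_K) (x : spoint R d), half_space x ->
              v i (x, 0) = u0 i x) ->
           forall (i : 'I_K) (z : stpoint R d), cylinder T z -> v i z = u i z]).
Proof.
have [Lam Lam0 hl] := lipschitz_bound_exists Hlip.
have adm : admissible T Lam H by split => //; exact: ltW.
split=> [u v bu bv su sv uv0|hb u0 bu0]; first by move=> i z; exact: (comparison_solutions adm bu bv su sv uv0).
have [u [bu su du iu]] := existence B hT adm hb bu0.
have hT' := ltW hT.
have ss : sub_solution T B H u by apply/sub_solutionP.
have sp : super_solution T B H u by apply/super_solutionP.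
exists u; split=> // v bv [sv pv] iv i z cz; apply/eqP; rewrite eq_le; apply/andP; split.
  by apply: (comparison_solutions adm bv bu sv sp) => // j x hx; rewrite iv // iu.
by apply: (comparison_solutions adm bu bv ss pv) => // j x hx; rewrite iv // iu.
Qed.
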